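(* Let $j>0$, let $\rho_{\rm init}\in C([0,1],\mathbb R_+)$ with $\int_0^1\rho_{\rm init}(r)dr=M$, and let $\rho_t$ be the hydrodynamic limit started from $\rho_{\rm init}$. Then $$\lim_{t\to\infty}\sup_{r\in[0,1]}\big|F(r;\rho_t)-F(r;\rho^{(M)})\big|=0.$$
   Context: Particle system: fix $j>0$. For $\varepsilon>0$ with $\varepsilon^{-1}$ a positive integer let $\Lambda_\varepsilon=\{0,1,\dots,\varepsilon^{-1}\}$; configurations are $\xi\in\mathbb N^{\Lambda_\varepsilon}$. The process $(\xi_t)_{t\ge0}$ is the Markov jump process with generator $L=L^0+L_b+L_a$, where $L^0f(\xi)=\frac12\sum_{x=0}^{\varepsilon^{-1}-1}[\xi(x)(f(\xi^{x,x+1})-f(\xi))+\xi(x+1)(f(\xi^{x+1,x})-f(\xi))]$ ($\xi^{x,y}$: one particle moved from $x$ to $y$), $L_bf(\xi)=j\varepsilon(f(\xi^+)-f(\xi))$ with $\xi^+(x)=\xi(x)+\mathbf 1_{x=0}$, $L_af(\xi)=j\varepsilon(f(\xi^-)-f(\xi))$ with $\xi^-(x)=\xi(x)-\mathbf 1_{x=R_\xi}$, $R_\xi=\max\{y:\xi(y)>0\}$ ($L_af=0$ if $\xi\equiv0$). $P^{(\varepsilon)}_\xi$ is the law started from $\xi$. Notation: $F(r;u)=\int_r^1u(r')dr'$, $F_\varepsilon(x;\xi)=\sum_{y\ge x}\xi(y)$, $\mathcal A_\ell(x,\xi)=\frac1\ell\sum_{y=x}^{x+\ell-1}\xi(y)$,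 $\mathcal A'_\ell(x,\rho)=\frac1{\varepsilon\ell}\int_{\varepsilon x}^{\varepsilon(x+\ell)}\rho$. Admissible initial data: the edge of $\rho_{\rm init}$ (if it exists) is $R(0)=\min\{r:\rho_{\rm init}=0\text{ on }[r,1]\}$; with fixed $b<1$ close to $1$, $a>0$ small, $\ell=\lfloor\varepsilon^{-b}\rfloor$, a family $\xi=\xi^{(\varepsilon)}$ approximates $\rho_{\rm init}$ if $\max_{x\in[0,\varepsilon^{-1}-\ell+1]}|\mathcal A_\ell(x,\xi)-\mathcal A'_\ell(x,\rho_{\rm init})|\le\varepsilon^a$ and, if the edge exists, $|\varepsilon R_\xi-R(0)|\le\varepsilon^a$. Hydrodynamic limit (known from earlier work): there is $\rho_t(r)\ge0$, continuous in $(t,r)$, $\rho_0=\rho_{\rm init}$, such that for every approximating family $\xi$ and all $\zeta>0$, $t\ge0$: $\lim_{\varepsilon\to0}P^{(\varepsilon)}_\xi[\max_{x}|\varepsilon F_\varepsilon(x;\xi_{\varepsilon^{-2}t})-F(\varepsilon x;\rho_t)|\le\zeta]=1$. Linear profiles: $\rho^{(0)}\equiv0$; for $0<M<j$, $\rho^{(M)}(r)=2j(R-r)\mathbf 1_{r\le R}$ with $jR^2=M$; for $M\ge j$, $\rho^{(M)}(r)=-2jr+M+j$. In all cases $\int_0^1\rho^{(M)}=M$. *)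

(* Defs.v *)
From Stdlib Require Import Reals Lra List.
From Coquelicot Require Import Coquelicot.
Import ListNotations.
Open Scope R_scope.

(** * The particle system on Lambda_eps = {0,...,n}, with n = eps^{-1}. *)

(* A configuration: number of particles at each site; only sites 0..n matter,
   and the dynamics never touches sites > n. *)
Definition config := nat -> nat.

Definition move_part (xi : config) (x y : nat) : config :=
  fun z => if Nat.eqb z x then (xi z - 1)%nat
           else if Nat.eqb z y then S (xi z) else xi z.

Definition add0 (xi : config) : config :=
  fun z => if Nat.eqb z 0 then S (xi z) else xi z.

(* R_xi = max{y <= n : xi(y) > 0}  (convention: 0 if xi = 0 on {0..n}). *)
Fixpoint edge (m : nat) (xi : config) : nat :=
  match m with
  | O => O
  | S m' => if Nat.ltb 0 (xi (S m')) then S m' else edge m' xi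
  end.

Definition nonzero (n : nat) (xi : config) : bool :=
  existsb (fun y => Nat.ltb 0 (xi y)) (seq 0 (S n)).

Definition rem_edge (n : nat) (xi : config) : config :=
  fun z => if Nat.eqb z (edge n xi) then (xi z - 1)%nat else xi z.

(* The list of (rate, target configuration) of the generator
   L = L^0 + L_b + L_a, with eps = 1/n. *)
Definition moves (j : R) (n : nat) (xi : config) : list (R * config) :=
  flat_map (fun x => [ (INR (xi x) / 2, move_part xi x (S x)) ;
                       (INR (xi (S x)) / 2, move_part xi (S x) x) ])
           (seq 0 n)
  ++ [ (j / INR n, add0 xi) ]
  ++ (if nonzero n xi then [ (j / INR n, rem_edge n xi) ] else []).

Definition qrate (j : R) (n : nat) (xi : config) : R :=
  fold_right (fun p acc => fst p + acc) 0 (moves j n xi).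

(* Pk k t xi E = P_xi[ exactly k jumps in [0,t] and xi_t in E ]
   (Feller's path expansion of the jump process). *)
Fixpoint Pk (j : R) (n : nat) (E : config -> bool) (k : nat) (t : R) (xi : config)
  {struct k} : R :=
  match k with
  | O => exp (- qrate j n xi * t) * (if E xi then 1 else 0)
  | S k' =>
      RInt (fun s => exp (- qrate j n xi * s) *
              fold_right (fun p acc => fst p * Pk j n E k' (t - s) (snd p) + acc)
                         0 (moves j n xi)) 0 t
  end.

Definition Prob (j : R) (n : nat) (E : config -> bool) (t : R) (xi : config) : R :=
  Series (fun k => Pk j n E k t xi).

Definition Fmac (r : R) (u : R -> R) : R := RInt u r 1.

Definition rsum (xi : config) (x len : nat) : R :=
  fold_right Rplus 0 (map (fun y => INR (xi y)) (seq x len)).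

Definition Feps (n x : nat) (xi : config) : R := rsum xi x (S n - x).

Definition Rle_b (a b : R) : bool := if Rle_dec a b then true else false.

Definition hdl_event (n : nat) (zeta : R) (u : R -> R) (xi : config) : bool :=
  forallb (fun x => Rle_b (Rabs (/ INR n * Feps n x xi - Fmac (INR x / INR n) u)) zeta)
          (seq 0 (S n)).

Definition ell (b : R) (n : nat) : nat := Z.to_nat (Int_part (Rpower (INR n) b)).

Definition Aell (b : R) (n x : nat) (xi : config) : R :=
  / INR (ell b n) * rsum xi x (ell b n).

Definition ext01 (u : R -> R) (r : R) : R :=
  if Rle_dec 0 r then (if Rle_dec r 1 then u r else 0) else 0.

Definition Aell' (b : R) (n x : nat) (u : R -> R) : R :=
  INR n / INR (ell b n) * RInt (ext01 u) (INR x / INR n) (INR (x + ell b n) / INR n).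

Definition is_edge (u : R -> R) (R0 : R) : Prop :=
  0 <= R0 <= 1 /\ (forall r, R0 <= r <= 1 -> u r = 0) /\
  (forall r', 0 <= r' <= 1 -> (forall r, r' <= r <= 1 -> u r = 0) -> R0 <= r').

Definition approximates (a b : R) (u : R -> R) (xi : nat -> config) : Prop :=
  exists n0 : nat, forall n : nat, (1 <= n)%nat -> (n0 <= n)%nat ->
    (forall x : nat, (x + ell b n <= S n)%nat ->
       Rabs (Aell b n x (xi n) - Aell' b n x u) <= Rpower (INR n) (- a)) /\
    (forall R0, is_edge u R0 ->
       Rabs (INR (edge n (xi n)) / INR n - R0) <= Rpower (INR n) (- a)).

Definition is_hydro_limit (j a b : R) (rho_init : R -> R) (rho : R -> R -> R) : Prop :=
  (forall t r, 0 <= t -> 0 <= r <= 1 -> 0 <= rho t r) /\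
  (forall t r, 0 <= t -> 0 <= r <= 1 ->
     filterlim (fun p : R * R => rho (fst p) (snd p))
       (within (fun p : R * R => 0 <= fst p /\ 0 <= snd p <= 1) (locally (t, r)))
       (locally (rho t r))) /\
  (forall r, 0 <= r <= 1 -> rho 0 r = rho_init r) /\
  (forall xi : nat -> config, approximates a b rho_init xi ->
     forall zeta t, 0 < zeta -> 0 <= t ->
       is_lim_seq (fun n => Prob j n (hdl_event n zeta (rho t)) (INR n ^ 2 * t) (xi n)) 1).

Definition rhoM (j M : R) (r : R) : R :=
  if Rle_dec M 0 then 0
  else if Rlt_dec M j then
         (if Rle_dec r (sqrt (M / j)) then 2 * j * (sqrt (M / j) - r) else 0)
       else -2 * j * r + M + j.

(* Main.v *)
(** The tail [f(t,r) = F(r; rho_t)] formally solves the obstacle problem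
    [f_t = f''/2 - j 1_{f>0}], [f(t,0) = M], [f(t,1) = 0], whose stationary solution is
    [F(.; rho^(M))].

    Convergence in probability is the only link between [rho_t] and the dynamics, so the equation is
    extracted from the particle system.  Feller's expansion is the minimal solution of the
    backward equation, hence bounded by every nonnegative supersolution.  The one used here is
    built from the average of the tail counts against a hat function of macroscopic width: its
    discrete Laplacian telescopes, and the squared total mass controls all remaining terms.
    As the limit is deterministic, comparing two close times gives, for the hat average [g] of
    [f], [D_t g >= g''/2 - j] always, and [D_t g <= g''/2 - j] wherever [f > 0].

    The maximum principle then squeezes [g] between
    [F(.; rho^(M)) +- ((M+1) exp(-t/4) (2 - r^2) + delta)]. *)
Require Import Defs.
From Stdlib Require Import Reals Lra Lia List ZArith Classical ClassicalEpsilon.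
From Coquelicot Require Import Coquelicot.
Import ListNotations.
Open Scope R_scope.

(** * Minimality of the path expansion *)

(** The tail counts are unbounded and the limit hypothesis says nothing about moments, so
    expectations cannot be passed to the limit. Every estimate is a Markov inequality between two
    events of probability tending to 1: a supersolution that is at least [beta] on the later event,
    and at most [a] plus a multiple of the squared mass deviation on the earlier one, forces
    [beta <= a].

    A tail count at one site has no drift bounded uniformly in [n], only its hat averages do. Hence
    two hat widths: the wide one is the observable, narrow ones replace the three site values in its
    drift, each placed on the side where monotonicity gives the right inequality.

    The absorption term [- j] is lost on configurations whose tail is empty, even where [f > 0]. The
    penalty [j / y0 ^ 2 * (Y - y0) ^ 2], with [Y] a narrow hat average and [y0 > 0] its limit,
    equals [j] when [Y = 0] and is small on typical configurations.

    With [E = (M + 1) exp(- t / 4)] the barrier has half second derivative [- E] and time derivative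
    at least [- E / 2]; the margin between the two absorbs the discretisation of time. *)

Definition wsum (l : list (R * config)) (g : config -> R) : R :=
  fold_right (fun p acc => fst p * g (snd p) + acc) 0 l.

Definition gen (j : R) (n : nat) (g : config -> R) (xi : config) : R :=
  wsum (moves j n xi) g - qrate j n xi * g xi.

Lemma wsum_ext l g h : (forall xi, g xi = h xi) -> wsum l g = wsum l h.
Proof.
  intros H; induction l as [|p l IH]; simpl; [reflexivity|].
  rewrite H; fold (wsum l g) (wsum l h); rewrite IH; reflexivity.
Qed.

Lemma wsum_plus l g h : wsum l (fun xi => g xi + h xi) = wsum l g + wsum l h.
Proof.
  induction l as [|p l IH]; simpl; [lra|].
  change (fst p * (g (snd p) + h (snd p)) + wsum l (fun xi => g xi + h xi)
    = (fst p * g (snd p) + wsum l g) + (fst p * h (snd p) + wsum l h)).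
  rewrite IH; ring.
Qed.

Lemma wsum_scal l c g : wsum l (fun xi => c * g xi) = c * wsum l g.
Proof.
  induction l as [|p l IH]; simpl; [lra|].
  change (fst p * (c * g (snd p)) + wsum l (fun xi => c * g xi)
    = c * (fst p * g (snd p) + wsum l g)).
  rewrite IH; ring.
Qed.

Lemma wsum_app l1 l2 g : wsum (l1 ++ l2) g = wsum l1 g + wsum l2 g.
Proof.
  induction l1 as [|p l IH]; simpl; [lra|].
  change (fst p * g (snd p) + wsum (l ++ l2) g = (fst p * g (snd p) + wsum l g) + wsum l2 g).
  rewrite IH; ring.
Qed.

Lemma wsum_le l g h : (forall p, In p l -> 0 <= fst p) ->
  (forall xi, g xi <= h xi) -> wsum l g <= wsum l h.
Proof.
  intros Hl H; induction l as [|p l IH]; simpl; [lra|].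
  apply Rplus_le_compat.
  - apply Rmult_le_compat_l; [apply Hl; now left | apply H].
  - apply IH; intros; apply Hl; now right.
Qed.

Lemma qrate_wsum j n xi : qrate j n xi = wsum (moves j n xi) (fun _ => 1).
Proof.
  unfold qrate; induction (moves j n xi) as [|p l IH]; simpl; [reflexivity|].
  rewrite IH; unfold wsum; simpl; ring.
Qed.

Lemma moves_rate_ge0 j n xi p : 0 < j -> (1 <= n)%nat -> In p (moves j n xi) -> 0 <= fst p.
Proof.
  intros Hj Hn Hp.
  assert (Hjn : 0 <= j / INR n).
  { apply Rdiv_le_0_compat; [lra|]. apply (lt_INR 0); lia. }
  unfold moves in Hp; rewrite !in_app_iff in Hp; destruct Hp as [Hp|[Hp|Hp]].
  - apply in_flat_map in Hp; destruct Hp as [x [_ Hp]].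
    destruct Hp as [<-|[<-|[]]]; simpl;
      (apply Rdiv_le_0_compat; [apply pos_INR | lra]).
  - destruct Hp as [<-|[]]; exact Hjn.
  - destruct (Defs.nonzero n xi); [|destruct Hp].
    destruct Hp as [<-|[]]; exact Hjn.
Qed.

Lemma continuous_wsum l (h : R -> config -> R) (s : R) :
  (forall xi, continuous (fun t => h t xi) s) -> continuous (fun t => wsum l (h t)) s.
Proof.
  intros H; induction l as [|p l IH]; simpl; [apply continuous_const|].
  apply (continuous_plus (fun t => fst p * h t (snd p)) (fun t => wsum l (h t))); [|exact IH].
  apply (continuous_scal_r (fst p) (fun t => h t (snd p))), H.
Qed.

Lemma continuous_exp_lin q s : continuous (fun t => exp (q * t)) s.
Proof.
  apply (ex_derive_continuous (fun t => exp (q * t))); auto_derive; trivial.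
Qed.

Lemma continuous_reflect (h : R -> R) (t s : R) :
  (forall s, continuous h s) -> continuous (fun s => h (t - s)) s.
Proof.
  intros H; apply (continuous_comp (fun s => t - s) h); [|apply H].
  apply (ex_derive_continuous (fun s => t - s)); auto_derive; trivial.
Qed.

Lemma continuous_integrand q (h : R -> R) t s :
  (forall s, continuous h s) -> continuous (fun s => exp (- q * s) * h (t - s)) s.
Proof.
  intros H; apply (continuous_mult (fun s => exp (- q * s)) (fun s => h (t - s))).
  - apply continuous_exp_lin.
  - now apply continuous_reflect.
Qed.

Lemma ex_RInt_integrand q (h : R -> R) t a b :
  (forall s, continuous h s) -> ex_RInt (fun s => exp (- q * s) * h (t - s)) a b.
Proof.
  intros H; apply (ex_RInt_continuous (V := R_CompleteNormedModule)).
  intros; now apply continuous_integrand.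
Qed.

(** Reversing time frees the integrand from the parameter [t], so that continuity in [t] reduces to
    the fundamental theorem of calculus. *)
Lemma RInt_duhamel q (h : R -> R) t : (forall s, continuous h s) ->
  RInt (fun s => exp (- q * s) * h (t - s)) 0 t
  = exp (- q * t) * RInt (fun u => exp (q * u) * h u) 0 t.
Proof.
  intros H.
  assert (Hc : forall s, continuous (fun u => exp (q * u) * h u) s).
  { intros s; apply (continuous_mult (fun u => exp (q * u)) h); [apply continuous_exp_lin | apply H]. }
  rewrite <- (RInt_scal (V := R_CompleteNormedModule)).
  2:{ apply (ex_RInt_continuous (V := R_CompleteNormedModule)); intros; apply Hc. }
  pose proof (RInt_comp_lin (V := R_CompleteNormedModule)
    (fun s => exp (- q * s) * h (t - s)) (-1) t 0 t) as HL.
  replace (-1 * 0 + t) with t in HL by ring.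
  replace (-1 * t + t) with 0 in HL by ring.
  rewrite <- (opp_RInt_swap (V := R_CompleteNormedModule)).
  2:{ now apply ex_RInt_integrand. }
  rewrite <- HL; [|now apply ex_RInt_integrand].
  rewrite <- (RInt_opp (V := R_CompleteNormedModule)).
  - apply RInt_ext; intros x _.
    unfold opp, scal; simpl; unfold mult; simpl.
    replace (t - (-1 * x + t)) with x by ring.
    replace (- q * (-1 * x + t)) with (- q * t + q * x) by ring.
    rewrite exp_plus; ring.
  - apply (ex_RInt_continuous (V := R_CompleteNormedModule)); intros s _.
    apply (continuous_scal_r (-1) (fun y => exp (- q * (-1 * y + t)) * h (t - (-1 * y + t)))).
    apply (continuous_ext (fun y => exp (- q * (t - y)) * h (y))).
    { assert (Hy : forall y : R, exp (- q * (t - y)) * h y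
                  = exp (- q * (-1 * y + t)) * h (t - (-1 * y + t))).
      { intros y; f_equal; f_equal; ring. }
      exact Hy. }
    apply (continuous_mult (fun y => exp (- q * (t - y))) h); [|apply H].
    apply (ex_derive_continuous (fun y => exp (- q * (t - y)))); auto_derive; trivial.
Qed.

Lemma continuous_duhamel q (h : R -> R) t : (forall s, continuous h s) ->
  continuous (fun t => RInt (fun s => exp (- q * s) * h (t - s)) 0 t) t.
Proof.
  intros H.
  apply (continuous_ext (fun t => exp (- q * t) * RInt (fun u => exp (q * u) * h u) 0 t)).
  { intros s; now rewrite RInt_duhamel. }
  assert (Hc : forall s, continuous (fun u => exp (q * u) * h u) s).
  { intros s; apply (continuous_mult (fun u => exp (q * u)) h); [apply continuous_exp_lin | apply H]. }
  apply (continuous_mult (fun t => exp (- q * t)) (fun t => RInt (fun u => exp (q * u) * h u) 0 t)).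
  - apply continuous_exp_lin.
  - apply (ex_derive_continuous (fun t => RInt (fun u => exp (q * u) * h u) 0 t)).
    exists (exp (q * t) * h t).
    apply (is_derive_RInt (fun u => exp (q * u) * h u) _ 0 t); [|apply Hc].
    exists (mkposreal 1 Rlt_0_1); intros y _.
    apply (RInt_correct (V := R_CompleteNormedModule)).
    apply (ex_RInt_continuous (V := R_CompleteNormedModule)); intros; apply Hc.
Qed.

Section Jumps.
Variables (j : R) (n : nat).
Hypotheses (Hj : 0 < j) (Hn : (1 <= n)%nat).

Lemma continuous_Pk E k t xi : continuous (fun t => Pk j n E k t xi) t.
Proof.
  revert t xi; induction k as [|k IH]; intros t xi; simpl.
  - apply (continuous_mult (fun t => exp (- qrate j n xi * t)) (fun _ => if E xi then 1 else 0)).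
    + apply continuous_exp_lin.
    + apply continuous_const.
  - apply (continuous_duhamel (qrate j n xi) (fun s => wsum (moves j n xi) (fun x => Pk j n E k s x))).
    intros s; apply continuous_wsum; intros; apply IH.
Qed.

Fixpoint psum (E : config -> bool) (K : nat) (t : R) (xi : config) : R :=
  match K with
  | O => 0
  | S K' => psum E K' t xi + Pk j n E K' t xi
  end.

Lemma continuous_psum E K t xi : continuous (fun t => psum E K t xi) t.
Proof.
  induction K as [|K IH]; simpl; [apply continuous_const|].
  apply (continuous_plus (fun t => psum E K t xi) (fun t => Pk j n E K t xi)); [exact IH|].
  apply continuous_Pk.
Qed.

Lemma continuous_wsum_psum E K xi s : continuous (fun s => wsum (moves j n xi) (psum E K s)) s.
Proof. apply continuous_wsum; intros; apply continuous_psum. Qed.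

(** Decomposition at the first jump: [psum E (S K)] counts paths with at most [K] jumps, hence at
    most [K - 1] after the first one. *)
Lemma psum_S E K t xi :
  psum E (S K) t xi = exp (- qrate j n xi * t) * (if E xi then 1 else 0)
    + RInt (fun s => exp (- qrate j n xi * s) * wsum (moves j n xi) (psum E K (t - s))) 0 t.
Proof.
  induction K as [|K IH].
  - simpl; rewrite (RInt_ext _ (fun _ => 0)).
    + rewrite RInt_const; unfold scal; simpl; unfold mult; simpl; ring.
    + intros x _. rewrite (wsum_ext _ _ (fun _ => 0 * 1)) by (intros; simpl; now rewrite Rmult_0_l).
      rewrite (wsum_scal _ 0 (fun _ => 1)), Rmult_0_l, Rmult_0_r; reflexivity.
  - change (psum E (S (S K)) t xi) with (psum E (S K) t xi + Pk j n E (S K) t xi).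
    rewrite IH.
    change (Pk j n E (S K) t xi) with
      (RInt (fun s => exp (- qrate j n xi * s) *
              wsum (moves j n xi) (fun x => Pk j n E K (t - s) x)) 0 t).
    rewrite Rplus_assoc; f_equal.
    rewrite <- (RInt_plus (V := R_CompleteNormedModule)).
    + apply RInt_ext; intros x _; unfold plus; simpl.
      rewrite <- Rmult_plus_distr_l, <- wsum_plus; reflexivity.
    + apply (ex_RInt_integrand _ (fun s => wsum (moves j n xi) (psum E K s))).
      intros; apply continuous_wsum_psum.
    + apply (ex_RInt_integrand _ (fun s => wsum (moves j n xi) (fun x => Pk j n E K s x))).
      intros; apply continuous_wsum; intros; apply continuous_Pk.
Qed.

(** The first jump is looked for in [[0, s]] only; without one, the chain restarts from [xi] with
    time [tau] left. An induction on [K] can thus carry a bound known at time [tau] to time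
    [tau + s]. *)
Lemma psum_S_restart E K tau s xi :
  psum E (S K) (tau + s) xi = exp (- qrate j n xi * s) * psum E (S K) tau xi
    + RInt (fun v => exp (- qrate j n xi * v) * wsum (moves j n xi) (psum E K (tau + (s - v)))) 0 s.
Proof.
  rewrite !psum_S. set (q := qrate j n xi). set (h := fun s => wsum (moves j n xi) (psum E K s)).
  assert (Hh : forall s, continuous h s) by (intros; apply continuous_wsum_psum).
  change (exp (- q * (tau + s)) * (if E xi then 1 else 0)
    + RInt (fun v => exp (- q * v) * h (tau + s - v)) 0 (tau + s)
    = exp (- q * s) * (exp (- q * tau) * (if E xi then 1 else 0)
       + RInt (fun v => exp (- q * v) * h (tau - v)) 0 tau)
      + RInt (fun v => exp (- q * v) * h (tau + (s - v))) 0 s).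
  rewrite <- (RInt_Chasles (V := R_CompleteNormedModule) _ 0 s (tau + s)).
  2,3: now apply ex_RInt_integrand.
  unfold plus; simpl.
  replace (RInt (fun v => exp (- q * v) * h (tau + s - v)) s (tau + s))
    with (exp (- q * s) * RInt (fun v => exp (- q * v) * h (tau - v)) 0 tau).
  - replace (- q * (tau + s)) with (- q * s + - q * tau) by ring. rewrite exp_plus.
    rewrite (RInt_ext (fun v => exp (- q * v) * h (tau + (s - v)))
                      (fun v => exp (- q * v) * h (tau + s - v))).
    { ring. }
    intros x _; f_equal; f_equal; ring.
  - pose proof (RInt_comp_lin (V := R_CompleteNormedModule)
      (fun v => exp (- q * v) * h (tau + s - v)) 1 s 0 tau) as HL.
    replace (1 * 0 + s) with s in HL by ring.
    replace (1 * tau + s) with (tau + s) in HL by ring.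
    rewrite <- HL; [|now apply ex_RInt_integrand].
    rewrite <- (RInt_scal (V := R_CompleteNormedModule)); [|now apply ex_RInt_integrand].
    apply RInt_ext; intros x _; unfold scal; simpl; unfold mult; simpl.
    replace (- q * (1 * x + s)) with (- q * s + - q * x) by ring. rewrite exp_plus.
    replace (tau + s - (1 * x + s)) with (tau - x) by ring. ring.
Qed.

Lemma psum_0 E K xi : psum E (S K) 0 xi = if E xi then 1 else 0.
Proof.
  rewrite psum_S, RInt_point, Rmult_0_r, exp_0; unfold zero; simpl; ring.
Qed.

(** Here [t] is the time still to run: [V 0] is the terminal payoff, and [V t xi] is meant to
    dominate its expectation after time [t] from [xi]. *)
Definition supersolution (V V' : R -> config -> R) (sigma : R) : Prop :=
  (forall t xi, is_derive (fun t => V t xi) t (V' t xi)) /\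
  (forall t xi, continuous (fun t => V' t xi) t) /\
  (forall t xi, 0 <= t <= sigma -> 0 <= V t xi) /\
  (forall t xi, 0 <= t <= sigma -> gen j n (V t) xi <= V' t xi).

(** The derivative of [exp (- q s) * V (t - s) xi] in [s] is [- exp (- q s) * (q V + V')], and the
    generator inequality says that [q V + V'] dominates the jump term. Integration over [[0, t]]
    gives the claim. *)
Lemma supersolution_mild V V' sigma t xi :
  supersolution V V' sigma -> 0 <= t <= sigma ->
  exp (- qrate j n xi * t) * V 0 xi
  + RInt (fun s => exp (- qrate j n xi * s) * wsum (moves j n xi) (V (t - s))) 0 t <= V t xi.
Proof.
  intros [HV [HV' [_ Hgen]]] Ht. set (q := qrate j n xi).
  assert (HcV : forall xi s, continuous (fun t => V t xi) s).
  { intros x s; apply (ex_derive_continuous (fun t => V t x)); eexists; apply HV. }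
  set (D' := fun s => - (exp (- q * s) * (q * V (t - s) xi + V' (t - s) xi))).
  assert (HD : is_RInt D' 0 t (exp (- q * t) * V (t - t) xi - exp (- q * 0) * V (t - 0) xi)).
  { apply (is_RInt_derive (V := R_CompleteNormedModule) (fun s => exp (- q * s) * V (t - s) xi)).
    - intros x _.
      assert (H1 : is_derive (fun s => V (t - s) xi) x (- V' (t - x) xi)).
      { replace (- V' (t - x) xi) with (scal (-1) (V' (t - x) xi))
          by (unfold scal; simpl; unfold mult; simpl; ring).
        apply (is_derive_comp (fun s => V s xi) (fun s => t - s)); [apply HV|].
        auto_derive; [trivial|ring]. }
      assert (H2 : is_derive (fun s => exp (- q * s)) x (- q * exp (- q * x))).
      { auto_derive; [trivial|ring]. }
      pose proof (is_derive_mult _ _ x _ _ H2 H1 Rmult_comm) as H3.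
      unfold D'; eapply filterdiff_ext_lin; [exact H3|].
      intros y; unfold scal, plus, mult; simpl; unfold mult; simpl; ring.
    - intros x _. unfold D'.
      apply (continuous_opp (V := R_NormedModule) (fun s => exp (- q * s) * (q * V (t - s) xi + V' (t - s) xi))).
      apply (continuous_integrand q (fun s => q * V s xi + V' s xi)).
      intros s; apply (continuous_plus (fun s => q * V s xi) (fun s => V' s xi)); [|auto].
      apply (continuous_scal_r q (fun s => V s xi)), HcV. }
  replace (t - t) with 0 in HD by ring. rewrite Rmult_0_r, exp_0, Rminus_0_r in HD.
  assert (Hle : RInt (fun s => exp (- q * s) * wsum (moves j n xi) (V (t - s))) 0 t
                <= RInt (fun s => opp (D' s)) 0 t).
  { apply RInt_le; [lra | | |].
    - apply (ex_RInt_integrand q (fun s => wsum (moves j n xi) (V s))).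
      intros s; apply continuous_wsum; intros; apply HcV.
    - apply (ex_RInt_opp (V := R_NormedModule)); eexists; exact HD.
    - intros s Hs. unfold opp, D'; simpl. rewrite Ropp_involutive.
      apply Rmult_le_compat_l; [left; apply exp_pos|].
      specialize (Hgen (t - s) xi ltac:(lra)); unfold gen in Hgen; fold q in Hgen; lra. }
  rewrite (RInt_opp (V := R_CompleteNormedModule)) in Hle by (eexists; exact HD).
  rewrite (is_RInt_unique _ _ _ _ HD) in Hle. unfold opp in Hle; simpl in Hle; lra.
Qed.

(* Minimality of Feller's expansion: any nonnegative supersolution of the backward
   equation dominates it.  The event [B] collects the configurations for which the bound
   at the intermediate time fails. *)
Lemma psum_comparison E B beta c tau sigma V V' :
  0 <= beta -> 0 <= c -> supersolution V V' sigma ->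
  (forall K xi, beta * psum E K tau xi <= V 0 xi + c * (if B xi : bool then 1 else 0)) ->
  forall K s xi, 0 <= s <= sigma ->
    beta * psum E K (tau + s) xi <= V s xi + c * psum B K s xi.
Proof.
  intros Hb Hc HV H0 K; induction K as [|K IH]; intros s xi Hs.
  - simpl; destruct HV as [_ [_ [Hp _]]]; specialize (Hp s xi Hs); lra.
  - rewrite psum_S_restart, (psum_S B). set (q := qrate j n xi).
    pose proof (supersolution_mild V V' sigma s xi HV Hs) as Hm; fold q in Hm.
    assert (HcV : forall xi s, continuous (fun t => V t xi) s).
    { intros x s'; apply (ex_derive_continuous (fun t => V t x)).
      destruct HV as [HV _]; eexists; apply HV. }
    assert (Hi : beta * RInt (fun v => exp (- q * v) * wsum (moves j n xi) (psum E K (tau + (s - v)))) 0 s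
       <= RInt (fun v => exp (- q * v) * wsum (moves j n xi) (V (s - v))) 0 s
          + c * RInt (fun v => exp (- q * v) * wsum (moves j n xi) (psum B K (s - v))) 0 s).
    { assert (E1 : ex_RInt (fun v => exp (- q * v) * wsum (moves j n xi) (psum E K (tau + (s - v)))) 0 s).
      { apply (ex_RInt_integrand q (fun v => wsum (moves j n xi) (psum E K (tau + v)))).
        intros v; apply continuous_wsum; intros x.
        apply (continuous_comp (fun v => tau + v) (fun v => psum E K v x)).
        - apply (ex_derive_continuous (fun v => tau + v)); auto_derive; trivial.
        - apply continuous_psum. }
      assert (E2 : ex_RInt (fun v => exp (- q * v) * wsum (moves j n xi) (V (s - v))) 0 s).
      { apply (ex_RInt_integrand q (fun v => wsum (moves j n xi) (V v))).
        intros v; apply continuous_wsum; intros; apply HcV. }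
      assert (E3 : ex_RInt (fun v => exp (- q * v) * wsum (moves j n xi) (psum B K (s - v))) 0 s).
      { apply (ex_RInt_integrand q (fun v => wsum (moves j n xi) (psum B K v))).
        intros; apply continuous_wsum_psum. }
      change (scal beta (RInt (fun v => exp (- q * v) * wsum (moves j n xi) (psum E K (tau + (s - v)))) 0 s)
       <= plus (RInt (fun v => exp (- q * v) * wsum (moves j n xi) (V (s - v))) 0 s)
          (scal c (RInt (fun v => exp (- q * v) * wsum (moves j n xi) (psum B K (s - v))) 0 s))).
      rewrite <- !(RInt_scal (V := R_CompleteNormedModule)) by assumption.
      rewrite <- (RInt_plus (V := R_CompleteNormedModule)).
      2: assumption. 2: now apply (ex_RInt_scal (V := R_NormedModule)).
      apply RInt_le; [lra | now apply (ex_RInt_scal (V := R_NormedModule)) | |].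
      { apply (ex_RInt_plus (V := R_NormedModule)); [assumption|].
        now apply (ex_RInt_scal (V := R_NormedModule)). }
      intros v Hv; unfold plus, scal; simpl; unfold mult; simpl.
      replace (beta * (exp (- q * v) * wsum (moves j n xi) (psum E K (tau + (s - v)))))
        with (exp (- q * v) * (beta * wsum (moves j n xi) (psum E K (tau + (s - v))))) by ring.
      replace (exp (- q * v) * wsum (moves j n xi) (V (s - v)) +
               c * (exp (- q * v) * wsum (moves j n xi) (psum B K (s - v))))
        with (exp (- q * v) * (wsum (moves j n xi) (V (s - v)) + c * wsum (moves j n xi) (psum B K (s - v)))) by ring.
      apply Rmult_le_compat_l; [left; apply exp_pos|].
      rewrite <- !wsum_scal, <- wsum_plus; apply wsum_le.
      + intros p Hp; now apply (moves_rate_ge0 j n xi).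
      + intros x; apply IH; lra. }
    specialize (H0 (S K) xi).
    apply (Rmult_le_compat_l (exp (- q * s))) in H0; [|left; apply exp_pos].
    lra.
Qed.

Lemma supersolution_one sigma : supersolution (fun _ _ => 1) (fun _ _ => 0) sigma.
Proof.
  split; [|split; [|split]]; intros.
  - apply (is_derive_const (V := R_NormedModule) 1).
  - apply continuous_const.
  - lra.
  - unfold gen; rewrite qrate_wsum; lra.
Qed.

(** The expansion is additive in the event and the constant 1 is a supersolution. This is how a
    probability close to 1 for an event becomes an upper bound for its complement. *)
Lemma psum_compl E K t xi :
  0 <= t -> psum E K t xi + psum (fun x => negb (E x)) K t xi <= 1.
Proof.
  intros Ht. apply Rle_trans with (psum (fun _ => true) K t xi).
  - right; revert t xi Ht; induction K as [|K IH]; intros t xi Ht; [simpl; ring|].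
    rewrite !psum_S.
    rewrite (RInt_ext (fun s => _ * wsum _ (psum (fun _ => true) K (t - s)))
      (fun s => plus (exp (- qrate j n xi * s) * wsum (moves j n xi) (psum E K (t - s)))
         (exp (- qrate j n xi * s) * wsum (moves j n xi) (psum (fun x => negb (E x)) K (t - s))))).
    + rewrite (RInt_plus (V := R_CompleteNormedModule)).
      * unfold plus; simpl; destruct (E xi); simpl; ring.
      * apply (ex_RInt_integrand _ (fun v => wsum (moves j n xi) (psum E K v))).
        intros; apply continuous_wsum_psum.
      * apply (ex_RInt_integrand _ (fun v => wsum (moves j n xi) (psum (fun x => negb (E x)) K v))).
        intros; apply continuous_wsum_psum.
    + intros s Hs; rewrite Rmin_left, Rmax_right in Hs by lra.
      unfold plus; simpl; rewrite <- Rmult_plus_distr_l, <- wsum_plus; f_equal.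
      apply wsum_ext; intros x; symmetry; apply IH; lra.
  - pose proof (psum_comparison (fun _ => true) (fun _ => true) 1 0 0 t
      (fun _ _ => 1) (fun _ _ => 0) ltac:(lra) ltac:(lra) (supersolution_one t)) as H.
    specialize (H ltac:(intros [|K'] x; [simpl; lra | rewrite psum_0; lra]) K t xi ltac:(lra)).
    rewrite Rplus_0_l in H; lra.
Qed.

Lemma Pk_ge0 E k t xi : 0 <= t -> 0 <= Pk j n E k t xi.
Proof.
  revert t xi; induction k as [|k IH]; intros t xi Ht; simpl.
  - apply Rmult_le_pos; [left; apply exp_pos | destruct (E xi); lra].
  - apply RInt_ge_0; [lra| |].
    + apply (ex_RInt_integrand _ (fun s => wsum (moves j n xi) (fun x => Pk j n E k s x))).
      intros; apply continuous_wsum; intros; apply continuous_Pk.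
    + intros s Hs; apply Rmult_le_pos; [left; apply exp_pos|].
      assert (H : forall p, In p (moves j n xi) -> 0 <= fst p)
        by (intros p Hp; now apply (moves_rate_ge0 j n xi)).
      revert H; induction (moves j n xi) as [|p l IHl]; intros H; simpl; [lra|].
      apply Rplus_le_le_0_compat.
      * apply Rmult_le_pos; [apply H; now left | apply IH; lra].
      * apply IHl; intros; apply H; now right.
Qed.

Lemma is_lim_psum E t xi : 0 <= t -> is_lim_seq (fun K => psum E K t xi) (Prob j n E t xi).
Proof.
  intros Ht.
  assert (Hs : forall K, sum_n (fun k => Pk j n E k t xi) K = psum E (S K) t xi).
  { induction K as [|K IH]; [rewrite sum_O; simpl; ring|].
    rewrite sum_Sn, IH; reflexivity. }
  assert (Hex : ex_finite_lim_seq (fun K => psum E K t xi)).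
  { apply (ex_finite_lim_seq_incr _ 1).
    - intros K; simpl; pose proof (Pk_ge0 E K t xi Ht); lra.
    - intros K. pose proof (psum_compl E K t xi Ht).
      assert (0 <= psum (fun x => negb (E x)) K t xi); [|lra].
      induction K as [|K IH]; simpl; [lra|].
      pose proof (psum_compl E K t xi Ht). specialize (IH ltac:(lra)).
      pose proof (Pk_ge0 (fun x => negb (E x)) K t xi Ht); lra. }
  destruct Hex as [l Hl].
  replace (Prob j n E t xi) with l; [exact Hl|].
  symmetry; unfold Prob, Series.
  rewrite (Lim_seq_ext _ (fun K => psum E (S K) t xi)) by exact Hs.
  rewrite (is_lim_seq_unique _ l); [reflexivity|].
  now apply (is_lim_seq_incr_1 (fun K => psum E K t xi)).
Qed.

(** Two comparisons in a row: [V] covers the last stretch [tau], [W] the first stretch [s]. At the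
    intermediate time, configurations outside [G] are paid for at price [c], and the complement of
    [G] has probability at most one minus that of [G]. *)
Lemma Prob_two_step (E G : config -> bool) beta c tau s V V' W W' xi :
  0 <= beta -> 0 <= c -> 0 <= tau -> 0 <= s ->
  supersolution V V' tau -> supersolution W W' s ->
  (forall x, beta * (if E x : bool then 1 else 0) <= V 0 x) ->
  (forall x, V tau x <= W 0 x + c * (if G x : bool then 0 else 1)) ->
  beta * Prob j n E (s + tau) xi + c * Prob j n G s xi <= W s xi + c.
Proof.
  intros Hb Hc Ht Hs HV HW H0 H1.
  assert (HE : forall K x, beta * psum E K tau x <= W 0 x + c * (if negb (G x) then 1 else 0)).
  { intros K x.
    pose proof (psum_comparison E E beta 0 0 tau V V' Hb (Rle_refl 0) HV) as H.
    specialize (H ltac:(intros [|K'] y;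
      [pose proof (proj1 (proj2 (proj2 HV)) 0 y ltac:(lra)); simpl; lra
      | rewrite psum_0; specialize (H0 y); lra]) K tau x ltac:(lra)).
    rewrite Rplus_0_l in H. specialize (H1 x). destruct (G x); simpl in *; lra. }
  pose proof (psum_comparison E (fun x => negb (G x)) beta c tau s W W' Hb Hc HW HE) as HK.
  assert (Hlim : is_lim_seq (fun K => beta * psum E K (s + tau) xi + c * psum G K s xi)
     (beta * Prob j n E (s + tau) xi + c * Prob j n G s xi)).
  { apply (is_lim_seq_plus' (fun K => beta * psum E K (s + tau) xi) (fun K => c * psum G K s xi)).
    - apply (is_lim_seq_scal_l _ beta (Prob j n E (s + tau) xi)), is_lim_psum; lra.
    - apply (is_lim_seq_scal_l _ c (Prob j n G s xi)), is_lim_psum; lra. }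
  refine (is_lim_seq_le _ (fun _ => W s xi + c) (Finite _) (Finite _) _ Hlim
    (is_lim_seq_const (W s xi + c))).
  intros K. specialize (HK K s xi ltac:(lra)).
    pose proof (psum_compl G K s xi Hs) as H.
    apply (Rmult_le_compat_l c) in H; [|lra].
  rewrite (Rplus_comm s tau). lra.
Qed.

End Jumps.

(** * Drift of the tail counts *)

Fixpoint bsum (f : nat -> R) (m : nat) : R :=
  match m with O => 0 | S m' => bsum f m' + f m' end.

Lemma bsum_ext f g m : (forall i, (i < m)%nat -> f i = g i) -> bsum f m = bsum g m.
Proof. intros H; induction m as [|m IH]; simpl; [reflexivity|]. rewrite IH, H; auto. Qed.

Lemma bsum_plus f g m : bsum (fun i => f i + g i) m = bsum f m + bsum g m.
Proof. induction m as [|m IH]; simpl; [ring|]. rewrite IH; ring. Qed.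

Lemma bsum_scal c f m : bsum (fun i => c * f i) m = c * bsum f m.
Proof. induction m as [|m IH]; simpl; [ring|]. rewrite IH; ring. Qed.

Lemma bsum_const c m : bsum (fun _ => c) m = INR m * c.
Proof. induction m as [|m IH]; [simpl; ring|]. rewrite S_INR; simpl; rewrite IH; ring. Qed.

Lemma bsum_le f g m : (forall i, (i < m)%nat -> f i <= g i) -> bsum f m <= bsum g m.
Proof.
  intros H; induction m as [|m IH]; simpl; [lra|].
  apply Rplus_le_compat; [apply IH; intros; apply H; lia | apply H; lia].
Qed.

Lemma bsum_tele f m : bsum (fun i => f (S i) - f i) m = f m - f O.
Proof. induction m as [|m IH]; simpl; [ring|]. rewrite IH; ring. Qed.

(** The value [i + k] occurs with triangular multiplicity, so this is summation against a discrete
    hat of base [2 m] and height [m]. *)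
Definition bsum2 (f : nat -> R) (m : nat) : R := bsum (fun i => bsum (fun k => f (i + k)%nat) m) m.

Lemma bsum2_ext f g m : (forall i, (S i < 2 * m)%nat -> f i = g i) -> bsum2 f m = bsum2 g m.
Proof. intros H; apply bsum_ext; intros i Hi; apply bsum_ext; intros k Hk; apply H; lia. Qed.

Lemma bsum2_le f g m : (forall i, (S i < 2 * m)%nat -> f i <= g i) -> bsum2 f m <= bsum2 g m.
Proof. intros H; apply bsum_le; intros i Hi; apply bsum_le; intros k Hk; apply H; lia. Qed.

Lemma bsum2_plus f g m : bsum2 (fun i => f i + g i) m = bsum2 f m + bsum2 g m.
Proof.
  unfold bsum2; rewrite <- bsum_plus; apply bsum_ext; intros i _.
  apply (bsum_plus (fun k => f (i + k)%nat) (fun k => g (i + k)%nat)).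
Qed.

Lemma bsum2_scal c f m : bsum2 (fun i => c * f i) m = c * bsum2 f m.
Proof.
  unfold bsum2; rewrite <- bsum_scal; apply bsum_ext; intros i _.
  apply (bsum_scal c (fun k => f (i + k)%nat)).
Qed.

Lemma bsum2_const c m : bsum2 (fun _ => c) m = INR m ^ 2 * c.
Proof. unfold bsum2; rewrite (bsum_ext _ (fun _ => INR m * c)), bsum_const; [ring|].
  intros; apply bsum_const. Qed.

(** The sum over [k] reduces second differences to first differences, the sum over [i] reduces these
    to values at three sites. This is what singles out the hat as the weight. *)
Lemma bsum2_laplacian f m :
  bsum2 (fun i => f i - 2 * f (S i) + f (S (S i))) m = f O - 2 * f m + f (2 * m)%nat.
Proof.
  unfold bsum2.
  rewrite (bsum_ext _ (fun i => (f (S i + m)%nat - f (i + m)%nat) + -1 * (f (S i) - f i))).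
  - rewrite bsum_plus, bsum_scal, (bsum_tele f), (bsum_tele (fun i => f (i + m)%nat)); simpl.
    replace (m + (m + 0))%nat with (m + m)%nat by lia. ring.
  - intros i _. rewrite (bsum_ext _ (fun k => (f (S (i + S k)) - f (i + S k)%nat) - (f (S (i + k)) - f (i + k)%nat))).
    + rewrite (bsum_tele (fun k => f (S (i + k)) - f (i + k)%nat)).
      rewrite Nat.add_0_r; simpl; ring.
    + intros k _. rewrite Nat.add_succ_r; ring.
Qed.

(** For each [i] at most one [k] satisfies [i + k = y]. *)
Lemma bsum2_indicator_le y m : bsum2 (fun i => if Nat.eqb i y then 1 else 0) m <= INR m.
Proof.
  unfold bsum2; rewrite <- (Rmult_1_r (INR m)), <- bsum_const; apply bsum_le; intros i _.
  assert (H : forall p, bsum (fun k => if Nat.eqb (i + k) y then 1 else 0) p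
            <= if Nat.ltb y (i + p) then 1 else 0).
  { induction p as [|p IH]; simpl.
    - destruct (Nat.ltb_spec y (i + 0)); lra.
    - destruct (Nat.ltb_spec y (i + p)), (Nat.ltb_spec y (i + S p)), (Nat.eqb_spec (i + p) y);
        try lia; lra. }
  eapply Rle_trans; [apply H|]. destruct (Nat.ltb y (i + m)); lra.
Qed.

Lemma wsum_moves j n xi h :
  wsum (moves j n xi) h =
  bsum (fun x => INR (xi x) / 2 * h (move_part xi x (S x))
               + INR (xi (S x)) / 2 * h (move_part xi (S x) x)) n
  + j / INR n * h (add0 xi)
  + (if Defs.nonzero n xi then j / INR n * h (rem_edge n xi) else 0).
Proof.
  unfold moves; rewrite !wsum_app.
  replace (wsum (flat_map _ (seq 0 n)) h) with
    (bsum (fun x => INR (xi x) / 2 * h (move_part xi x (S x))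
               + INR (xi (S x)) / 2 * h (move_part xi (S x) x)) n).
  - destruct (Defs.nonzero n xi); unfold wsum; simpl; ring.
  - generalize n; intros m; induction m as [|m IH]; [reflexivity|].
    rewrite seq_S, flat_map_app, wsum_app, <- IH; unfold wsum; simpl; ring.
Qed.

Lemma gen_diff j n g xi : gen j n g xi = wsum (moves j n xi) (fun x => g x - g xi).
Proof.
  unfold gen; rewrite qrate_wsum.
  rewrite (wsum_ext _ (fun x => g x - g xi) (fun x => g x + - g xi * 1)) by (intros; ring).
  rewrite wsum_plus, (wsum_scal _ (- g xi) (fun _ => 1)); ring.
Qed.

Lemma gen_ext j n g h xi : (forall x, g x = h x) -> gen j n g xi = gen j n h xi.
Proof. intros H; unfold gen; rewrite H, (wsum_ext _ g h); auto. Qed.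

Lemma gen_plus j n g h xi : gen j n (fun x => g x + h x) xi = gen j n g xi + gen j n h xi.
Proof. unfold gen; rewrite wsum_plus; ring. Qed.

Lemma gen_scal j n c g xi : gen j n (fun x => c * g x) xi = c * gen j n g xi.
Proof. unfold gen; rewrite wsum_scal; ring. Qed.

Lemma gen_const j n c xi : gen j n (fun _ => c) xi = 0.
Proof.
  rewrite gen_diff, (wsum_ext _ _ (fun _ => 0 * 1)) by (intros; ring).
  rewrite (wsum_scal _ 0 (fun _ => 1)); ring.
Qed.

Lemma gen_bsum j n (g : nat -> config -> R) m xi :
  gen j n (fun x => bsum (fun i => g i x) m) xi = bsum (fun i => gen j n (g i) xi) m.
Proof.
  induction m as [|m IH]; simpl; [apply gen_const|].
  rewrite (gen_plus j n (fun x => bsum (fun i => g i x) m) (g m)), IH; reflexivity.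
Qed.

(** The last term is the carre du champ of [g]; it sees increments only and therefore does not
    involve [c]. *)
Lemma gen_sqr j n g c xi :
  gen j n (fun x => (g x - c) ^ 2) xi
  = 2 * (g xi - c) * gen j n g xi + wsum (moves j n xi) (fun x => (g x - g xi) ^ 2).
Proof.
  rewrite !gen_diff.
  rewrite <- wsum_scal, <- wsum_plus; apply wsum_ext; intros; ring.
Qed.

Lemma rsum_S xi x len : rsum xi x (S len) = INR (xi x) + rsum xi (S x) len.
Proof. reflexivity. Qed.

Lemma Feps_step n y xi : (y <= n)%nat -> Feps n y xi = INR (xi y) + Feps n (S y) xi.
Proof.
  intros H; unfold Feps. replace (S n - y)%nat with (S (S n - S y)) by lia. apply rsum_S.
Qed.

Lemma Feps_last n y xi : (n < y)%nat -> Feps n y xi = 0.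
Proof. intros H; unfold Feps. now replace (S n - y)%nat with 0%nat by lia. Qed.

(** Induction from the right end, the direction in which [Feps_step] unfolds a tail count; beyond
    site [n] the tail is empty. *)
Lemma Feps_ind n (Q : nat -> Prop) :
  (forall y, (n < y)%nat -> Q y) -> (forall y, (y <= n)%nat -> Q (S y) -> Q y) -> forall y, Q y.
Proof.
  intros H0 H1 y. remember (S n - y)%nat as d eqn:Hd; revert y Hd.
  induction d as [|d IH]; intros y Hd; [apply H0; lia|].
  apply H1; [lia|]. apply IH; lia.
Qed.

Lemma Feps_ge0 n y xi : 0 <= Feps n y xi.
Proof.
  revert y; apply (Feps_ind n); intros y Hy.
  - rewrite Feps_last by assumption; lra.
  - intros IH; rewrite Feps_step by assumption. pose proof (pos_INR (xi y)); lra.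
Qed.

Lemma Feps_decr n y z xi : (y <= z)%nat -> Feps n z xi <= Feps n y xi.
Proof.
  intros H; induction H as [|z H IH]; [lra|].
  destruct (Nat.le_gt_cases z n) as [Hz|Hz].
  - rewrite (Feps_step n z) in IH by assumption. pose proof (pos_INR (xi z)); lra.
  - rewrite (Feps_last n (S z)) by lia. apply Feps_ge0.
Qed.

Lemma Feps_hop_right n x z xi : (x < n)%nat -> (0 < xi x)%nat ->
  Feps n z (move_part xi x (S x)) = Feps n z xi + (if Nat.eqb z (S x) then 1 else 0).
Proof.
  intros Hx Hp; revert z; apply (Feps_ind n); intros y Hy.
  - rewrite !Feps_last by assumption. destruct (Nat.eqb_spec y (S x)); [lia|lra].
  - intros IH; rewrite (Feps_step n y xi), (Feps_step n y), IH by assumption. unfold move_part.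
    destruct (Nat.eqb_spec y x), (Nat.eqb_spec y (S x)), (Nat.eqb_spec (S y) (S x));
      try lia; subst; rewrite ?minus_INR, ?S_INR by lia; simpl; lra.
Qed.

Lemma Feps_hop_left n x z xi : (x < n)%nat -> (0 < xi (S x))%nat ->
  Feps n z (move_part xi (S x) x) = Feps n z xi - (if Nat.eqb z (S x) then 1 else 0).
Proof.
  intros Hx Hp; revert z; apply (Feps_ind n); intros y Hy.
  - rewrite !Feps_last by assumption. destruct (Nat.eqb_spec y (S x)); [lia|lra].
  - intros IH; rewrite (Feps_step n y xi), (Feps_step n y), IH by assumption. unfold move_part.
    destruct (Nat.eqb_spec y x), (Nat.eqb_spec y (S x)), (Nat.eqb_spec (S y) (S x));
      try lia; subst; rewrite ?minus_INR, ?S_INR by lia; simpl; lra.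
Qed.

Lemma Feps_add0 n z xi : Feps n z (add0 xi) = Feps n z xi + (if Nat.eqb z 0 then 1 else 0).
Proof.
  revert z; apply (Feps_ind n); intros y Hy.
  - rewrite !Feps_last by assumption. destruct (Nat.eqb_spec y 0); [lia|lra].
  - intros IH; rewrite (Feps_step n y xi), (Feps_step n y), IH by assumption. unfold add0.
    destruct (Nat.eqb_spec y 0), (Nat.eqb_spec (S y) 0); try lia; rewrite ?S_INR; lra.
Qed.

Lemma edge_spec m xi :
  (edge m xi <= m)%nat /\ (forall y, (edge m xi < y <= m)%nat -> xi y = 0%nat) /\
  ((exists y, (y <= m)%nat /\ (0 < xi y)%nat) -> (0 < xi (edge m xi))%nat).
Proof.
  induction m as [|m [IH1 [IH2 IH3]]]; simpl.
  - repeat split; [lia | intros; lia |].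
    intros [y [Hy Hp]]; now replace y with 0%nat in Hp by lia.
  - destruct (Nat.ltb_spec 0 (xi (S m))) as [H|H]; repeat split; try lia.
    + intros y Hy. destruct (Nat.eq_dec y (S m)) as [->|Hne]; [lia|]. apply IH2; lia.
    + intros [y [Hy Hp]]. apply IH3; exists y; split; [|assumption].
      destruct (Nat.eq_dec y (S m)) as [->|Hne]; lia.
Qed.

Lemma nonzero_spec n xi : Defs.nonzero n xi = true <-> exists y, (y <= n)%nat /\ (0 < xi y)%nat.
Proof.
  unfold Defs.nonzero; rewrite existsb_exists; split; intros [y [H1 H2]]; exists y.
  - apply in_seq in H1. apply Nat.ltb_lt in H2. split; [lia|assumption].
  - split; [apply in_seq; lia | now apply Nat.ltb_lt].
Qed.

Lemma Feps_rem_edge n z xi : Defs.nonzero n xi = true ->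
  Feps n z (rem_edge n xi) = Feps n z xi - (if Nat.leb z (edge n xi) then 1 else 0).
Proof.
  intros Hnz; apply nonzero_spec in Hnz.
  destruct (edge_spec n xi) as [He1 [_ He2]]; specialize (He2 Hnz).
  revert z; apply (Feps_ind n); intros y Hy.
  - rewrite !Feps_last by assumption. destruct (Nat.leb_spec y (edge n xi)); [lia|lra].
  - intros IH; rewrite (Feps_step n y xi), (Feps_step n y), IH by assumption. unfold rem_edge.
    destruct (Nat.eqb_spec y (edge n xi)) as [He|He].
    + rewrite <- He in *; rewrite minus_INR by lia.
      destruct (Nat.leb_spec (S y) y), (Nat.leb_spec y y); try lia; simpl; lra.
    + destruct (Nat.leb_spec (S y) (edge n xi)), (Nat.leb_spec y (edge n xi)); try lia; lra.
Qed.

Lemma Feps_gt0_edge n y xi : 0 < Feps n y xi -> Defs.nonzero n xi = true /\ (y <= edge n xi)%nat.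
Proof.
  destruct (edge_spec n xi) as [He1 [He2 _]].
  revert y; apply (Feps_ind n (fun y => 0 < Feps n y xi -> _)); intros y Hy.
  - rewrite Feps_last by assumption; lra.
  - intros IH; rewrite Feps_step by assumption; intros H.
    destruct (Nat.eq_dec (xi y) 0) as [H0|H0].
    + rewrite H0 in H; simpl in H. destruct IH as [IH1 IH2]; [lra|]. split; [assumption|lia].
    + split; [apply nonzero_spec; exists y; lia|].
      destruct (Nat.le_gt_cases y (edge n xi)) as [|Hlt]; [assumption|].
      exfalso; apply H0, He2; lia.
Qed.

Definition ucum (n y : nat) (xi : config) : R := / INR n * Feps n y xi.

(** The amount by which the removal of the rightmost particle lowers the tail count at [y]: the
    microscopic counterpart of the indicator of [f > 0]. *)
Definition occ (n : nat) (xi : config) (y : nat) : R :=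
  if Defs.nonzero n xi then (if Nat.leb y (edge n xi) then 1 else 0) else 0.

Lemma occ_01 n xi y : 0 <= occ n xi y <= 1.
Proof. unfold occ; destruct (Defs.nonzero n xi), (Nat.leb y (edge n xi)); lra. Qed.

Lemma occ_gt0 n xi y z : (y <= z)%nat -> 0 < Feps n z xi -> occ n xi y = 1.
Proof.
  intros H Hp; apply Feps_gt0_edge in Hp; destruct Hp as [H1 H2]; unfold occ; rewrite H1.
  destruct (Nat.leb_spec y (edge n xi)); [reflexivity|lia].
Qed.

(** * Generator bounds for the tail counts, the total mass and the hat averages *)

Section Drift.
Variables (j : R) (n : nat).
Hypotheses (Hj : 0 < j) (Hn : (1 <= n)%nat).

Lemma INRn_gt0 : 0 < INR n.
Proof. apply (lt_INR 0); lia. Qed.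

(** Subtraction being truncated, [move_part] from an empty site would create a particle. Such a move
    has rate zero, so the target need only be computed when the site is occupied. *)
Lemma rate_mul_ext (a : nat) (p q : R) : ((0 < a)%nat -> p = q) -> INR a / 2 * p = INR a / 2 * q.
Proof.
  intros H; destruct a as [|a]; [simpl; lra|]. now rewrite H by lia.
Qed.

(** Only hops across the bond between [y] and [S y] change this tail, at net rate
    [(xi y - xi (S y)) / 2]. As [xi y] is itself a difference of tail counts, a discrete Laplacian
    appears. *)
Lemma gen_Feps_S y xi : (y < n)%nat ->
  gen j n (Feps n (S y)) xi
  = / 2 * (Feps n y xi - 2 * Feps n (S y) xi + Feps n (S (S y)) xi) - j / INR n * occ n xi (S y).
Proof.
  intros Hy. rewrite gen_diff, wsum_moves, Feps_add0.
  rewrite (bsum_ext _ (fun x => if Nat.eqb x y then (INR (xi y) - INR (xi (S y))) / 2 else 0)).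
  - assert (Hs : forall c m, bsum (fun x => if Nat.eqb x y then c else 0) m
               = if Nat.ltb y m then c else 0).
    { intros c; induction m as [|m IH]; [reflexivity|]; simpl bsum; rewrite IH.
      destruct (Nat.ltb_spec y m), (Nat.ltb_spec y (S m)), (Nat.eqb_spec m y); try lia; lra. }
    rewrite Hs. destruct (Nat.ltb_spec y n); [|lia].
    rewrite (Feps_step n y), (Feps_step n (S y)) by lia. simpl (Nat.eqb (S y) 0).
    unfold occ; destruct (Defs.nonzero n xi) eqn:Hz.
    + rewrite Feps_rem_edge, (Feps_step n (S y)) by (assumption || lia).
      destruct (Nat.leb (S y) (edge n xi)); lra.
    + lra.
  - intros x Hx.
    rewrite (rate_mul_ext (xi x) _ (if Nat.eqb (S y) (S x) then 1 else 0)).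
    2:{ intros; rewrite Feps_hop_right by assumption; ring. }
    rewrite (rate_mul_ext (xi (S x)) _ (- (if Nat.eqb (S y) (S x) then 1 else 0))).
    2:{ intros; rewrite Feps_hop_left by assumption; ring. }
    destruct (Nat.eqb_spec (S y) (S x)) as [He|He], (Nat.eqb_spec x y); try lia; subst; lra.
Qed.

Lemma gen_Feps_0 xi :
  gen j n (Feps n 0) xi = j / INR n - j / INR n * (if Defs.nonzero n xi then 1 else 0).
Proof.
  rewrite gen_diff, wsum_moves, Feps_add0.
  rewrite (bsum_ext _ (fun x => 0)).
  - rewrite bsum_const; destruct (Defs.nonzero n xi) eqn:Hz; [|simpl; lra].
    rewrite Feps_rem_edge by assumption; simpl; lra.
  - intros x Hx.
    rewrite (rate_mul_ext (xi x) _ 0), (rate_mul_ext (xi (S x)) _ 0); [lra| |].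
    + intros; rewrite Feps_hop_left by assumption; simpl; ring.
    + intros; rewrite Feps_hop_right by assumption; simpl; ring.
Qed.

(** Hops preserve the mass; creation and removal balance unless the system is empty. In that case
    the drift of the mass is positive while the mass lies below [M], so its contribution to the
    square is nonpositive. What remains is the carre du champ: total rate at most [2 j / n], jumps
    of size [1 / n]. *)
Lemma gen_mass_sqr M xi : 0 <= M ->
  INR n ^ 2 * gen j n (fun x => (ucum n 0 x - M) ^ 2) xi <= 2 * j / INR n.
Proof.
  intros HM. pose proof INRn_gt0 as Hn0.
  rewrite gen_sqr. unfold ucum. rewrite gen_scal, gen_Feps_0, wsum_moves, Feps_add0.
  rewrite (bsum_ext _ (fun x => 0)).
  - rewrite bsum_const. simpl (Nat.eqb 0 0).
    destruct (Defs.nonzero n xi) eqn:Hz.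
    + rewrite Feps_rem_edge by assumption; simpl (Nat.leb 0 _).
      right; field; lra.
    + assert (H0 : Feps n 0 xi = 0).
      { destruct (Rle_lt_or_eq_dec _ _ (Feps_ge0 n 0 xi)) as [H|H]; [|lra].
        apply Feps_gt0_edge in H; destruct H as [H _]; congruence. }
      rewrite H0.
      replace (INR n ^ 2 * _) with (- 2 * M * j + j / INR n) by (field; lra).
      replace (2 * j / INR n) with (j / INR n + j / INR n) by (field; lra).
      assert (0 < j / INR n) by (apply Rdiv_lt_0_compat; lra). nra.
  - intros x Hx.
    rewrite (rate_mul_ext (xi x) _ 0), (rate_mul_ext (xi (S x)) _ 0); [lra| |].
    + intros; rewrite Feps_hop_left by assumption; simpl; ring.
    + intros; rewrite Feps_hop_right by assumption; simpl; ring.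
Qed.

(* Average of [ucum] against the hat function supported on [b, b + 2m]. *)
Definition Hat (b m : nat) (xi : config) : R :=
  / (INR n * INR m ^ 2) * bsum2 (fun i => Feps n (S b + i) xi) m.

Variables (b m : nat).
Hypotheses (Hm : (1 <= m)%nat) (Hb : (b + 2 * m <= n)%nat).

Lemma INRm_gt0 : 0 < INR m.
Proof. apply (lt_INR 0); lia. Qed.

Lemma ucum_ge0 y xi : 0 <= ucum n y xi.
Proof.
  apply Rmult_le_pos; [|apply Feps_ge0]. left; apply Rinv_0_lt_compat, INRn_gt0.
Qed.

Lemma ucum_decr y z xi : (y <= z)%nat -> ucum n z xi <= ucum n y xi.
Proof.
  intros H; apply Rmult_le_compat_l; [|now apply Feps_decr].
  left; apply Rinv_0_lt_compat, INRn_gt0.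
Qed.

Lemma Hat_ucum xi : Hat b m xi = / INR m ^ 2 * bsum2 (fun i => ucum n (S b + i) xi) m.
Proof.
  pose proof INRn_gt0; pose proof INRm_gt0.
  unfold Hat, ucum; rewrite bsum2_scal; field; lra.
Qed.

Lemma avg_le (f g : nat -> R) : (forall i, (S i < 2 * m)%nat -> f i <= g i) ->
  / INR m ^ 2 * bsum2 f m <= / INR m ^ 2 * bsum2 g m.
Proof.
  intros H; apply Rmult_le_compat_l; [|now apply bsum2_le].
  left; apply Rinv_0_lt_compat, pow_lt, INRm_gt0.
Qed.

Lemma avg_const c : / INR m ^ 2 * bsum2 (fun _ => c) m = c.
Proof. pose proof INRm_gt0; rewrite bsum2_const; field; lra. Qed.

Lemma Hat_le xi : Hat b m xi <= ucum n b xi.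
Proof.
  rewrite Hat_ucum, <- (avg_const (ucum n b xi)); apply avg_le; intros; apply ucum_decr; lia.
Qed.

Lemma Hat_ge xi : ucum n (b + 2 * m) xi <= Hat b m xi.
Proof.
  rewrite Hat_ucum, <- (avg_const (ucum n (b + 2 * m) xi)); apply avg_le; intros; apply ucum_decr; lia.
Qed.

Lemma Hat_ge0 xi : 0 <= Hat b m xi.
Proof. eapply Rle_trans; [apply ucum_ge0 | apply Hat_ge]. Qed.

Lemma Hat_le0 xi : Hat b m xi <= ucum n 0 xi.
Proof. eapply Rle_trans; [apply Hat_le | apply ucum_decr; lia]. Qed.

Definition lap2 xi := ucum n b xi - 2 * ucum n (b + m) xi + ucum n (b + 2 * m) xi.

Lemma lap2_bounds xi : - ucum n 0 xi <= lap2 xi <= ucum n 0 xi.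
Proof.
  unfold lap2. pose proof (ucum_decr 0 b xi). pose proof (ucum_decr b (b + m) xi).
  pose proof (ucum_decr (b + m) (b + 2 * m) xi). pose proof (ucum_ge0 (b + 2 * m) xi).
  repeat match goal with H : (_ <= _)%nat -> _ |- _ => specialize (H ltac:(lia)) end. lra.
Qed.

Lemma gen_Hat xi :
  INR n ^ 2 * gen j n (Hat b m) xi
  = / 2 * (INR n / INR m) ^ 2 * lap2 xi
    - j * (/ INR m ^ 2 * bsum2 (fun i => occ n xi (S b + i)) m).
Proof.
  pose proof INRn_gt0; pose proof INRm_gt0.
  unfold Hat; rewrite gen_scal. unfold bsum2 at 1.
  rewrite (gen_bsum j n (fun i x => bsum (fun k => Feps n (S b + (i + k)) x) m)).
  rewrite (bsum_ext _ (fun i => bsum (fun k => gen j n (Feps n (S b + (i + k))) xi) m)).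
  2:{ intros i _; apply (gen_bsum j n (fun k => Feps n (S b + (i + k)))). }
  change (bsum (fun i => bsum (fun k => gen j n (Feps n (S b + (i + k))) xi) m) m)
    with (bsum2 (fun i => gen j n (Feps n (S b + i)) xi) m).
  rewrite (bsum2_ext _ (fun i => / 2 * (Feps n (b + i) xi - 2 * Feps n (b + S i) xi + Feps n (b + S (S i)) xi)
      + - (j / INR n) * occ n xi (S b + i))).
  - rewrite bsum2_plus, !bsum2_scal, (bsum2_laplacian (fun i => Feps n (b + i) xi)).
    rewrite Nat.add_0_r. unfold lap2, ucum. field; lra.
  - intros i Hi. simpl (S b + i)%nat. rewrite gen_Feps_S by lia.
    rewrite !Nat.add_succ_r. ring.
Qed.

Lemma gen_Hat_ge xi : / 2 * (INR n / INR m) ^ 2 * lap2 xi - j <= INR n ^ 2 * gen j n (Hat b m) xi.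
Proof.
  rewrite gen_Hat.
  pose proof (avg_le (fun i => occ n xi (S b + i)) (fun _ => 1) (fun i _ => proj2 (occ_01 n xi _))) as H.
  rewrite avg_const in H. nra.
Qed.

Lemma gen_Hat_le0 xi : INR n ^ 2 * gen j n (Hat b m) xi <= / 2 * (INR n / INR m) ^ 2 * lap2 xi.
Proof.
  rewrite gen_Hat.
  pose proof (avg_le (fun _ => 0) (fun i => occ n xi (S b + i)) (fun i _ => proj1 (occ_01 n xi _))) as H.
  rewrite avg_const in H. nra.
Qed.

(** A particle to the right of the whole support makes every tail count under the hat feel the
    removal. *)
Lemma gen_Hat_le xi : 0 < Feps n (b + 2 * m) xi ->
  INR n ^ 2 * gen j n (Hat b m) xi <= / 2 * (INR n / INR m) ^ 2 * lap2 xi - j.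
Proof.
  intros Hp; rewrite gen_Hat.
  assert (H : / INR m ^ 2 * bsum2 (fun i => occ n xi (S b + i)) m = 1).
  { rewrite (bsum2_ext _ (fun _ => 1)); [apply avg_const|].
    intros i Hi; apply occ_gt0 with (b + 2 * m)%nat; [lia|assumption]. }
  rewrite H; lra.
Qed.

(** A hop changes a single tail count by one, and the normalised hat gives each site weight at most
    [m / (n m ^ 2)]. *)
Lemma Hat_jump_sqr xi xi' y s : (s = 1 \/ s = -1) ->
  (forall z, Feps n z xi' = Feps n z xi + s * (if Nat.eqb z y then 1 else 0)) ->
  (Hat b m xi' - Hat b m xi) ^ 2 <= / (INR n * INR m) ^ 2.
Proof.
  intros Hs H. pose proof INRn_gt0; pose proof INRm_gt0.
  set (B := bsum2 (fun i => if Nat.eqb (S b + i) y then 1 else 0) m).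
  assert (HB : 0 <= B <= INR m).
  { split.
    - rewrite <- (Rmult_0_r (INR m ^ 2)), <- bsum2_const; apply bsum2_le; intros i _.
      destruct (Nat.eqb (S b + i) y); lra.
    - destruct (Nat.le_gt_cases (S b) y) as [Hy|Hy].
      + eapply Rle_trans; [|apply (bsum2_indicator_le (y - S b))].
        apply bsum2_le; intros i _.
        destruct (Nat.eqb_spec (S b + i) y), (Nat.eqb_spec i (y - S b)); try lia; lra.
      + apply Rle_trans with 0; [|lra].
        rewrite <- (Rmult_0_r (INR m ^ 2)), <- bsum2_const; apply bsum2_le; intros i _.
        destruct (Nat.eqb_spec (S b + i) y); [lia|lra]. }
  replace (Hat b m xi' - Hat b m xi) with (s * (/ (INR n * INR m) * (B / INR m))).
  - assert (HBm : 0 <= B / INR m <= 1).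
    { split; [apply Rdiv_le_0_compat; lra|]. apply (Rmult_le_reg_r (INR m)); [lra|]. field_simplify; lra. }
    replace ((s * (/ (INR n * INR m) * (B / INR m))) ^ 2)
      with (/ (INR n * INR m) ^ 2 * (B / INR m) ^ 2)
      by (destruct Hs; subst s; field; lra).
    assert (He : 0 < / (INR n * INR m) ^ 2) by (apply Rinv_0_lt_compat, pow_lt; nra).
    revert HBm He; generalize (B / INR m) (/ (INR n * INR m) ^ 2); intros x e Hx He.
    assert (x ^ 2 <= 1) by nra. nra.
  - unfold Hat. rewrite (bsum2_ext (fun i => Feps n (S b + i) xi')
      (fun i => Feps n (S b + i) xi + s * (if Nat.eqb (S b + i) y then 1 else 0))) by (intros; apply H).
    rewrite bsum2_plus, bsum2_scal; fold B; field; lra.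
Qed.

(** Each particle jumps with rate one half in each direction, and the two end sites have only one
    neighbour. *)
Lemma bsum_rates_le xi : bsum (fun x => INR (xi x) / 2 + INR (xi (S x)) / 2) n <= Feps n 0 xi.
Proof.
  assert (H : forall p, (p <= n)%nat ->
    bsum (fun x => INR (xi x) / 2 + INR (xi (S x)) / 2) p + Feps n p xi + INR (xi 0%nat) / 2
    = Feps n 0 xi + INR (xi p) / 2).
  { induction p as [|p IH]; intros Hp; [simpl; ring|].
    specialize (IH ltac:(lia)). rewrite (Feps_step n p) in IH by lia. simpl. lra. }
  specialize (H n (Nat.le_refl n)). rewrite (Feps_step n n), (Feps_last n (S n)) in H by lia.
  pose proof (pos_INR (xi 0%nat)). pose proof (pos_INR (xi n)). lra.
Qed.

(** Hops contribute total rate at most the number of particles, times [1 / (n m) ^ 2]. Creation at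
    site 0 is not seen, since the hat starts at [S b]. Removal moves the average by at most [1 / n],
    at rate [j / n]. *)
Lemma carre_Hat xi :
  INR n ^ 2 * wsum (moves j n xi) (fun x => (Hat b m x - Hat b m xi) ^ 2)
  <= (INR n / INR m) ^ 2 * ucum n 0 xi + j.
Proof.
  pose proof INRn_gt0 as Hn0; pose proof INRm_gt0 as Hm0.
  assert (Hn1 : 1 <= INR n) by (apply (le_INR 1); lia).
  rewrite wsum_moves.
  set (e := / (INR n * INR m) ^ 2).
  assert (He : 0 < e) by (apply Rinv_0_lt_compat, pow_lt; nra).
  assert (H1 : bsum (fun x => INR (xi x) / 2 * (Hat b m (move_part xi x (S x)) - Hat b m xi) ^ 2 +
     INR (xi (S x)) / 2 * (Hat b m (move_part xi (S x) x) - Hat b m xi) ^ 2) n <= e * Feps n 0 xi).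
  { eapply Rle_trans; [|apply Rmult_le_compat_l; [lra|apply bsum_rates_le]].
    rewrite <- bsum_scal; apply bsum_le; intros x Hx.
    assert (HL : forall a p, ((0 < a)%nat -> p <= e) -> INR a / 2 * p <= INR a / 2 * e).
    { intros [|a] p Hp; [simpl; lra|]. pose proof (pos_INR (S a)).
      specialize (Hp ltac:(lia)). nra. }
    rewrite Rmult_plus_distr_l, !(Rmult_comm e); apply Rplus_le_compat; apply HL; intros Hp.
    - apply (Hat_jump_sqr _ _ (S x) 1); [lra|]; intros z; rewrite Feps_hop_right by assumption; ring.
    - apply (Hat_jump_sqr _ _ (S x) (-1)); [lra|]; intros z; rewrite Feps_hop_left by assumption; ring. }
  assert (H2 : Hat b m (add0 xi) = Hat b m xi).
  { unfold Hat; f_equal; apply bsum2_ext; intros i _; rewrite Feps_add0; simpl; ring. }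
  rewrite H2, Rminus_diag.
  assert (H3 : (if Defs.nonzero n xi then j / INR n * (Hat b m (rem_edge n xi) - Hat b m xi) ^ 2 else 0)
     <= j / INR n * (/ INR n) ^ 2).
  { assert (Hj' : 0 < j / INR n) by (apply Rdiv_lt_0_compat; lra).
    assert (Hi : 0 < / INR n) by (apply Rinv_0_lt_compat; lra).
    destruct (Defs.nonzero n xi) eqn:Hz; [|nra].
    apply Rmult_le_compat_l; [lra|].
    assert (Hd : - / INR n <= Hat b m (rem_edge n xi) - Hat b m xi <= 0).
    { rewrite !Hat_ucum. split.
      - enough (/ INR m ^ 2 * bsum2 (fun i => ucum n (S b + i) xi + - / INR n) m
           <= / INR m ^ 2 * bsum2 (fun i => ucum n (S b + i) (rem_edge n xi)) m) as Hq.
        + rewrite bsum2_plus, Rmult_plus_distr_l, avg_const in Hq. lra.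
        + apply avg_le; intros i _; unfold ucum; rewrite Feps_rem_edge by assumption.
          destruct (Nat.leb _ _); nra.
      - enough (/ INR m ^ 2 * bsum2 (fun i => ucum n (S b + i) (rem_edge n xi)) m
           <= / INR m ^ 2 * bsum2 (fun i => ucum n (S b + i) xi) m) by lra.
        apply avg_le; intros i _; unfold ucum; rewrite Feps_rem_edge by assumption.
        destruct (Nat.leb _ _); nra. }
    nra. }
  apply Rle_trans with (INR n ^ 2 * (e * Feps n 0 xi + j / INR n * 0 ^ 2 + j / INR n * (/ INR n) ^ 2)).
  - apply Rmult_le_compat_l; [apply pow2_ge_0|]. lra.
  - replace (INR n ^ 2 * (e * Feps n 0 xi + j / INR n * 0 ^ 2 + j / INR n * (/ INR n) ^ 2))
      with (/ INR m ^ 2 * Feps n 0 xi + j * / INR n) by (unfold e; field; lra).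
    replace ((INR n / INR m) ^ 2 * ucum n 0 xi) with (INR n * (/ INR m ^ 2 * Feps n 0 xi))
      by (unfold ucum; field; lra).
    assert (0 <= / INR m ^ 2 * Feps n 0 xi).
    { apply Rmult_le_pos; [left; apply Rinv_0_lt_compat, pow_lt; lra | apply Feps_ge0]. }
    assert (/ INR n <= 1) by (rewrite <- Rinv_1; apply Rinv_le_contravar; lra).
    nra.
Qed.

(** This bounds the drift of the penalty used near the empty tail; the right side is quadratic in
    the mass, hence controlled by [mdev]. *)
Lemma gen_Hat_sqr_le c xi : 0 <= c ->
  INR n ^ 2 * gen j n (fun x => (Hat b m x - c) ^ 2) xi
  <= (ucum n 0 xi + c) * ((INR n / INR m) ^ 2 * ucum n 0 xi + 2 * j)
     + (INR n / INR m) ^ 2 * ucum n 0 xi + j.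
Proof.
  intros Hc. rewrite gen_sqr, Rmult_plus_distr_l.
  pose proof (carre_Hat xi) as H1. pose proof (gen_Hat_ge xi) as H2. pose proof (gen_Hat_le0 xi) as H3.
  pose proof (lap2_bounds xi) as H4. pose proof (Hat_ge0 xi) as H5. pose proof (Hat_le0 xi) as H6.
  set (A := (INR n / INR m) ^ 2) in *. assert (HA : 0 <= A) by apply pow2_ge_0.
  set (Z := ucum n 0 xi) in *. set (D := INR n ^ 2 * gen j n (Hat b m) xi) in *.
  assert (HD : - (/ 2 * A * Z + j) <= D <= / 2 * A * Z + j) by nra.
  replace (INR n ^ 2 * (2 * (Hat b m xi - c) * gen j n (Hat b m) xi))
    with (2 * ((Hat b m xi - c) * D)) by (unfold D; ring).
  enough ((Hat b m xi - c) * D <= (Z + c) * (/ 2 * A * Z + j)) by nra.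
  assert (HY : - (Z + c) <= Hat b m xi - c <= Z + c) by lra.
  assert (HZ : 0 <= Z) by lra. clear - HD HY HA HZ Hj Hc.
  set (X := Hat b m xi - c) in *. set (K := / 2 * A * Z + j) in *.
  apply Rle_trans with (Rabs (X * D)); [apply Rle_abs|]. rewrite Rabs_mult.
  apply Rmult_le_compat; try apply Rabs_pos; apply Rabs_le; lra.
Qed.

End Drift.

(** * Supersolutions on the macroscopic time scale *)

Definition macro_supersolution (j : R) (n : nat) (V V' : R -> config -> R) (tau : R) : Prop :=
  (forall t xi, is_derive (fun t => V t xi) t (V' t xi)) /\
  (forall t xi, continuous (fun t => V' t xi) t) /\
  (forall t xi, 0 <= t <= tau -> 0 <= V t xi) /\
  (forall t xi, 0 <= t <= tau -> INR n ^ 2 * gen j n (V t) xi <= V' t xi).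

Lemma supersolution_rescale j n V V' tau : (1 <= n)%nat ->
  macro_supersolution j n V V' tau ->
  supersolution j n (fun s => V (s / INR n ^ 2)) (fun s x => V' (s / INR n ^ 2) x / INR n ^ 2)
    (INR n ^ 2 * tau).
Proof.
  intros Hn [H1 [H2 [H3 H4]]].
  pose proof (INRn_gt0 n Hn) as Hn0.
  assert (Hn2 : 0 < INR n ^ 2) by (apply pow_lt, INRn_gt0, Hn).
  assert (Hi : 0 < / INR n ^ 2) by now apply Rinv_0_lt_compat.
  assert (Hr : forall t, 0 <= t <= INR n ^ 2 * tau -> 0 <= t / INR n ^ 2 <= tau).
  { intros t Ht; split; [apply Rdiv_le_0_compat; lra|].
    apply (Rmult_le_reg_l (INR n ^ 2)); [lra|]. replace (INR n ^ 2 * (t / INR n ^ 2)) with t by (field; lra). lra. }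
  split; [|split; [|split]]; intros t xi.
  - replace (V' (t / INR n ^ 2) xi / INR n ^ 2) with (scal (/ INR n ^ 2) (V' (t / INR n ^ 2) xi))
      by (unfold scal; simpl; unfold mult; simpl; unfold Rdiv; ring).
    apply (is_derive_comp (fun s => V s xi) (fun s => s / INR n ^ 2)); [apply H1|].
    auto_derive; [trivial|]. field; lra.
  - apply (continuous_mult (fun t => V' (t / INR n ^ 2) xi) (fun _ => / INR n ^ 2));
      [|apply continuous_const].
    apply (continuous_comp (fun t => t / INR n ^ 2) (fun t => V' t xi)); [|apply H2].
    apply (ex_derive_continuous (fun t => t / INR n ^ 2)); auto_derive; trivial.
  - intros Ht; apply H3, Hr, Ht.
  - intros Ht. specialize (H4 (t / INR n ^ 2) xi (Hr t Ht)).
    apply (Rmult_le_reg_l (INR n ^ 2)); [lra|].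
    replace (INR n ^ 2 * (V' (t / INR n ^ 2) xi / INR n ^ 2)) with (V' (t / INR n ^ 2) xi) by (field; lra).
    exact H4.
Qed.

Definition mdev (n : nat) (M : R) (xi : config) : R := (ucum n 0 xi - M) ^ 2.

Lemma mdev_ge0 n M xi : 0 <= mdev n M xi.
Proof. apply pow2_ge_0. Qed.

Lemma mass_supersolution j n M a K tau : 0 < j -> (1 <= n)%nat -> 0 <= M -> 0 <= a -> 0 <= K ->
  macro_supersolution j n (fun t xi => a + K * (mdev n M xi + 2 * j * t / INR n))
    (fun _ _ => K * (2 * j / INR n)) tau.
Proof.
  intros Hj Hn HM Ha HK. pose proof (INRn_gt0 n Hn) as Hn0.
  split; [|split; [|split]]; intros t xi.
  - auto_derive; [trivial|]. field; lra.
  - apply continuous_const.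
  - intros Ht. assert (0 <= 2 * j * t / INR n) by (apply Rdiv_le_0_compat; nra).
    pose proof (mdev_ge0 n M xi). nra.
  - intros _. rewrite (gen_ext _ _ _ (fun x => (a + K * (2 * j * t / INR n)) + K * mdev n M x)) by (intros; ring).
    rewrite (gen_plus j n (fun _ => _)), gen_const, gen_scal, Rplus_0_l.
    pose proof (gen_mass_sqr j n Hj Hn M xi HM) as H. unfold mdev. nra.
Qed.

Lemma Prob_macro_bound j n M (E G : config -> bool) beta a K tau s V V' xi :
  0 < j -> (1 <= n)%nat -> 0 <= M -> 0 <= beta -> 0 <= a -> 0 <= K -> 0 <= tau -> 0 <= s ->
  macro_supersolution j n V V' tau ->
  (forall x, E x = true -> beta <= V 0 x) ->
  (forall x, V tau x <= K * (1 + mdev n M x)) ->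
  (forall x, G x = true -> V tau x <= a + K * mdev n M x) ->
  beta * Prob j n E (INR n ^ 2 * (s + tau)) xi + K * Prob j n G (INR n ^ 2 * s) xi
  <= a + K * (mdev n M xi + 2 * j * s / INR n) + K.
Proof.
  intros Hj Hn HM Hb Ha HK Ht Hs HV HE HA HG.
  pose proof (mass_supersolution j n M a K s Hj Hn HM Ha HK) as HW.
  pose proof (INRn_gt0 n Hn) as Hn0.
  assert (Hn2 : 0 < INR n ^ 2) by (apply pow_lt, INRn_gt0, Hn).
  pose proof (supersolution_rescale _ _ _ _ _ Hn HV) as HV1.
  pose proof (supersolution_rescale _ _ _ _ _ Hn HW) as HW1.
  rewrite Rmult_plus_distr_l.
  pose proof (Prob_two_step j n Hj Hn E G beta K (INR n ^ 2 * tau) (INR n ^ 2 * s)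
    _ _ _ _ xi Hb HK ltac:(nra) ltac:(nra) HV1 HW1) as H.
  cbv beta in H.
  replace (INR n ^ 2 * s / INR n ^ 2) with s in H by (field; lra).
  replace (INR n ^ 2 * tau / INR n ^ 2) with tau in H by (field; lra).
  replace (0 / INR n ^ 2) with 0 in H by (field; lra).
  apply H.
  - intros x; specialize (HE x); destruct (E x); [specialize (HE eq_refl); lra|].
    destruct HV as [_ [_ [HV _]]]; specialize (HV 0 x ltac:(lra)); lra.
  - intros x; specialize (HG x); specialize (HA x).
    replace (2 * j * 0 / INR n) with 0 by (unfold Rdiv; ring).
    destruct (G x); [specialize (HG eq_refl); lra | lra].
Qed.


(** Growth bounds are all phrased through [mdev], the unbounded quantity for which a supersolution
    with vanishing growth is available. *)
Lemma mass_le_mdev n M xi : ucum n 0 xi <= M + 1 + mdev n M xi.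
Proof. unfold mdev. pose proof (pow2_ge_0 (ucum n 0 xi - M - 1)). nra. Qed.

Lemma mass_sqr_le_mdev n M xi : ucum n 0 xi ^ 2 <= 2 * M ^ 2 + 2 * mdev n M xi.
Proof. unfold mdev. pose proof (pow2_ge_0 (ucum n 0 xi - 2 * M)). nra. Qed.

(* [D] is the observable whose increment is bounded, [Th] bounds its drift up to the error
   [kap * Q]; the quadratic terms absorb the drifts of [Th] and [Q]. *)
Record local_drift (j : R) (n : nat) (M A kap C1 C2 C3 : R) (D Th Q : config -> R) : Prop := {
  ld_D : forall xi, - ucum n 0 xi <= D xi <= ucum n 0 xi;
  ld_Th : forall xi, - (A * ucum n 0 xi + j) <= Th xi <= A * ucum n 0 xi + j;
  ld_Q : forall xi, 0 <= Q xi <= C3 * (1 + mdev n M xi);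
  ld_genD : forall xi, INR n ^ 2 * gen j n D xi <= Th xi + kap * Q xi;
  ld_genTh : forall xi, INR n ^ 2 * gen j n Th xi <= C1 * (1 + mdev n M xi);
  ld_genQ : forall xi, INR n ^ 2 * gen j n Q xi <= C2 * (1 + mdev n M xi) }.

(** Taylor expansion of the expected [D] after time [t], made into a supersolution. The three copies
    of [M + 1 + mdev] ensure positivity: [D] and [t * Th] together cost at most twice the mass plus
    1. The terms [2 j t / n] compensate the growth of [mdev], and the [t ^ 2] term has derivative
    large enough to pay for the drifts of [Th] and [Q]. *)
Definition Vloc (j : R) (n : nat) (M kap C : R) (D Th Q : config -> R) (t : R) (xi : config) : R :=
  3 * (M + 1 + (mdev n M xi + 2 * j * t / INR n)) + D xi + t * Th xi
  + t ^ 2 * (C * (1 + (mdev n M xi + 2 * j * t / INR n))) + kap * t * Q xi.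

Lemma Vloc_supersolution j n M A kap C1 C2 C3 D Th Q tau :
  0 < j -> (1 <= n)%nat -> 0 <= M -> 0 <= kap -> 0 <= C1 -> 0 <= C2 -> 0 <= A ->
  0 <= tau -> tau * A <= 1 -> tau * j <= 1 ->
  local_drift j n M A kap C1 C2 C3 D Th Q ->
  let C := C1 + kap * C2 in
  macro_supersolution j n (Vloc j n M kap C D Th Q)
    (fun t xi => 3 * (2 * j / INR n) + Th xi
       + (2 * t * (C * (1 + (mdev n M xi + 2 * j * t / INR n))) + t ^ 2 * (C * (2 * j / INR n)))
       + kap * Q xi) tau.
Proof.
  intros Hj Hn HM Hk HC1 HC2 HA Ht HtA Htj [LD LTh LQ LgD LgT LgQ] C.
  pose proof (INRn_gt0 n Hn) as Hn0.
  assert (HC : 0 <= C) by (unfold C; nra).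
  unfold macro_supersolution, Vloc; split; [|split; [|split]]; intros t xi.
  - auto_derive; [trivial|]. field; lra.
  - apply (ex_derive_continuous (fun t => 3 * (2 * j / INR n) + Th xi
       + (2 * t * (C * (1 + (mdev n M xi + 2 * j * t / INR n))) + t ^ 2 * (C * (2 * j / INR n)))
       + kap * Q xi)); auto_derive; trivial.
  - intros Ht0. specialize (LD xi); specialize (LTh xi); specialize (LQ xi).
    pose proof (mdev_ge0 n M xi) as HP. pose proof (mass_le_mdev n M xi) as HZ.
    assert (Hs : 0 <= 2 * j * t / INR n) by (apply Rdiv_le_0_compat; nra).
    set (s := 2 * j * t / INR n) in *. set (P := mdev n M xi) in *.
    pose proof (ucum_ge0 n Hn 0 xi) as HZ0. set (Z := ucum n 0 xi) in *.
    assert (0 <= t ^ 2 * (C * (1 + (P + s)))).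
    { apply Rmult_le_pos; [apply pow2_ge_0|]. apply Rmult_le_pos; lra. }
    assert (0 <= kap * t * Q xi) by (apply Rmult_le_pos; [apply Rmult_le_pos|]; lra).
    assert (- (Z + 1) <= t * Th xi).
    { assert (t * A <= 1) by nra. assert (t * j <= 1) by nra.
      assert (t * (A * Z + j) <= Z + 1) by nra. nra. }
    lra.
  - intros Ht0. specialize (LgD xi); specialize (LgT xi); specialize (LgQ xi).
    set (s := 2 * j * t / INR n).
    assert (Hs : 0 <= s) by (apply Rdiv_le_0_compat; nra).
    rewrite (gen_ext _ _ _ (fun x => (3 * (M + 1 + s) + t ^ 2 * (C * (1 + s)))
       + ((3 + t ^ 2 * C) * mdev n M x + (D x + (t * Th x + (kap * t) * Q x))))).
    2:{ intros; unfold s; ring. }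
    rewrite (gen_plus j n (fun _ => _)), gen_const, Rplus_0_l.
    rewrite (gen_plus j n (fun x => (3 + t ^ 2 * C) * mdev n M x)), gen_scal.
    rewrite (gen_plus j n D), (gen_plus j n (fun x => t * Th x)), !gen_scal.
    pose proof (gen_mass_sqr j n Hj Hn M xi HM) as HP.
    change (fun x => (ucum n 0 x - M) ^ 2) with (mdev n M) in HP.
    pose proof (mdev_ge0 n M xi) as HP0. set (P := mdev n M xi) in *.
    set (gP := gen j n (mdev n M) xi) in *. set (gD := gen j n D xi) in *.
    set (gT := gen j n Th xi) in *. set (gQ := gen j n Q xi) in *.
    set (N2 := INR n ^ 2) in *.
    replace (N2 * ((3 + t ^ 2 * C) * gP + (gD + (t * gT + kap * t * gQ))))
      with ((3 + t ^ 2 * C) * (N2 * gP) + (N2 * gD) + t * (N2 * gT) + kap * t * (N2 * gQ)) by ring.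
    assert (H1 : (3 + t ^ 2 * C) * (N2 * gP) <= (3 + t ^ 2 * C) * (2 * j / INR n)).
    { apply Rmult_le_compat_l; [pose proof (pow2_ge_0 t); nra | exact HP]. }
    assert (H2 : t * (N2 * gT) <= t * (C1 * (1 + P))) by (apply Rmult_le_compat_l; lra).
    assert (H3 : kap * t * (N2 * gQ) <= kap * t * (C2 * (1 + P)))
      by (apply Rmult_le_compat_l; [apply Rmult_le_pos|]; lra).
    assert (H4 : t * (C1 * (1 + P)) + kap * t * (C2 * (1 + P)) <= 2 * t * (C * (1 + (P + s)))).
    { replace (t * (C1 * (1 + P)) + kap * t * (C2 * (1 + P))) with (t * (C * (1 + P)))
        by (unfold C; ring).
      assert (C * (1 + P) <= C * (1 + (P + s))) by (apply Rmult_le_compat_l; lra).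
      assert (0 <= C * (1 + P)) by (apply Rmult_le_pos; lra). nra. }
    lra.
Qed.

Lemma filterlim_mul_eventually N : (1 <= N)%nat -> filterlim (fun k => (k * N)%nat) eventually eventually.
Proof.
  intros HN Q [n0 H0]; exists n0; intros k Hk; apply H0; nia.
Qed.

(** * From supersolutions to deterministic inequalities for the limit profile *)

Section Limit.
Variables (j M : R) (rho : R -> R -> R) (xi0 : nat -> config).
Hypotheses (Hj : 0 < j) (HM : 0 <= M).
Hypothesis Hlim : forall zeta t, 0 < zeta -> 0 <= t ->
  is_lim_seq (fun n => Prob j n (hdl_event n zeta (rho t)) (INR n ^ 2 * t) (xi0 n)) 1.
Hypothesis Hmass : is_lim_seq (fun n => mdev n M (xi0 n)) 0.

(** Both events have probability tending to 1, so [Prob_macro_bound] becomes [beta + K <= a + K] in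
    the limit. Only multiples of [N] are used: hats with rational position and width then sit
    exactly on the lattice. *)
Lemma limit_principle N s tau zeta beta a K : (1 <= N)%nat ->
  0 <= beta -> 0 <= a -> 0 <= K -> 0 <= tau -> 0 <= s -> 0 < zeta ->
  eventually (fun k => exists V V',
    macro_supersolution j (k * N) V V' tau /\
    (forall x, hdl_event (k * N) zeta (rho (s + tau)) x = true -> beta <= V 0 x) /\
    (forall x, V tau x <= K * (1 + mdev (k * N) M x)) /\
    (forall x, hdl_event (k * N) zeta (rho s) x = true -> V tau x <= a + K * mdev (k * N) M x)) ->
  beta <= a.
Proof.
  intros HN Hb Ha HK Ht Hs Hz [k0 HV].
  pose proof (filterlim_mul_eventually N HN) as Hsub.
  pose proof (is_lim_seq_subseq _ _ _ Hsub (Hlim zeta (s + tau) Hz ltac:(lra))) as L1.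
  pose proof (is_lim_seq_subseq _ _ _ Hsub (Hlim zeta s Hz ltac:(lra))) as L2.
  pose proof (is_lim_seq_subseq _ _ _ Hsub Hmass) as L3.
  assert (L4 : is_lim_seq (fun n => 2 * j * s / INR n) 0).
  { replace (Finite 0) with (Rbar_mult (2 * j * s) 0) by (simpl; f_equal; ring).
    apply (is_lim_seq_scal_l (fun n => / INR n)).
    replace (Finite 0) with (Rbar_inv p_infty) by reflexivity.
    apply is_lim_seq_inv; [apply is_lim_seq_INR | discriminate]. }
  apply (is_lim_seq_subseq _ _ _ Hsub) in L4.
  cut (Rbar_le (beta * 1 + K * 1) (a + K * (0 + 0) + K)); [simpl; lra|].
  apply (is_lim_seq_scal_l _ beta) in L1. apply (is_lim_seq_scal_l _ K) in L2.
  pose proof (is_lim_seq_plus' _ _ _ _ L1 L2) as L5.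
  pose proof (is_lim_seq_scal_l _ K _ (is_lim_seq_plus' _ _ _ _ L3 L4)) as L6.
  pose proof (is_lim_seq_plus' _ _ _ _
    (is_lim_seq_plus' _ _ _ _ (is_lim_seq_const a) L6) (is_lim_seq_const K)) as L7.
  refine (is_lim_seq_le_loc _ _ _ _ _ L5 L7).
  exists (S k0); intros k Hk. destruct (HV k ltac:(lia)) as [V [V' [H1 [H2 [H3 H4]]]]].
  eapply (Prob_macro_bound j (k * N) M); try eassumption; nia.
Qed.

(** Here [d0] and [d1] stand for the limits of [D] at times [s] and [s + tau], and [th] for that of
    [Th] at time [s]; [Q] must vanish in the limit at time [s]. The [tau ^ 2] term is the price of
    freezing [Th] at the initial time. *)
Lemma local_limit N s tau A kap C1 C2 C3 d0 d1 th : (1 <= N)%nat ->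
  0 <= A -> 0 <= kap -> 0 <= C1 -> 0 <= C2 -> 0 <= C3 ->
  0 <= tau -> 0 <= s -> tau * A <= 1 -> tau * j <= 1 -> - M <= d1 ->
  (forall e, 0 < e -> exists zeta, 0 < zeta /\ eventually (fun k => exists D Th Q,
     local_drift j (k * N) M A kap C1 C2 C3 D Th Q /\
     (forall x, hdl_event (k * N) zeta (rho (s + tau)) x = true -> d1 - e <= D x) /\
     (forall x, hdl_event (k * N) zeta (rho s) x = true -> D x <= d0 + e /\ Th x <= th + e /\ Q x <= e))) ->
  d1 <= d0 + tau * th + tau ^ 2 * (C1 + kap * C2).
Proof.
  intros HN HA Hk HC1 HC2 HC3 Ht Hs HtA Htj Hd1 H.
  set (C := C1 + kap * C2). assert (HC : 0 <= C) by (unfold C; nra).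
  assert (Hkey : forall e, 0 < e < 1 -> d1 - e <= d0 + tau * th + tau ^ 2 * C + e * (2 + tau + kap * tau)).
  { intros e He. destruct (H e ltac:(lra)) as [zeta [Hz Hev]].
    set (beta := 3 * (M + 1) + d1 - e).
    (* The error [e] is paid once for [D], once for the terms of order [1 / n], [tau] times for [Th]
       and [kap * tau] times for [Q]. *)
    set (a := 3 * (M + 1) + (d0 + tau * th + tau ^ 2 * C + e * (2 + tau + kap * tau))).
    set (K := 3 * (M + 1) + 4 + (M + 1) + tau * (A * (M + 1) + j) + 2 * (tau ^ 2 * C) + kap * tau * C3 + e).
    assert (HtC : 0 <= tau ^ 2 * C) by (apply Rmult_le_pos; [apply pow2_ge_0|lra]).
    assert (HkC : 0 <= kap * tau * C3) by (apply Rmult_le_pos; [apply Rmult_le_pos|]; lra).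
    assert (HtAM : 0 <= tau * (A * (M + 1) + j)).
    { apply Rmult_le_pos; [lra|]. assert (0 <= A * (M + 1)) by (apply Rmult_le_pos; lra). lra. }
    (* [a] may be negative, but [beta] is positive because [d1 >= - M] and [e < 1]; so the
       truncation at 0 costs nothing. *)
    cut (beta <= Rmax a 0).
    { unfold Rmax; destruct (Rle_dec a 0); unfold beta, a in *; lra. }
    apply (limit_principle N s tau zeta beta (Rmax a 0) K); try assumption.
    - unfold beta; lra.
    - apply Rmax_r.
    - unfold K; lra.
    - assert (Hsmall : eventually (fun k => (3 + tau ^ 2 * C) * (2 * j * tau / INR (k * N)) < e)).
      { assert (L : is_lim_seq (fun n => (3 + tau ^ 2 * C) * (2 * j * tau) * / INR n) 0).
        { replace (Finite 0) with (Rbar_mult ((3 + tau ^ 2 * C) * (2 * j * tau)) 0) by (simpl; f_equal; ring).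
          apply (is_lim_seq_scal_l (fun n => / INR n)).
          replace (Finite 0) with (Rbar_inv p_infty) by reflexivity.
          apply is_lim_seq_inv; [apply is_lim_seq_INR | discriminate]. }
        apply (is_lim_seq_subseq _ _ _ (filterlim_mul_eventually N HN)) in L.
        apply is_lim_seq_spec in L. destruct (L (mkposreal e (proj1 He))) as [k1 Hk1].
        exists k1; intros k Hk'. specialize (Hk1 k Hk'); simpl in Hk1.
        apply Rabs_lt_between in Hk1. unfold Rdiv; lra. }
      destruct Hev as [k0 Hev], Hsmall as [k1 Hsmall].
      exists (S (k0 + k1)); intros k Hkk.
      destruct (Hev k ltac:(lia)) as [D [Th [Q [HL [HE HG]]]]].
      specialize (Hsmall k ltac:(lia)).
      assert (Hn : (1 <= k * N)%nat) by nia. set (n := (k * N)%nat) in *.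
      pose proof (INRn_gt0 n Hn) as Hn0.
      do 2 eexists; split; [|split; [|split]].
      + eapply (Vloc_supersolution j n M A kap C1 C2 C3 D Th Q tau); eassumption.
      + intros x Hx. specialize (HE x Hx). unfold Vloc, beta.
        replace (2 * j * 0 / INR n) with 0 by (field; lra).
        pose proof (mdev_ge0 n M x). lra.
      + intros x. destruct HL as [LD LTh LQ _ _ _].
        specialize (LD x); specialize (LTh x); specialize (LQ x).
        pose proof (mdev_ge0 n M x) as HP. pose proof (mass_le_mdev n M x) as HZ.
        unfold Vloc; fold C. set (sm := 2 * j * tau / INR n) in *.
        assert (Hsm : 0 <= sm) by (apply Rdiv_le_0_compat; nra).
        set (P := mdev n M x) in *. set (Z := ucum n 0 x) in *.
        assert (H1 : tau * Th x <= tau * (A * (M + 1) + j) + P).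
        { apply Rle_trans with (tau * (A * (M + 1 + P) + j)).
          - apply Rmult_le_compat_l; [lra|]. nra.
          - replace (tau * (A * (M + 1 + P) + j)) with (tau * (A * (M + 1) + j) + (tau * A) * P) by ring.
            nra. }
        assert (H2 : kap * tau * Q x <= kap * tau * C3 * (1 + P)).
        { rewrite (Rmult_assoc (kap * tau) C3); apply Rmult_le_compat_l; [apply Rmult_le_pos; lra|lra]. }
        unfold K.
        replace (tau ^ 2 * (C * (1 + (P + sm)))) with (tau ^ 2 * C * (1 + P) + tau ^ 2 * C * sm) by ring.
        assert (0 <= tau ^ 2 * C * P) by (apply Rmult_le_pos; lra).
        assert (0 <= kap * tau * C3 * P) by (apply Rmult_le_pos; lra).
        assert (0 <= tau * (A * (M + 1) + j) * P) by (apply Rmult_le_pos; lra).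
        assert (0 <= M * P) by (apply Rmult_le_pos; lra). assert (0 <= e * P) by (apply Rmult_le_pos; lra).
        nra.
      + intros x Hx. specialize (HG x Hx). destruct HG as [G1 [G2 G3]].
        apply Rle_trans with (a + K * mdev n M x); [|pose proof (Rmax_l a 0); lra].
        pose proof (mdev_ge0 n M x) as HP.
        unfold Vloc; fold C. set (sm := 2 * j * tau / INR n) in *.
        set (P := mdev n M x) in *.
        assert (H1 : tau * Th x <= tau * (th + e)) by (apply Rmult_le_compat_l; lra).
        assert (H2 : kap * tau * Q x <= kap * tau * e)
          by (apply Rmult_le_compat_l; [apply Rmult_le_pos|]; lra).
        replace (tau ^ 2 * (C * (1 + (P + sm)))) with (tau ^ 2 * C + tau ^ 2 * C * P + tau ^ 2 * C * sm) by ring.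
        assert (H3 : (3 + tau ^ 2 * C) * P <= K * P).
        { apply Rmult_le_compat_r; [lra|]. unfold K. lra. }
        unfold a. lra. }
  set (Y := 3 + tau + kap * tau).
  assert (HY : 0 < Y) by (unfold Y; assert (0 <= kap * tau) by (apply Rmult_le_pos; lra); lra).
  apply Rnot_lt_le; intros Hlt.
  set (gap := d1 - (d0 + tau * th + tau ^ 2 * C)) in *. assert (Hgap : 0 < gap) by (unfold gap; lra).
  set (e := Rmin (1 / 2) (gap / (2 * Y))).
  assert (He : 0 < e < 1).
  { unfold e; split; [apply Rmin_glb_lt; [lra|apply Rdiv_lt_0_compat; lra]|].
    eapply Rle_lt_trans; [apply Rmin_l|lra]. }
  assert (He2 : e * Y <= gap / 2).
  { apply Rle_trans with (gap / (2 * Y) * Y).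
    - apply Rmult_le_compat_r; [lra|apply Rmin_r].
    - right; field; lra. }
  specialize (Hkey e He). unfold Y, gap in *. lra.
Qed.

End Limit.

(** * The macroscopic profile *)

Definition clamp (a b x : R) : R := Rmax a (Rmin b x).

Ltac clamp_cases :=
  unfold clamp, Rmin;
  repeat match goal with |- context [Rle_dec ?u ?v] => destruct (Rle_dec u v) end;
  unfold Rmax;
  repeat match goal with |- context [Rle_dec ?u ?v] => destruct (Rle_dec u v) end;
  unfold Rabs;
  repeat match goal with |- context [Rcase_abs ?u] => destruct (Rcase_abs u) end; lra.

Lemma clamp_in a b x : a <= b -> a <= clamp a b x <= b.
Proof. intros; clamp_cases. Qed.

Lemma clamp_id a b x : a <= x <= b -> clamp a b x = x.
Proof. intros; clamp_cases. Qed.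

Lemma clamp_lip a b x y : a <= b -> Rabs (clamp a b x - clamp a b y) <= Rabs (x - y).
Proof. intros; clamp_cases. Qed.

(** Maximise in [y] first: the maximal value depends continuously on [x] by uniform continuity,
    although the chosen maximiser need not. Clamping [x] gives meaning to points just outside the
    interval. *)
Lemma max_2d (h : R -> R -> R) a b c d : a <= b -> c <= d ->
  (forall x y, a <= x <= b -> c <= y <= d -> continuity_2d_pt h x y) ->
  exists x y, (a <= x <= b /\ c <= y <= d) /\
    forall x' y', a <= x' <= b -> c <= y' <= d -> h x' y' <= h x y.
Proof.
  intros Hab Hcd Hh.
  set (cl := clamp a b).
  assert (Hcl : forall x, a <= cl x <= b) by (intros; now apply clamp_in).
  assert (Hclid : forall x, a <= x <= b -> cl x = x) by (intros; now apply clamp_id).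
  assert (Hcl1 : forall x y, Rabs (cl x - cl y) <= Rabs (x - y)) by (intros; now apply clamp_lip).
  assert (H1 : forall x, exists y, (forall y', c <= y' <= d -> h (cl x) y' <= h (cl x) y) /\ c <= y <= d).
  { intros x; apply (continuity_ab_maj (h (cl x)) c d Hcd); intros y Hy.
    apply continuity_pt_locally; intros eps.
    destruct (Hh (cl x) y (Hcl x) Hy eps) as [de Hde]; exists de; intros z Hz.
    apply Hde; [rewrite Rminus_diag, Rabs_R0; apply cond_pos | exact Hz]. }
  set (ym := fun x => proj1_sig (constructive_indefinite_description _ (H1 x))).
  assert (Hym : forall x, (forall y', c <= y' <= d -> h (cl x) y' <= h (cl x) (ym x)) /\ c <= ym x <= d)
    by (intros x; exact (proj2_sig (constructive_indefinite_description _ (H1 x)))).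
  destruct (continuity_ab_maj (fun x => h (cl x) (ym x)) a b Hab) as [x [Hx1 Hx2]].
  - intros x Hx; apply continuity_pt_locally; intros eps.
    destruct (uniform_continuity_2d h a b c d Hh eps) as [de Hde]; exists de; intros z Hz.
    assert (Hz' : Rabs (cl z - cl x) < de) by (eapply Rle_lt_trans; [apply Hcl1|exact Hz]).
    assert (Hz'' : Rabs (cl x - cl z) < de) by (rewrite Rabs_minus_sym; exact Hz').
    destruct (Hym x) as [Mx Ix], (Hym z) as [Mz Iz].
    pose proof (Hde (cl x) (ym z) (cl z) (ym z) (Hcl x) Iz (Hcl z) Iz Hz'
      ltac:(rewrite Rminus_diag, Rabs_R0; apply cond_pos)) as E1.
    pose proof (Hde (cl z) (ym x) (cl x) (ym x) (Hcl z) Ix (Hcl x) Ix Hz''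
      ltac:(rewrite Rminus_diag, Rabs_R0; apply cond_pos)) as E2.
    specialize (Mx (ym z) Iz); specialize (Mz (ym x) Ix).
    apply Rabs_lt_between in E1; apply Rabs_lt_between in E2; apply Rabs_lt_between; lra.
  - exists x, (ym x); split; [split; [exact Hx2 | apply Hym]|].
    intros x' y' Hx' Hy'. specialize (Hx1 x' Hx'). destruct (Hym x') as [Mx' _].
    specialize (Mx' y' Hy'). rewrite !Hclid in * by assumption. lra.
Qed.

Lemma is_derive_continuity_pt (h : R -> R) x l : is_derive h x l -> continuity_pt h x.
Proof.
  intros H; apply continuity_pt_filterlim, (ex_derive_continuous h); now exists l.
Qed.

(** The defect, as a function of the step [s], vanishes at 0 and has derivative
    [p1 (x + s) - p1 (x - s) - 2 c s], which is nonnegative by the mean value theorem. *)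
Lemma second_diff_ge (p p1 p2 : R -> R) x h c : 0 <= h ->
  (forall y, is_derive p y (p1 y)) -> (forall y, is_derive p1 y (p2 y)) ->
  (forall y, x - h <= y <= x + h -> c <= p2 y) ->
  c * h ^ 2 <= p (x - h) - 2 * p x + p (x + h).
Proof.
  intros Hh H1 H2 Hc.
  set (psi := fun s => p (x - s) - 2 * p x + p (x + s) - c * s ^ 2).
  set (dpsi := fun s => p1 (x + s) - p1 (x - s) - 2 * c * s).
  assert (Hd : forall s, is_derive psi s (dpsi s)).
  { intros s; unfold psi, dpsi. auto_derive.
    - repeat split; eexists; apply H1.
    - rewrite !(fun y => is_derive_unique p y _ (H1 y)). unfold Rminus; ring. }
  destruct (MVT_gen psi 0 h dpsi) as [s [Hs Heq]].
  { intros; apply Hd. } { intros; eapply is_derive_continuity_pt; apply Hd. }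
  rewrite Rmin_left, Rmax_right in Hs by lra.
  destruct (MVT_gen p1 (x - s) (x + s) p2) as [y [Hy Heq2]].
  { intros; apply H2. } { intros; eapply is_derive_continuity_pt; apply H2. }
  rewrite Rmin_left, Rmax_right in Hy by lra.
  specialize (Hc y ltac:(lra)).
  assert (0 <= dpsi s) by (unfold dpsi; nra).
  assert (0 <= dpsi s * (h - 0)) by (apply Rmult_le_pos; lra).
  unfold psi in Heq. rewrite Rminus_0_r, Rplus_0_r in Heq. lra.
Qed.

Lemma second_diff_close (p p1 p2 : R -> R) x h c e : 0 <= h ->
  (forall y, is_derive p y (p1 y)) -> (forall y, is_derive p1 y (p2 y)) ->
  (forall y, x - h <= y <= x + h -> Rabs (p2 y - c) <= e) ->
  Rabs (p (x - h) - 2 * p x + p (x + h) - c * h ^ 2) <= e * h ^ 2.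
Proof.
  intros Hh H1 H2 Hc.
  pose proof (second_diff_ge p p1 p2 x h (c - e) Hh H1 H2) as L.
  pose proof (second_diff_ge (fun y => - p y) (fun y => - p1 y) (fun y => - p2 y) x h (- c - e) Hh) as U.
  specialize (L ltac:(intros y Hy; specialize (Hc y Hy); apply Rabs_le_between in Hc; lra)).
  specialize (U ltac:(intros; apply (is_derive_opp (V := R_NormedModule) p), H1)
                ltac:(intros; apply (is_derive_opp (V := R_NormedModule) p1), H2)
                ltac:(intros y Hy; specialize (Hc y Hy); apply Rabs_le_between in Hc; lra)).
  apply Rabs_le_between; lra.
Qed.

Definition clamp01 : R -> R := clamp 0 1.

Lemma clamp01_in r : 0 <= clamp01 r <= 1.
Proof. apply clamp_in; lra. Qed.

Lemma clamp01_id r : 0 <= r <= 1 -> clamp01 r = r.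
Proof. apply clamp_id. Qed.

Lemma clamp01_lip x y : Rabs (clamp01 x - clamp01 y) <= Rabs (x - y).
Proof. apply clamp_lip; lra. Qed.

(** * Regularity of the profile, of its tail and of its hat averages *)

Section Profile.
Variable rho : R -> R -> R.
Hypothesis rho_ge0 : forall t r, 0 <= t -> 0 <= r <= 1 -> 0 <= rho t r.
Hypothesis rho_cont : forall t r, 0 <= t -> 0 <= r <= 1 ->
  filterlim (fun p : R * R => rho (fst p) (snd p))
    (within (fun p : R * R => 0 <= fst p /\ 0 <= snd p <= 1) (locally (t, r)))
    (locally (rho t r)).

(* Extended constantly outside of [0,oo) x [0,1], so that it is continuous on the plane. *)
Definition rc (t r : R) : R := rho (Rmax 0 t) (clamp01 r).

Lemma rc_ge0 t r : 0 <= rc t r.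
Proof. apply rho_ge0; [apply Rmax_l | apply clamp01_in]. Qed.

Lemma rc_cont_2d t r : continuity_2d_pt rc t r.
Proof.
  intros eps.
  destruct (rho_cont (Rmax 0 t) (clamp01 r) (Rmax_l 0 t) (clamp01_in r)
    (fun z => Rabs (z - rho (Rmax 0 t) (clamp01 r)) < eps)) as [de Hde].
  { exists eps; intros z Hz; exact Hz. }
  exists de; intros u v Hu Hv.
  apply (Hde (Rmax 0 u, clamp01 v)).
  - split; simpl.
    + change (Rabs (Rmax 0 u - Rmax 0 t) < de).
      eapply Rle_lt_trans; [|exact Hu].
      clamp_cases.
    + change (Rabs (clamp01 v - clamp01 r) < de).
      eapply Rle_lt_trans; [apply clamp01_lip | exact Hv].
  - simpl; split; [apply Rmax_l | apply clamp01_in].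
Qed.

Lemma rc_continuous t r : continuous (rc t) r.
Proof.
  apply continuity_pt_filterlim, continuity_pt_locally; intros eps.
  destruct (rc_cont_2d t r eps) as [de Hde]; exists de; intros z Hz.
  apply Hde; [rewrite Rminus_diag, Rabs_R0; apply cond_pos | exact Hz].
Qed.

Lemma ex_RInt_rc t a b : ex_RInt (rc t) a b.
Proof. apply (ex_RInt_continuous (V := R_CompleteNormedModule)); intros; apply rc_continuous. Qed.

Definition fF (t r : R) : R := RInt (rc t) r 1.

Lemma fF_Fmac t r : 0 <= t -> 0 <= r <= 1 -> fF t r = Fmac r (rho t).
Proof.
  intros Ht Hr; unfold fF, Fmac; apply RInt_ext; intros x Hx.
  rewrite Rmin_left, Rmax_right in Hx by lra.
  unfold rc; rewrite Rmax_right, clamp01_id by lra; reflexivity.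
Qed.

Lemma fF_diff t x y : fF t x - fF t y = RInt (rc t) x y.
Proof.
  unfold fF. rewrite <- (RInt_Chasles (V := R_CompleteNormedModule) (rc t) x y 1) by apply ex_RInt_rc.
  unfold plus; simpl; ring.
Qed.

Lemma fF_1 t : fF t 1 = 0.
Proof. apply (RInt_point (V := R_CompleteNormedModule)). Qed.

Lemma fF_decr t x y : x <= y -> fF t y <= fF t x.
Proof.
  intros H. enough (0 <= fF t x - fF t y) by lra. rewrite fF_diff.
  apply RInt_ge_0; [assumption | apply ex_RInt_rc | intros; apply rc_ge0].
Qed.

Lemma fF_ge0 t x : x <= 1 -> 0 <= fF t x.
Proof. intros H; rewrite <- (fF_1 t); now apply fF_decr. Qed.

Lemma fF_derive t r : is_derive (fF t) r (- rc t r).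
Proof.
  apply (is_derive_RInt' (V := R_NormedModule) (rc t) (fF t) r 1).
  - exists (mkposreal 1 Rlt_0_1); intros y _.
    apply (RInt_correct (V := R_CompleteNormedModule)), ex_RInt_rc.
  - apply rc_continuous.
Qed.

Lemma fF_continuous t r : continuous (fF t) r.
Proof. apply (ex_derive_continuous (fF t)); eexists; apply fF_derive. Qed.

Lemma rc_bound T : exists L, 0 < L /\ forall t r, t <= T -> rc t r <= L.
Proof.
  destruct (max_2d rc 0 (Rmax 0 T) 0 1) as [x [y [_ H]]]; try lra.
  { apply Rmax_l. } { intros; apply rc_cont_2d. }
  exists (rc x y + 1); split; [pose proof (rc_ge0 x y); lra|].
  intros t r Ht.
  replace (rc t r) with (rc (Rmax 0 t) (clamp01 r)).
  - specialize (H (Rmax 0 t) (clamp01 r)). 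
    specialize (H ltac:(split; [apply Rmax_l | apply Rle_max_compat_l; lra]) (clamp01_in r)). lra.
  - unfold rc; rewrite (clamp01_id (clamp01 r)) by apply clamp01_in.
    rewrite (Rmax_right 0 (Rmax 0 t)) by apply Rmax_l; reflexivity.
Qed.

Lemma fF_lip T : exists L, 0 < L /\ forall t x y, t <= T -> Rabs (fF t x - fF t y) <= L * Rabs (x - y).
Proof.
  destruct (rc_bound T) as [L [HL H]]; exists L; split; [assumption|]; intros t x y Ht.
  assert (Hw : forall x y, x <= y -> Rabs (fF t x - fF t y) <= L * Rabs (x - y)).
  { clear x y; intros x y Hxy. rewrite fF_diff.
    rewrite (Rabs_minus_sym x y), (Rabs_right (y - x)), Rmult_comm by lra.
    apply abs_RInt_le_const; [assumption | apply ex_RInt_rc |].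
    intros z _; rewrite Rabs_right; [now apply H | apply Rle_ge, rc_ge0]. }
  destruct (Rle_dec x y); [now apply Hw|].
  rewrite Rabs_minus_sym, (Rabs_minus_sym x y); apply Hw; lra.
Qed.

(** The densities are compared up to [e / 2] and integrated over a length [|1 - r| <= 2]. Times
    start at [-1] so that [t = 0] has a two-sided neighbourhood. *)
Lemma fF_equicont T e : 0 < e -> exists d, 0 < d /\
  forall t u r, -1 <= t <= T -> -1 <= u <= T -> Rabs (t - u) < d -> -1 <= r <= 2 ->
    Rabs (fF t r - fF u r) <= e.
Proof.
  intros He. assert (He2 : 0 < e / 2) by lra.
  destruct (uniform_continuity_2d rc (-1) T 0 1 (fun x y _ _ => rc_cont_2d x y) (mkposreal _ He2)) as [d Hd].
  exists d; split; [apply cond_pos|]; intros t u r Ht Hu Htu Hr; simpl in Hd.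
  assert (Hrc : forall y, Rabs (rc t y - rc u y) <= e / 2).
  { intros y; left.
    assert (Hy : forall s, rc s y = rc s (clamp01 y))
      by (intros s; unfold rc; now rewrite (clamp01_id (clamp01 y)) by apply clamp01_in).
    rewrite !Hy; apply Hd; try assumption; try apply clamp01_in.
    rewrite Rminus_diag, Rabs_R0; apply cond_pos. }
  assert (Hex : forall a b, ex_RInt (fun y => minus (rc t y) (rc u y)) a b)
    by (intros; apply (ex_RInt_minus (V := R_NormedModule)); apply ex_RInt_rc).
  replace (fF t r - fF u r) with (RInt (fun y => minus (rc t y) (rc u y)) r 1).
  2:{ rewrite (RInt_minus (V := R_CompleteNormedModule)) by apply ex_RInt_rc. reflexivity. }
  destruct (Rle_dec r 1) as [Hr1|Hr1].
  - eapply Rle_trans; [apply (abs_RInt_le_const _ _ _ (e / 2)); [assumption|apply Hex|]|nra].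
    intros y _; apply Hrc.
  - rewrite <- (opp_RInt_swap (V := R_CompleteNormedModule)) by apply Hex.
    unfold opp; simpl; rewrite Rabs_Ropp.
    eapply Rle_trans; [apply (abs_RInt_le_const _ _ _ (e / 2)); [lra|apply Hex|]|nra].
    intros y _; apply Hrc.
Qed.

Definition iF (t r : R) : R := RInt (fF t) 0 r.
Definition iiF (t r : R) : R := RInt (iF t) 0 r.

Lemma iF_derive t r : is_derive (iF t) r (fF t r).
Proof.
  apply (is_derive_RInt (V := R_NormedModule) (fF t) (iF t) 0 r); [|apply fF_continuous].
  exists (mkposreal 1 Rlt_0_1); intros y _.
  apply (RInt_correct (V := R_CompleteNormedModule)), (ex_RInt_continuous (V := R_CompleteNormedModule)).
  intros; apply fF_continuous.
Qed.

Lemma iF_continuous t r : continuous (iF t) r.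
Proof. apply (ex_derive_continuous (iF t)); eexists; apply iF_derive. Qed.

Lemma iiF_derive t r : is_derive (iiF t) r (iF t r).
Proof.
  apply (is_derive_RInt (V := R_NormedModule) (iF t) (iiF t) 0 r); [|apply iF_continuous].
  exists (mkposreal 1 Rlt_0_1); intros y _.
  apply (RInt_correct (V := R_CompleteNormedModule)), (ex_RInt_continuous (V := R_CompleteNormedModule)).
  intros; apply iF_continuous.
Qed.

(* Average of [fF t] against the hat function supported on [r, r + 2 eta]. *)
Definition gF (t eta r : R) : R := (iiF t r - 2 * iiF t (r + eta) + iiF t (r + 2 * eta)) / eta ^ 2.

(** [gF] is a normalised second difference of the second primitive [iiF]. An inequality between
    tails is thus one between second derivatives, and [second_diff_ge] transfers it to the
    averages. *)
Lemma gF_le_shift t u eta r d e : 0 < eta ->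
  (forall y, r <= y <= r + 2 * eta -> fF u (y + d) <= fF t y + e) ->
  gF u eta (r + d) <= gF t eta r + e.
Proof.
  intros Heta H.
  pose proof (second_diff_ge (fun y => iiF t y - iiF u (y + d)) (fun y => iF t y - iF u (y + d))
    (fun y => fF t y - fF u (y + d)) (r + eta) eta (- e)) as L.
  specialize (L ltac:(lra)).
  assert (D1 : forall y, is_derive (fun y => iiF t y - iiF u (y + d)) y (iF t y - iF u (y + d))).
  { intros y; auto_derive.
    - repeat split; eexists; apply iiF_derive.
    - rewrite !(fun t y => is_derive_unique (iiF t) y _ (iiF_derive t y)). ring. }
  assert (D2 : forall y, is_derive (fun y => iF t y - iF u (y + d)) y (fF t y - fF u (y + d))).
  { intros y; auto_derive.
    - repeat split; eexists; apply iF_derive.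
    - rewrite !(fun t y => is_derive_unique (iF t) y _ (iF_derive t y)). ring. }
  specialize (L D1 D2). cbv beta in L.
  specialize (L ltac:(intros y Hy; specialize (H y ltac:(lra)); lra)).
  unfold gF. apply (Rmult_le_reg_r (eta ^ 2)); [apply pow_lt; lra|].
  rewrite Rmult_plus_distr_r. unfold Rdiv.
  rewrite !Rmult_assoc, !Rinv_l by (apply pow_nonzero; lra). rewrite !Rmult_1_r.
  replace (r + eta - eta) with r in L by ring.
  replace (r + eta + eta) with (r + 2 * eta) in L by ring.
  replace (r + d + eta) with (r + eta + d) by ring.
  replace (r + d + 2 * eta) with (r + 2 * eta + d) by ring. lra.
Qed.

Lemma gF_bounds t eta r : 0 < eta -> fF t (r + 2 * eta) <= gF t eta r <= fF t r.
Proof.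
  intros Heta.
  pose proof (second_diff_ge (iiF t) (iF t) (fF t) (r + eta) eta (fF t (r + 2 * eta)) ltac:(lra)
    (iiF_derive t) (iF_derive t)) as L.
  specialize (L ltac:(intros y Hy; apply fF_decr; lra)).
  pose proof (second_diff_ge (fun y => - iiF t y) (fun y => - iF t y) (fun y => - fF t y)
    (r + eta) eta (- fF t r) ltac:(lra)
    ltac:(intros; apply (is_derive_opp (V := R_NormedModule) (iiF t)), iiF_derive)
    ltac:(intros; apply (is_derive_opp (V := R_NormedModule) (iF t)), iF_derive)) as U.
  specialize (U ltac:(intros y Hy; apply Ropp_le_contravar, fF_decr; lra)).
  cbv beta in U.
  replace (r + eta - eta) with r in * by ring.
  replace (r + eta + eta) with (r + 2 * eta) in * by ring.
  assert (Hp : 0 < eta ^ 2) by (apply pow_lt; lra).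
  split; apply (Rmult_le_reg_r (eta ^ 2)); try assumption; unfold gF, Rdiv;
    rewrite Rmult_assoc, Rinv_l, Rmult_1_r by lra; lra.
Qed.

(** A displacement in [r] is absorbed by the Lipschitz bound of the tail, one in [t] by
    equicontinuity. The open margins beyond the physical domain provide full neighbourhoods of its
    boundary points. *)
Lemma gF_cont_2d eta t r : 0 < eta -> -1 < t -> -1 < r -> r + 2 * eta < 2 ->
  continuity_2d_pt (fun t r => gF t eta r) t r.
Proof.
  intros Heta Ht Hr1 Hr2 eps.
  destruct (fF_lip (t + 1)) as [L [HL Hlip]].
  pose proof (cond_pos eps) as Heps.
  destruct (fF_equicont (t + 1) (eps / 3)) as [d [Hd Heq]]; [lra|].
  assert (Hde : 0 < Rmin (Rmin d (eps / (3 * L))) (Rmin (t + 1) 1)).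
  { repeat apply Rmin_glb_lt; try lra. apply Rdiv_lt_0_compat; lra. }
  exists (mkposreal _ Hde); simpl; intros u v Hu Hv.
  pose proof (Rmin_l (Rmin d (eps / (3 * L))) (Rmin (t + 1) 1)) as M1.
  pose proof (Rmin_r (Rmin d (eps / (3 * L))) (Rmin (t + 1) 1)) as M2.
  pose proof (Rmin_l d (eps / (3 * L))) as M3. pose proof (Rmin_r d (eps / (3 * L))) as M4.
  pose proof (Rmin_l (t + 1) 1) as M5. pose proof (Rmin_r (t + 1) 1) as M6.
  assert (Hu' : Rabs (u - t) < 1) by lra. apply Rabs_lt_between in Hu'.
  assert (Hu'' : Rabs (u - t) < t + 1) by lra. apply Rabs_lt_between in Hu''.
  assert (HLv : L * Rabs (v - r) <= eps / 3).
  { apply Rle_trans with (L * (eps / (3 * L))); [apply Rmult_le_compat_l; lra | right; field; lra]. }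
  assert (Hpt : forall y, r <= y <= r + 2 * eta -> Rabs (fF u (y + (v - r)) - fF t y) <= eps / 3 + eps / 3).
  { intros y Hy.
    pose proof (Hlip u (y + (v - r)) y ltac:(lra)) as E1.
    replace (y + (v - r) - y) with (v - r) in E1 by ring.
    pose proof (Heq u t y ltac:(lra) ltac:(lra) ltac:(lra) ltac:(lra)) as E2.
    apply Rabs_le_between in E1; apply Rabs_le_between in E2; apply Rabs_le_between; lra. }
  assert (U : gF u eta v <= gF t eta r + (eps / 3 + eps / 3)).
  { replace v with (r + (v - r)) by ring; apply gF_le_shift; [assumption|].
    intros y Hy; specialize (Hpt y Hy); apply Rabs_le_between in Hpt; lra. }
  assert (D : gF t eta r <= gF u eta v + (eps / 3 + eps / 3)).
  { replace r with (v + (r - v)) at 1 by ring; apply gF_le_shift; [assumption|].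
    intros y Hy. specialize (Hpt (y + (r - v)) ltac:(lra)).
    replace (y + (r - v) + (v - r)) with y in Hpt by ring.
    apply Rabs_le_between in Hpt; lra. }
  apply Rabs_lt_between; lra.
Qed.

Lemma hdl_event_spec n zeta t x y : 0 <= t -> (1 <= n)%nat ->
  hdl_event n zeta (rho t) x = true -> (y <= n)%nat ->
  Rabs (ucum n y x - fF t (INR y / INR n)) <= zeta.
Proof.
  intros Ht Hn H Hy. unfold hdl_event in H; rewrite forallb_forall in H.
  specialize (H y ltac:(apply in_seq; lia)). unfold Rle_b in H.
  destruct (Rle_dec _ zeta) as [Hle|]; [|discriminate].
  pose proof (INRn_gt0 n Hn) as Hn0.
  rewrite fF_Fmac; [exact Hle | assumption |].
  pose proof (pos_INR y). apply le_INR in Hy. split; [apply Rdiv_le_0_compat; lra|].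
  apply (Rmult_le_reg_r (INR n)); [lra|]. unfold Rdiv; rewrite Rmult_assoc, Rinv_l by lra; lra.
Qed.

(** The same telescoping as for [Hat] writes [gF] exactly as a discrete hat average of second
    differences of [iiF] at step [1 / n]. Each of these is within [e / 2] of [fF] at the site, and
    the event supplies the other [e / 2]. *)
Lemma Hat_close N b0 m0 t e : (1 <= N)%nat -> (1 <= m0)%nat -> (b0 + 2 * m0 <= N)%nat -> 0 <= t -> 0 < e ->
  eventually (fun k => forall x, hdl_event (k * N) (e / 2) (rho t) x = true ->
    Rabs (Hat (k * N) (k * b0) (k * m0) x - gF t (INR m0 / INR N) (INR b0 / INR N)) <= e).
Proof.
  intros HN Hm Hb Ht He.
  destruct (fF_lip t) as [L [HL Hlip]].
  destruct (nfloor_ex (2 * L / e)) as [k0 Hk0]; [left; apply Rdiv_lt_0_compat; lra|].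
  exists (S k0); intros k Hk x Hx.
  assert (Hk1 : 2 * L / e <= INR k).
  { apply le_INR in Hk; rewrite S_INR in Hk; lra. }
  assert (Hkp : 0 < INR k) by (apply (lt_INR 0); lia).
  assert (HNp : 0 < INR N) by (apply (lt_INR 0); lia).
  assert (Hmp : 0 < INR m0) by (apply (lt_INR 0); lia).
  set (n := (k * N)%nat) in *. set (b := (k * b0)%nat). set (m := (k * m0)%nat).
  assert (Hn : (1 <= n)%nat) by (unfold n; nia). pose proof (INRn_gt0 n Hn) as Hn0.
  assert (Hm1 : (1 <= m)%nat) by (unfold m; nia).
  assert (Hbm : (b + 2 * m <= n)%nat) by (unfold b, m, n; nia).
  assert (Hm1p : 0 < INR m) by (apply (lt_INR 0); lia).
  assert (Eb : INR b / INR n = INR b0 / INR N) by (unfold b, n; rewrite !mult_INR; field; lra).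
  assert (Em : INR m / INR n = INR m0 / INR N) by (unfold m, n; rewrite !mult_INR; field; lra).
  rewrite <- Eb, <- Em, Hat_ucum by assumption.
  set (ph := fun i => iiF t (INR (b + i) / INR n)).
  assert (Hg : gF t (INR m / INR n) (INR b / INR n)
     = / INR m ^ 2 * bsum2 (fun i => INR n ^ 2 * (ph i - 2 * ph (S i) + ph (S (S i)))) m).
  { rewrite bsum2_scal, (bsum2_laplacian ph). unfold gF, ph.
    rewrite Nat.add_0_r, !plus_INR, mult_INR.
    replace (INR b / INR n + INR m / INR n) with ((INR b + INR m) / INR n) by (field; lra).
    replace (INR b / INR n + 2 * (INR m / INR n)) with ((INR b + INR 2 * INR m) / INR n)
      by (simpl; field; lra).
    field; lra. }
  rewrite Hg.
  assert (Hpt : forall i, (S i < 2 * m)%nat ->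
    Rabs (ucum n (S b + i) x - INR n ^ 2 * (ph i - 2 * ph (S i) + ph (S (S i)))) <= e).
  { intros i Hi.
    pose proof (hdl_event_spec n (e / 2) t x (S b + i) Ht Hn Hx ltac:(lia)) as E1.
    set (y := INR (S b + i) / INR n) in *.
    pose proof (second_diff_close (iiF t) (iF t) (fF t) y (/ INR n) (fF t y) (e / 2)
      ltac:(left; apply Rinv_0_lt_compat; lra) (iiF_derive t) (iF_derive t)) as E2.
    assert (Hcl : forall z, y - / INR n <= z <= y + / INR n -> Rabs (fF t z - fF t y) <= e / 2).
    { intros z Hz. eapply Rle_trans; [apply Hlip; lra|].
      apply Rle_trans with (L * / INR n).
      - apply Rmult_le_compat_l; [lra|]. apply Rabs_le_between; lra.
      - apply (Rmult_le_reg_r (INR n)); [lra|]. rewrite Rmult_assoc, Rinv_l, Rmult_1_r by lra.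
        assert (Hkn : INR k <= INR n) by (apply le_INR; unfold n; nia).
        apply (Rmult_le_compat_r e) in Hk1; [|lra].
        replace (2 * L / e * e) with (2 * L) in Hk1 by (field; lra). nra. }
    specialize (E2 Hcl).
    replace (ph i) with (iiF t (y - / INR n)).
    2:{ unfold ph, y; f_equal. rewrite !plus_INR, S_INR; field; lra. }
    replace (ph (S i)) with (iiF t y).
    2:{ unfold ph, y; f_equal; f_equal; f_equal; lia. }
    replace (ph (S (S i))) with (iiF t (y + / INR n)).
    2:{ unfold ph, y; f_equal. rewrite !plus_INR, !S_INR; field; lra. }
    set (DD := iiF t (y - / INR n) - 2 * iiF t y + iiF t (y + / INR n)) in *.
    assert (E3 : Rabs (INR n ^ 2 * DD - fF t y) <= e / 2).
    { replace (INR n ^ 2 * DD - fF t y) with (INR n ^ 2 * (DD - fF t y * (/ INR n) ^ 2)) by (field; lra).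
      rewrite Rabs_mult, Rabs_right by (apply Rle_ge, pow2_ge_0).
      apply Rle_trans with (INR n ^ 2 * (e / 2 * (/ INR n) ^ 2)).
      - apply Rmult_le_compat_l; [apply pow2_ge_0 | exact E2].
      - right; field; lra. }
    apply Rabs_le_between in E1; apply Rabs_le_between in E3; apply Rabs_le_between; lra. }
  rewrite <- Rmult_minus_distr_l.
  assert (Hpos : 0 < / INR m ^ 2) by (apply Rinv_0_lt_compat, pow_lt; lra).
  assert (Hc : / INR m ^ 2 * bsum2 (fun _ => e) m = e) by (rewrite bsum2_const; field; lra).
  assert (U : bsum2 (fun i => ucum n (S b + i) x) m
    <= bsum2 (fun i => INR n ^ 2 * (ph i - 2 * ph (S i) + ph (S (S i)))) m + bsum2 (fun _ => e) m).
  { rewrite <- bsum2_plus; apply bsum2_le; intros i Hi; specialize (Hpt i Hi);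
    apply Rabs_le_between in Hpt; lra. }
  assert (D : bsum2 (fun i => INR n ^ 2 * (ph i - 2 * ph (S i) + ph (S (S i)))) m
    <= bsum2 (fun i => ucum n (S b + i) x) m + bsum2 (fun _ => e) m).
  { rewrite <- bsum2_plus; apply bsum2_le; intros i Hi; specialize (Hpt i Hi);
    apply Rabs_le_between in Hpt; lra. }
  apply Rabs_le_between; nra.
Qed.

End Profile.

(** * Short-time estimates *)

Section Drift.
Variables (j M : R) (n b m p : nat).
Hypotheses (Hj : 0 < j) (HM : 0 <= M) (Hn : (1 <= n)%nat) (Hm : (1 <= m)%nat) (Hp : (1 <= p)%nat).
Hypotheses (Hb : (2 * p <= b)%nat) (Hbm : (b + 2 * m + 2 * p <= n)%nat).

Let A := (INR n / INR m) ^ 2.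
Let A' := (INR n / INR p) ^ 2.

(** An upper bound of the drift in which site values are replaced by narrow hats of base [2 p]: to
    the left of the site for the positive coefficients, to its right for the negative one. Tails
    decrease, so each replacement raises the expression. *)
Definition ThUp (xi : config) : R :=
  / 2 * A * (Hat n (b - 2 * p) p xi + -2 * Hat n (b + m) p xi + Hat n (b + 2 * m - 2 * p) p xi) + - j.

Definition ThLow (xi : config) : R :=
  - / 2 * A * (Hat n b p xi + -2 * Hat n (b + m - 2 * p) p xi + Hat n (b + 2 * m) p xi) + j.

Lemma gen_three q1 q2 q3 c d xi :
  gen j n (fun x => c * (Hat n q1 p x + -2 * Hat n q2 p x + Hat n q3 p x) + d) xi
  = c * (gen j n (Hat n q1 p) xi - 2 * gen j n (Hat n q2 p) xi + gen j n (Hat n q3 p) xi).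
Proof.
  rewrite (gen_plus j n (fun x => c * (Hat n q1 p x + -2 * Hat n q2 p x + Hat n q3 p x)) (fun _ => d)).
  rewrite gen_const, (gen_scal j n c (fun x => Hat n q1 p x + -2 * Hat n q2 p x + Hat n q3 p x)).
  rewrite (gen_plus j n (fun x => Hat n q1 p x + -2 * Hat n q2 p x) (Hat n q3 p)).
  rewrite (gen_plus j n (Hat n q1 p) (fun x => -2 * Hat n q2 p x)), gen_scal. ring.
Qed.

Lemma gen_Hat_crude q xi : (q + 2 * p <= n)%nat ->
  - (/ 2 * A' * ucum n 0 xi + j) <= INR n ^ 2 * gen j n (Hat n q p) xi <= / 2 * A' * ucum n 0 xi.
Proof.
  intros Hq.
  pose proof (gen_Hat_ge j n Hj Hn q p Hp Hq xi) as H1.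
  pose proof (gen_Hat_le0 j n Hj Hn q p Hp Hq xi) as H2.
  pose proof (lap2_bounds n Hn q p Hp Hq xi) as H3.
  fold A' in H1, H2. assert (HA : 0 <= A') by apply pow2_ge_0. nra.
Qed.

Lemma A_ge0 : 0 <= A. Proof. apply pow2_ge_0. Qed.
Lemma A'_ge0 : 0 <= A'. Proof. apply pow2_ge_0. Qed.

Lemma drift_const_le xi : A * (A' * ucum n 0 xi + j) <= A * (A' * (M + 1) + j) * (1 + mdev n M xi).
Proof.
  pose proof A_ge0 as HA; pose proof A'_ge0 as HA'.
  pose proof (mass_le_mdev n M xi) as HZ. pose proof (mdev_ge0 n M xi) as HP.
  rewrite Rmult_assoc; apply Rmult_le_compat_l; [assumption|].
  assert (A' * ucum n 0 xi <= A' * (M + 1 + mdev n M xi)) by (apply Rmult_le_compat_l; lra).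
  assert (0 <= A' * M * mdev n M xi) by (apply Rmult_le_pos; [apply Rmult_le_pos|]; lra).
  assert (0 <= j * mdev n M xi) by (apply Rmult_le_pos; lra). lra.
Qed.

Lemma three_Hat_bounds q1 q2 q3 xi : (q1 + 2 * p <= n)%nat -> (q2 + 2 * p <= n)%nat -> (q3 + 2 * p <= n)%nat ->
  - (2 * ucum n 0 xi) <= Hat n q1 p xi + -2 * Hat n q2 p xi + Hat n q3 p xi <= 2 * ucum n 0 xi.
Proof.
  intros H1 H2 H3.
  pose proof (Hat_le0 n Hn q1 p Hp H1 xi). pose proof (Hat_ge0 n Hn q1 p Hp H1 xi).
  pose proof (Hat_le0 n Hn q2 p Hp H2 xi). pose proof (Hat_ge0 n Hn q2 p Hp H2 xi).
  pose proof (Hat_le0 n Hn q3 p Hp H3 xi). pose proof (Hat_ge0 n Hn q3 p Hp H3 xi). lra.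
Qed.

(** Supersolutions yield upper bounds only, so the lower bound on the hat average is obtained for
    its negative. The absorption removes at most [j] from the drift on every configuration, hence no
    penalty is called for. *)
Lemma local_drift_low :
  local_drift j n M A 0 (A * (A' * (M + 1) + j)) 0 0 (fun x => -1 * Hat n b m x) ThLow (fun _ => 0).
Proof.
  pose proof A_ge0 as HA; pose proof A'_ge0 as HA'.
  assert (Hbm' : (b + 2 * m <= n)%nat) by lia.
  split; intros xi.
  - pose proof (Hat_le0 n Hn b m Hm Hbm' xi). pose proof (Hat_ge0 n Hn b m Hm Hbm' xi). lra.
  - unfold ThLow.
    pose proof (three_Hat_bounds b (b + m - 2 * p) (b + 2 * m) xi ltac:(lia) ltac:(lia) ltac:(lia)). nra.
  - pose proof (mdev_ge0 n M xi); lra.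
  - rewrite gen_scal.
    pose proof (gen_Hat_ge j n Hj Hn b m Hm Hbm' xi) as H; fold A in H. unfold lap2 in H.
    unfold ThLow.
    pose proof (Hat_le n Hn b p Hp ltac:(lia) xi).
    pose proof (Hat_ge n Hn (b + m - 2 * p) p Hp ltac:(lia) xi) as H1.
    replace (b + m - 2 * p + 2 * p)%nat with (b + m)%nat in H1 by lia.
    pose proof (Hat_le n Hn (b + 2 * m) p Hp ltac:(lia) xi). nra.
  - unfold ThLow. rewrite gen_three. 
    eapply Rle_trans; [|apply drift_const_le].
    pose proof (gen_Hat_crude b xi ltac:(lia)).
    pose proof (gen_Hat_crude (b + m - 2 * p) xi ltac:(lia)).
    pose proof (gen_Hat_crude (b + 2 * m) xi ltac:(lia)).
    set (N2 := INR n ^ 2) in *. set (g1 := gen j n (Hat n b p) xi) in *.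
    set (g2 := gen j n (Hat n (b + m - 2 * p) p) xi) in *. set (g3 := gen j n (Hat n (b + 2 * m) p) xi) in *.
    replace (N2 * (- / 2 * A * (g1 - 2 * g2 + g3)))
      with (A * (/ 2 * (2 * (N2 * g2) - N2 * g1 - N2 * g3))) by ring.
    apply Rmult_le_compat_l; [assumption|lra].
  - rewrite gen_const; pose proof (mdev_ge0 n M xi); lra.
Qed.

(** The right side of [gen_Hat_sqr_le] with [c = y0], after the mass and its square are bounded
    through [mdev]. *)
Definition CQ (j M A' y0 : R) : R :=
  A' * (2 * M ^ 2 + 2) + (2 * j + y0 * A' + A') * (M + 1) + 2 * j * y0 + j.

(** If the tail at [b + 2 m] is nonempty, the full absorption [- j] acts and the penalty may be
    dropped. Otherwise the penalty makes up for its absence. *)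
Lemma local_drift_up y0 : 0 < y0 ->
  local_drift j n M A (j / y0 ^ 2) (A * (A' * (M + 1) + j)) (CQ j M A' y0) (4 * M ^ 2 + 4 + 2 * y0 ^ 2)
    (Hat n b m) ThUp (fun x => (Hat n (b + 2 * m) p x - y0) ^ 2).
Proof.
  intros Hy. pose proof A_ge0 as HA; pose proof A'_ge0 as HA'.
  assert (Hbm' : (b + 2 * m <= n)%nat) by lia.
  assert (Hkap : 0 < j / y0 ^ 2) by (apply Rdiv_lt_0_compat; [lra|apply pow_lt; lra]).
  split; intros xi.
  - pose proof (Hat_le0 n Hn b m Hm Hbm' xi). pose proof (Hat_ge0 n Hn b m Hm Hbm' xi). lra.
  - unfold ThUp.
    pose proof (three_Hat_bounds (b - 2 * p) (b + m) (b + 2 * m - 2 * p) xi ltac:(lia) ltac:(lia) ltac:(lia)). nra.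
  - split; [apply pow2_ge_0|].
    pose proof (Hat_le0 n Hn (b + 2 * m) p Hp Hbm xi). pose proof (Hat_ge0 n Hn (b + 2 * m) p Hp Hbm xi).
    pose proof (mass_sqr_le_mdev n M xi) as HZ. pose proof (mdev_ge0 n M xi) as HP.
    assert (H1 : (Hat n (b + 2 * m) p xi - y0) ^ 2 <= 2 * ucum n 0 xi ^ 2 + 2 * y0 ^ 2) by nra.
    assert (0 <= (4 * M ^ 2 + 2 * y0 ^ 2) * mdev n M xi).
    { apply Rmult_le_pos; [|lra]. pose proof (pow2_ge_0 M); pose proof (pow2_ge_0 y0); lra. }
    lra.
  - pose proof (Hat_ge n Hn (b - 2 * p) p Hp ltac:(lia) xi) as H1.
    replace (b - 2 * p + 2 * p)%nat with b in H1 by lia.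
    pose proof (Hat_le n Hn (b + m) p Hp ltac:(lia) xi) as H2.
    pose proof (Hat_ge n Hn (b + 2 * m - 2 * p) p Hp ltac:(lia) xi) as H3.
    replace (b + 2 * m - 2 * p + 2 * p)%nat with (b + 2 * m)%nat in H3 by lia.
    destruct (Rle_lt_or_eq_dec _ _ (Feps_ge0 n (b + 2 * m) xi)) as [Hpos|Hzero].
    + pose proof (gen_Hat_le j n Hn b m Hm Hbm' xi Hpos) as H; fold A in H. unfold lap2 in H.
      assert (0 <= j / y0 ^ 2 * (Hat n (b + 2 * m) p xi - y0) ^ 2)
        by (apply Rmult_le_pos; [lra|apply pow2_ge_0]).
      unfold ThUp. nra.
    (* Empty tail: the narrow hat average at [b + 2 m] is 0, so the penalty equals exactly [j]. *)
    + pose proof (gen_Hat_le0 j n Hj Hn b m Hm Hbm' xi) as H; fold A in H. unfold lap2 in H.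
      assert (HY : Hat n (b + 2 * m) p xi = 0).
      { apply Rle_antisym; [|apply Hat_ge0; assumption].
        eapply Rle_trans; [apply Hat_le; assumption|]. unfold ucum; rewrite <- Hzero; lra. }
      rewrite HY. replace (j / y0 ^ 2 * (0 - y0) ^ 2) with j by (field; lra).
      unfold ThUp. nra.
  - unfold ThUp. rewrite gen_three.
    eapply Rle_trans; [|apply drift_const_le].
    pose proof (gen_Hat_crude (b - 2 * p) xi ltac:(lia)).
    pose proof (gen_Hat_crude (b + m) xi ltac:(lia)).
    pose proof (gen_Hat_crude (b + 2 * m - 2 * p) xi ltac:(lia)).
    set (N2 := INR n ^ 2) in *. set (g1 := gen j n (Hat n (b - 2 * p) p) xi) in *.
    set (g2 := gen j n (Hat n (b + m) p) xi) in *. set (g3 := gen j n (Hat n (b + 2 * m - 2 * p) p) xi) in *.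
    replace (N2 * (/ 2 * A * (g1 - 2 * g2 + g3)))
      with (A * (/ 2 * (N2 * g1 - 2 * (N2 * g2) + N2 * g3))) by ring.
    apply Rmult_le_compat_l; [assumption|lra].
  - eapply Rle_trans; [apply gen_Hat_sqr_le; try assumption; lra|]. fold A'.
    pose proof (mass_le_mdev n M xi) as HZ. pose proof (mdev_ge0 n M xi) as HP.
    pose proof (mass_sqr_le_mdev n M xi) as HZ2. pose proof (ucum_ge0 n Hn 0 xi) as HZ0.
    set (P := mdev n M xi) in *. set (Z := ucum n 0 xi) in *. unfold CQ.
    replace ((Z + y0) * (A' * Z + 2 * j) + A' * Z + j)
      with (A' * Z ^ 2 + (2 * j + y0 * A' + A') * Z + (2 * j * y0 + j)) by ring.
    assert (Hc : 0 <= 2 * j + y0 * A' + A') by (assert (0 <= y0 * A') by (apply Rmult_le_pos; lra); lra).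
    set (c := 2 * j + y0 * A' + A') in *.
    assert (E1 : A' * Z ^ 2 <= A' * (2 * M ^ 2 + 2 * P)) by (apply Rmult_le_compat_l; lra).
    assert (E2 : c * Z <= c * (M + 1 + P)) by (apply Rmult_le_compat_l; lra).
    assert (E3 : 0 <= A' * M ^ 2 * P)
      by (apply Rmult_le_pos; [apply Rmult_le_pos; [lra|apply pow2_ge_0]|lra]).
    assert (E4 : 0 <= c * M * P) by (apply Rmult_le_pos; [apply Rmult_le_pos|]; lra).
    assert (E5 : 0 <= (2 * j * y0 + j) * P) by (apply Rmult_le_pos; [nra|lra]).
    lra.
Qed.

End Drift.

(** * Mass conservation and short-time inequalities at rational positions *)

Section LocalEstimates.
Variables (j M : R) (rho : R -> R -> R) (xi0 : nat -> config).
Hypotheses (Hj : 0 < j) (HM : 0 <= M).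
Hypothesis Hlim : forall zeta t, 0 < zeta -> 0 <= t ->
  is_lim_seq (fun n => Prob j n (hdl_event n zeta (rho t)) (INR n ^ 2 * t) (xi0 n)) 1.
Hypothesis Hmass : is_lim_seq (fun n => mdev n M (xi0 n)) 0.
Hypothesis rho_ge0 : forall t r, 0 <= t -> 0 <= r <= 1 -> 0 <= rho t r.
Hypothesis rho_cont : forall t r, 0 <= t -> 0 <= r <= 1 ->
  filterlim (fun p : R * R => rho (fst p) (snd p))
    (within (fun p : R * R => 0 <= fst p /\ 0 <= snd p <= 1) (locally (t, r)))
    (locally (rho t r)).

Notation f := (fF rho).
Notation g := (gF rho).

(** If the limit mass differed from [M] by [de], the squared mass deviation would be at least
    [(de / 2) ^ 2] on a typical configuration at time [t]. It starts near 0 and its supersolution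
    grows by only [2 j t / n]. *)
Lemma mass_conserved t : 0 <= t -> f t 0 = M.
Proof.
  intros Ht. destruct (Req_dec (f t 0) M) as [|Hne]; [assumption|exfalso].
  set (de := Rabs (f t 0 - M)). assert (Hde : 0 < de) by (apply Rabs_pos_lt; lra).
  set (be := (de / 2) ^ 2). assert (Hbe : 0 < be) by (apply pow_lt; lra).
  cut (be <= be / 2); [lra|].
  apply (limit_principle j M rho xi0 Hj HM Hlim Hmass 1 0 t (de / 2) be (be / 2) (1 + be / 2));
    try lra; try lia.
  assert (L : is_lim_seq (fun n => 2 * j * t * / INR n) 0).
  { replace (Finite 0) with (Rbar_mult (2 * j * t) 0) by (simpl; f_equal; ring).
    apply (is_lim_seq_scal_l (fun n => / INR n)).
    replace (Finite 0) with (Rbar_inv p_infty) by reflexivity.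
    apply is_lim_seq_inv; [apply is_lim_seq_INR | discriminate]. }
  apply is_lim_seq_spec in L. assert (Hb2 : 0 < be / 2) by lra.
  destruct (L (mkposreal _ Hb2)) as [k0 Hk0]; simpl in Hk0.
  exists (S k0); intros k Hk. rewrite Nat.mul_1_r, Rplus_0_l.
  specialize (Hk0 k ltac:(lia)). rewrite Rminus_0_r in Hk0; apply Rabs_lt_between in Hk0.
  change (2 * j * t * / INR k) with (2 * j * t / INR k) in Hk0.
  assert (Hk1 : (1 <= k)%nat) by lia. pose proof (INRn_gt0 k Hk1) as Hkp.
  do 2 eexists; split; [|split; [|split]].
  - apply (mass_supersolution j k M 0 1 t); assumption || lra.
  - intros x Hx. pose proof (hdl_event_spec rho k (de / 2) t x 0 Ht Hk1 Hx ltac:(lia)) as E.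
    replace (INR 0 / INR k) with 0 in E by (simpl; field; lra).
    cbv beta. replace (2 * j * 0 / INR k) with 0 by (field; lra).
    unfold mdev, be. rewrite Rplus_0_l, Rmult_1_l, Rplus_0_r.
    rewrite <- (Rabs_right (de / 2)) by lra. rewrite <- !Rsqr_pow2. apply Rsqr_le_abs_1.
    rewrite Rabs_Rabsolu, (Rabs_right (de / 2)) by lra.
    unfold de in *. revert E; unfold Rabs; repeat destruct Rcase_abs; lra.
  - intros x. cbv beta. pose proof (mdev_ge0 k M x). nra.
  - intros x _. cbv beta. pose proof (mdev_ge0 k M x). nra.
Qed.

Lemma f_le_M t r : 0 <= t -> 0 <= r -> f t r <= M.
Proof. intros Ht Hr; rewrite <- (mass_conserved t Ht); apply fF_decr; assumption. Qed.

Variables (N b0 m0 p0 : nat).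
Hypotheses (HN : (1 <= N)%nat) (Hm0 : (1 <= m0)%nat) (Hp0 : (1 <= p0)%nat).
Hypotheses (Hb0 : (2 * p0 <= b0)%nat) (Hbm0 : (b0 + 2 * m0 + 2 * p0 <= N)%nat).

Let A := (INR N / INR m0) ^ 2.
Let A' := (INR N / INR p0) ^ 2.
Let fq (s : R) (q : nat) := f s (INR q / INR N).

Lemma ratio_scale k q : (1 <= k)%nat -> (1 <= q)%nat -> INR (k * N) / INR (k * q) = INR N / INR q.
Proof.
  intros Hk Hq. assert (0 < INR k) by (apply (lt_INR 0); lia).
  assert (0 < INR q) by (apply (lt_INR 0); lia). rewrite !mult_INR; field; lra.
Qed.

Lemma pos_scale k q : (1 <= k)%nat -> INR (k * q) / INR (k * N) = INR q / INR N.
Proof.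
  intros Hk. assert (0 < INR k) by (apply (lt_INR 0); lia).
  assert (0 < INR N) by (apply (lt_INR 0); lia). rewrite !mult_INR; field; lra.
Qed.

Lemma ucum_event k zeta s x q : 0 <= s -> (1 <= k)%nat -> (q <= N)%nat ->
  hdl_event (k * N) zeta (rho s) x = true -> Rabs (ucum (k * N) (k * q) x - fq s q) <= zeta.
Proof.
  intros Hs Hk Hq Hx. unfold fq; rewrite <- (pos_scale k q Hk).
  apply hdl_event_spec; try assumption; nia.
Qed.

Lemma frac_01 q : (q <= N)%nat -> 0 <= INR q / INR N <= 1.
Proof.
  intros Hq. assert (HNp : 0 < INR N) by (apply (lt_INR 0); lia). pose proof (pos_INR q).
  apply le_INR in Hq. split; [apply Rdiv_le_0_compat; lra|].
  apply (Rmult_le_reg_r (INR N)); [lra|]. unfold Rdiv; rewrite Rmult_assoc, Rinv_l by lra; lra.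
Qed.

Lemma eta_gt0 q : (1 <= q)%nat -> 0 < INR q / INR N.
Proof. intros Hq; apply Rdiv_lt_0_compat; apply (lt_INR 0); lia. Qed.

Lemma g_range s q m : 0 <= s -> (1 <= m)%nat -> (q + 2 * m <= N)%nat ->
  0 <= g s (INR m / INR N) (INR q / INR N) <= M.
Proof.
  intros Hs Hm Hq. destruct (gF_bounds rho rho_ge0 rho_cont s (INR m / INR N) (INR q / INR N) (eta_gt0 m Hm)) as [H1 H2].
  pose proof (frac_01 (q + 2 * m) Hq) as H3. pose proof (frac_01 q ltac:(lia)) as H4.
  assert (HNp : 0 < INR N) by (apply (lt_INR 0); lia).
  replace (INR q / INR N + 2 * (INR m / INR N)) with (INR (q + 2 * m) / INR N) in H1
    by (rewrite plus_INR, mult_INR; simpl (INR 2); field; lra).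
  split; [eapply Rle_trans; [|exact H1]; apply fF_ge0; try assumption; lra|].
  eapply Rle_trans; [exact H2|]. apply f_le_M; lra.
Qed.

Lemma local_low s tau : 0 <= s -> 0 <= tau -> tau * A <= 1 -> tau * j <= 1 ->
  g s (INR m0 / INR N) (INR b0 / INR N)
   + tau * (/ 2 * A * (fq s (b0 + 2 * p0) - 2 * fq s (b0 + m0 - 2 * p0) + fq s (b0 + 2 * m0 + 2 * p0)) - j)
   - tau ^ 2 * (A * (A' * (M + 1) + j))
  <= g (s + tau) (INR m0 / INR N) (INR b0 / INR N).
Proof.
  intros Hs Ht HtA Htj.
  assert (HA : 0 <= A) by apply pow2_ge_0. assert (HA' : 0 <= A') by apply pow2_ge_0.
  set (C1 := A * (A' * (M + 1) + j)).
  assert (HC1 : 0 <= C1).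
  { apply Rmult_le_pos; [assumption|]. assert (0 <= A' * (M + 1)) by (apply Rmult_le_pos; lra). lra. }
  pose proof (g_range (s + tau) b0 m0 ltac:(lra) Hm0 ltac:(lia)) as Hg.
  pose proof (local_limit j M rho xi0 Hj HM Hlim Hmass N s tau A 0 C1 0 0
    (- g s (INR m0 / INR N) (INR b0 / INR N)) (- g (s + tau) (INR m0 / INR N) (INR b0 / INR N))
    (- / 2 * A * (fq s (b0 + 2 * p0) - 2 * fq s (b0 + m0 - 2 * p0) + fq s (b0 + 2 * m0 + 2 * p0)) + j)
    HN HA ltac:(lra) HC1 ltac:(lra) ltac:(lra) Ht Hs HtA Htj ltac:(lra)) as H.
  enough (Hh : forall e, 0 < e -> exists zeta, 0 < zeta /\ eventually (fun k => exists D Th Q,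
     local_drift j (k * N) M A 0 C1 0 0 D Th Q /\
     (forall x, hdl_event (k * N) zeta (rho (s + tau)) x = true ->
        - g (s + tau) (INR m0 / INR N) (INR b0 / INR N) - e <= D x) /\
     (forall x, hdl_event (k * N) zeta (rho s) x = true ->
       D x <= - g s (INR m0 / INR N) (INR b0 / INR N) + e /\
       Th x <= - / 2 * A * (fq s (b0 + 2 * p0) - 2 * fq s (b0 + m0 - 2 * p0) + fq s (b0 + 2 * m0 + 2 * p0)) + j + e /\
       Q x <= e))) by (specialize (H Hh); lra).
  clear H. intros e He.
  (* [ThLow] multiplies four site errors of size [e1 / 2] by [A / 2], which gives [A * e1]. *)
  set (e1 := Rmin e (e / (A + 1))).
  assert (He1 : 0 < e1) by (apply Rmin_glb_lt; [lra|apply Rdiv_lt_0_compat; lra]).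
  assert (He1e : e1 <= e) by apply Rmin_l.
  assert (He1A : A * e1 <= e).
  { apply Rle_trans with (A * (e / (A + 1))); [apply Rmult_le_compat_l; [lra|apply Rmin_r]|].
    apply (Rmult_le_reg_r (A + 1)); [lra|].
    replace (A * (e / (A + 1)) * (A + 1)) with (A * e) by (field; lra). lra. }
  exists (e1 / 2); split; [lra|].
  destruct (Hat_close rho rho_ge0 rho_cont N b0 m0 (s + tau) e1 HN Hm0 ltac:(lia) ltac:(lra) He1) as [k1 Hk1].
  destruct (Hat_close rho rho_ge0 rho_cont N b0 m0 s e1 HN Hm0 ltac:(lia) ltac:(lra) He1) as [k2 Hk2].
  exists (S (k1 + k2)); intros k Hk. assert (Hk0 : (1 <= k)%nat) by lia.
  assert (EA : (INR (k * N) / INR (k * m0)) ^ 2 = A) by (rewrite ratio_scale by assumption; reflexivity).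
  assert (EA' : (INR (k * N) / INR (k * p0)) ^ 2 = A') by (rewrite ratio_scale by assumption; reflexivity).
  exists (fun x => -1 * Hat (k * N) (k * b0) (k * m0) x), (ThLow j (k * N) (k * b0) (k * m0) (k * p0)), (fun _ => 0).
  split; [|split].
  - pose proof (local_drift_low j M (k * N) (k * b0) (k * m0) (k * p0) Hj HM
      ltac:(nia) ltac:(nia) ltac:(nia) ltac:(nia) ltac:(nia)) as HL.
    rewrite EA, EA' in HL. exact HL.
  - intros x Hx. specialize (Hk1 k ltac:(lia) x Hx). apply Rabs_le_between in Hk1; lra.
  - intros x Hx. split; [|split; [|lra]].
    + specialize (Hk2 k ltac:(lia) x Hx). apply Rabs_le_between in Hk2; lra.
    + unfold ThLow; rewrite EA.
      pose proof (Hat_ge (k * N) ltac:(nia) (k * b0) (k * p0) ltac:(nia) ltac:(nia) x) as E1.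
      replace (k * b0 + 2 * (k * p0))%nat with (k * (b0 + 2 * p0))%nat in E1 by nia.
      pose proof (Hat_le (k * N) ltac:(nia) (k * b0 + k * m0 - 2 * (k * p0)) (k * p0) ltac:(nia) ltac:(nia) x) as E2.
      replace (k * b0 + k * m0 - 2 * (k * p0))%nat with (k * (b0 + m0 - 2 * p0))%nat in * by nia.
      pose proof (Hat_ge (k * N) ltac:(nia) (k * b0 + 2 * (k * m0)) (k * p0) ltac:(nia) ltac:(nia) x) as E3.
      replace (k * b0 + 2 * (k * m0) + 2 * (k * p0))%nat with (k * (b0 + 2 * m0 + 2 * p0))%nat in E3 by nia.
      pose proof (ucum_event k (e1 / 2) s x (b0 + 2 * p0) Hs Hk0 ltac:(lia) Hx) as U1.
      pose proof (ucum_event k (e1 / 2) s x (b0 + m0 - 2 * p0) Hs Hk0 ltac:(lia) Hx) as U2.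
      pose proof (ucum_event k (e1 / 2) s x (b0 + 2 * m0 + 2 * p0) Hs Hk0 ltac:(lia) Hx) as U3.
      apply Rabs_le_between in U1; apply Rabs_le_between in U2; apply Rabs_le_between in U3.
      nra.
Qed.

(** The error constant involves the lower bound [c0] and the total mass [M] instead of the value
    [y0], which depends on the grid: it stays fixed when rational positions approach a real one. *)
Lemma local_up s tau c0 : 0 <= s -> 0 <= tau -> tau * A <= 1 -> tau * j <= 1 ->
  0 < c0 <= fq s (b0 + 2 * m0 + 2 * p0) ->
  g (s + tau) (INR m0 / INR N) (INR b0 / INR N)
  <= g s (INR m0 / INR N) (INR b0 / INR N)
   + tau * (/ 2 * A * (fq s (b0 - 2 * p0) - 2 * fq s (b0 + m0 + 2 * p0) + fq s (b0 + 2 * m0 - 2 * p0)) - j)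
   + tau ^ 2 * (A * (A' * (M + 1) + j) + j / c0 ^ 2 * CQ j M A' M).
Proof.
  intros Hs Ht HtA Htj Hc0.
  assert (HA : 0 <= A) by apply pow2_ge_0. assert (HA' : 0 <= A') by apply pow2_ge_0.
  assert (HNp : 0 < INR N) by (apply (lt_INR 0); lia).
  set (C1 := A * (A' * (M + 1) + j)).
  assert (HC1 : 0 <= C1).
  { apply Rmult_le_pos; [assumption|]. assert (0 <= A' * (M + 1)) by (apply Rmult_le_pos; lra). lra. }
  pose proof (g_range (s + tau) b0 m0 ltac:(lra) Hm0 ltac:(lia)) as Hg.
  set (y0 := g s (INR p0 / INR N) (INR (b0 + 2 * m0) / INR N)).
  assert (Hy0 : c0 <= y0 <= M).
  { split; [|apply g_range; try assumption; lia].
    eapply Rle_trans; [apply Hc0|].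
    destruct (gF_bounds rho rho_ge0 rho_cont s (INR p0 / INR N) (INR (b0 + 2 * m0) / INR N) (eta_gt0 p0 Hp0)) as [H1 _].
    replace (INR (b0 + 2 * m0) / INR N + 2 * (INR p0 / INR N)) with (INR (b0 + 2 * m0 + 2 * p0) / INR N) in H1
      by (rewrite !plus_INR, !mult_INR; simpl (INR 2); field; lra).
    exact H1. }
  set (kap := j / y0 ^ 2).
  assert (Hkap : 0 < kap) by (apply Rdiv_lt_0_compat; [lra|apply pow_lt; lra]).
  assert (HCQ : forall y, 0 <= y -> 0 <= CQ j M A' y).
  { intros y Hy. unfold CQ. pose proof (pow2_ge_0 M).
    assert (0 <= A' * (2 * M ^ 2 + 2)) by (apply Rmult_le_pos; lra).
    assert (0 <= y * A') by (apply Rmult_le_pos; lra).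
    assert (0 <= (2 * j + y * A' + A') * (M + 1)) by (apply Rmult_le_pos; lra).
    assert (0 <= j * y) by (apply Rmult_le_pos; lra). lra. }
  assert (HkC : kap * CQ j M A' y0 <= j / c0 ^ 2 * CQ j M A' M).
  { apply Rmult_le_compat; [lra | apply HCQ; lra | |].
    - apply Rmult_le_compat_l; [lra|]. apply Rinv_le_contravar; [apply pow_lt; lra|].
      apply pow_incr; lra.
    - unfold CQ.
      assert (y0 * A' <= M * A') by (apply Rmult_le_compat_r; lra).
      assert ((2 * j + y0 * A' + A') * (M + 1) <= (2 * j + M * A' + A') * (M + 1))
        by (apply Rmult_le_compat_r; lra).
      assert (j * y0 <= j * M) by (apply Rmult_le_compat_l; lra). lra. }
  apply Rle_trans with (g s (INR m0 / INR N) (INR b0 / INR N)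
   + tau * (/ 2 * A * (fq s (b0 - 2 * p0) - 2 * fq s (b0 + m0 + 2 * p0) + fq s (b0 + 2 * m0 - 2 * p0)) - j)
   + tau ^ 2 * (C1 + kap * CQ j M A' y0)).
  2:{ apply Rplus_le_compat_l, Rmult_le_compat_l; [apply pow2_ge_0 | lra]. }
  apply (local_limit j M rho xi0 Hj HM Hlim Hmass N s tau A kap C1 (CQ j M A' y0) (4 * M ^ 2 + 4 + 2 * y0 ^ 2));
    try assumption; try lra.
  { apply HCQ; lra. }
  { pose proof (pow2_ge_0 M); pose proof (pow2_ge_0 y0); lra. }
  intros e He.
  (* The bound by 1 is for the penalty, which is at most [e1 ^ 2] on the event and must be at most
     [e]. *)
  set (e1 := Rmin (Rmin e 1) (e / (A + 1))).
  assert (He1 : 0 < e1) by (repeat apply Rmin_glb_lt; try lra; apply Rdiv_lt_0_compat; lra).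
  assert (He1e : e1 <= e) by (eapply Rle_trans; [apply Rmin_l|apply Rmin_l]).
  assert (He11 : e1 <= 1) by (eapply Rle_trans; [apply Rmin_l|apply Rmin_r]).
  assert (He1A : A * e1 <= e).
  { apply Rle_trans with (A * (e / (A + 1))); [apply Rmult_le_compat_l; [lra|apply Rmin_r]|].
    apply (Rmult_le_reg_r (A + 1)); [lra|].
    replace (A * (e / (A + 1)) * (A + 1)) with (A * e) by (field; lra). lra. }
  exists (e1 / 2); split; [lra|].
  destruct (Hat_close rho rho_ge0 rho_cont N b0 m0 (s + tau) e1 HN Hm0 ltac:(lia) ltac:(lra) He1) as [k1 Hk1].
  destruct (Hat_close rho rho_ge0 rho_cont N b0 m0 s e1 HN Hm0 ltac:(lia) ltac:(lra) He1) as [k2 Hk2].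
  destruct (Hat_close rho rho_ge0 rho_cont N (b0 + 2 * m0) p0 s e1 HN Hp0 ltac:(lia) ltac:(lra) He1) as [k3 Hk3].
  exists (S (k1 + k2 + k3)); intros k Hk. assert (Hk0 : (1 <= k)%nat) by lia.
  assert (EA : (INR (k * N) / INR (k * m0)) ^ 2 = A) by (rewrite ratio_scale by assumption; reflexivity).
  assert (EA' : (INR (k * N) / INR (k * p0)) ^ 2 = A') by (rewrite ratio_scale by assumption; reflexivity).
  exists (Hat (k * N) (k * b0) (k * m0)), (ThUp j (k * N) (k * b0) (k * m0) (k * p0)),
    (fun x => (Hat (k * N) (k * b0 + 2 * (k * m0)) (k * p0) x - y0) ^ 2).
  split; [|split].
  - pose proof (local_drift_up j M (k * N) (k * b0) (k * m0) (k * p0) Hj HM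
      ltac:(nia) ltac:(nia) ltac:(nia) ltac:(nia) ltac:(nia) y0 ltac:(lra)) as HL.
    rewrite EA, EA' in HL. exact HL.
  - intros x Hx. specialize (Hk1 k ltac:(lia) x Hx). apply Rabs_le_between in Hk1; lra.
  - intros x Hx. split; [|split].
    + specialize (Hk2 k ltac:(lia) x Hx). apply Rabs_le_between in Hk2; lra.
    + unfold ThUp; rewrite EA.
      pose proof (Hat_le (k * N) ltac:(nia) (k * b0 - 2 * (k * p0)) (k * p0) ltac:(nia) ltac:(nia) x) as E1.
      replace (k * b0 - 2 * (k * p0))%nat with (k * (b0 - 2 * p0))%nat in * by nia.
      pose proof (Hat_ge (k * N) ltac:(nia) (k * b0 + k * m0) (k * p0) ltac:(nia) ltac:(nia) x) as E2.
      replace (k * b0 + k * m0 + 2 * (k * p0))%nat with (k * (b0 + m0 + 2 * p0))%nat in E2 by nia.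
      pose proof (Hat_le (k * N) ltac:(nia) (k * b0 + 2 * (k * m0) - 2 * (k * p0)) (k * p0) ltac:(nia) ltac:(nia) x) as E3.
      replace (k * b0 + 2 * (k * m0) - 2 * (k * p0))%nat with (k * (b0 + 2 * m0 - 2 * p0))%nat in * by nia.
      pose proof (ucum_event k (e1 / 2) s x (b0 - 2 * p0) Hs Hk0 ltac:(lia) Hx) as U1.
      pose proof (ucum_event k (e1 / 2) s x (b0 + m0 + 2 * p0) Hs Hk0 ltac:(lia) Hx) as U2.
      pose proof (ucum_event k (e1 / 2) s x (b0 + 2 * m0 - 2 * p0) Hs Hk0 ltac:(lia) Hx) as U3.
      apply Rabs_le_between in U1; apply Rabs_le_between in U2; apply Rabs_le_between in U3.
      nra.
    + specialize (Hk3 k ltac:(lia) x Hx). fold y0 in Hk3.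
      replace (k * (b0 + 2 * m0))%nat with (k * b0 + 2 * (k * m0))%nat in Hk3 by nia.
      apply Rabs_le_between in Hk3. nra.
Qed.

End LocalEstimates.

(** * Existence of approximating configurations *)

Definition natfloor (x : R) : nat := Z.to_nat (Int_part x).

Lemma natfloor_spec x : 0 <= x -> INR (natfloor x) <= x < INR (natfloor x) + 1.
Proof.
  intros Hx. destruct (base_Int_part x) as [H1 H2]. unfold natfloor.
  assert (Hz : (0 <= Int_part x)%Z).
  { apply Z.lt_succ_r, lt_IZR. rewrite succ_IZR. lra. }
  rewrite INR_IZR_INZ, Z2Nat.id by assumption. lra.
Qed.

Lemma natfloor_le x y : 0 <= x -> x <= y -> (natfloor x <= natfloor y)%nat.
Proof.
  intros Hx Hxy. pose proof (natfloor_spec x Hx). pose proof (natfloor_spec y ltac:(lra)).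
  apply Nat.lt_succ_r, INR_lt. rewrite S_INR. lra.
Qed.

Section Approximation.
Variable u : R -> R.
Hypothesis u_cont : forall r, 0 <= r <= 1 ->
  filterlim u (within (fun x => 0 <= x <= 1) (locally r)) (locally (u r)).
Hypothesis u_ge0 : forall r, 0 <= r <= 1 -> 0 <= u r.

Let uc (r : R) := u (clamp01 r).

Lemma uc_continuous r : continuous uc r.
Proof.
  apply continuity_pt_filterlim, continuity_pt_locally; intros eps.
  destruct (u_cont (clamp01 r) (clamp01_in r) (fun z => Rabs (z - u (clamp01 r)) < eps)) as [de Hde].
  { exists eps; intros z Hz; exact Hz. }
  exists de; intros z Hz. apply (Hde (clamp01 z)); [|apply clamp01_in].
  change (Rabs (clamp01 z - clamp01 r) < de).
  eapply Rle_lt_trans; [apply clamp01_lip | exact Hz].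
Qed.

Lemma ex_RInt_uc a b : ex_RInt uc a b.
Proof. apply (ex_RInt_continuous (V := R_CompleteNormedModule)); intros; apply uc_continuous. Qed.

(** Averaging windows may end at [(n + 1) / n], where [ext01 u] vanishes; hence the cut at 1. *)
Let I (x : R) : R := RInt uc 0 (Rmin x 1).

Lemma is_RInt_ext01 x : 0 <= x -> is_RInt (ext01 u) 0 x (I x).
Proof.
  intros Hx.
  assert (H1 : forall y, 0 <= y <= 1 -> is_RInt (ext01 u) 0 y (RInt uc 0 y)).
  { intros y Hy. apply (is_RInt_ext uc).
    - intros z Hz. rewrite Rmin_left, Rmax_right in Hz by lra. unfold uc, ext01.
      rewrite clamp01_id by lra. destruct (Rle_dec 0 z), (Rle_dec z 1); lra.
    - apply (RInt_correct (V := R_CompleteNormedModule)), ex_RInt_uc. }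
  unfold I; destruct (Rle_dec x 1) as [Hx1|Hx1].
  - rewrite Rmin_left by assumption. apply H1; lra.
  - rewrite Rmin_right by lra. rewrite <- (Rplus_0_r (RInt uc 0 1)).
    apply (is_RInt_Chasles (V := R_NormedModule) (ext01 u) 0 1 x); [apply H1; lra|].
    apply (is_RInt_ext (fun _ => 0)).
    + intros z Hz. rewrite Rmin_left, Rmax_right in Hz by lra. unfold ext01.
      destruct (Rle_dec 0 z), (Rle_dec z 1); lra.
    + pose proof (is_RInt_const (V := R_NormedModule) 1 x 0) as H0.
      refine (eq_ind _ (fun l => is_RInt (V := R_NormedModule) (fun _ => 0) 1 x l) H0 0 _).
      apply Rmult_0_r.
Qed.

Lemma RInt_ext01 x y : 0 <= x -> 0 <= y -> RInt (ext01 u) x y = I y - I x.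
Proof.
  intros Hx Hy. apply is_RInt_unique.
  replace (I y - I x) with (plus (opp (I x)) (I y)) by (unfold plus, opp; simpl; ring).
  apply (is_RInt_Chasles (V := R_NormedModule) (ext01 u) x 0 y); [|now apply is_RInt_ext01].
  apply (is_RInt_swap (V := R_NormedModule)), is_RInt_ext01, Hx.
Qed.

Lemma I_incr x y : 0 <= x -> x <= y -> I x <= I y.
Proof.
  intros Hx Hxy. unfold I.
  rewrite <- (RInt_Chasles (V := R_CompleteNormedModule) uc 0 (Rmin x 1) (Rmin y 1)) by apply ex_RInt_uc.
  assert (0 <= RInt uc (Rmin x 1) (Rmin y 1)).
  { apply RInt_ge_0; [apply Rle_min_compat_r; lra | apply ex_RInt_uc |].
    intros; apply u_ge0, clamp01_in. }
  unfold plus; simpl; lra.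
Qed.

Lemma I_ge0 x : 0 <= x -> 0 <= I x.
Proof.
  intros Hx. apply Rle_trans with (I 0); [|apply I_incr; lra].
  unfold I; rewrite Rmin_left, RInt_point by lra; unfold zero; simpl; lra.
Qed.

Lemma I_1 : I 1 = RInt u 0 1.
Proof.
  unfold I; rewrite Rmin_left by lra; apply RInt_ext; intros x Hx.
  rewrite Rmin_left, Rmax_right in Hx by lra. unfold uc; now rewrite clamp01_id by lra.
Qed.

(** Rounding the cumulative mass, rather than the mass of each site, keeps the error of every window
    sum bounded whatever its length. *)
Let kfl (n y : nat) : nat := natfloor (INR n * I (INR y / INR n)).

(* Rounding the integral of [u] may lose the mass near its edge: the particle added at [e n] restores it. *)
Definition afam (e : nat -> nat) (n : nat) : config :=
  fun y => (kfl n (S y) - kfl n y + (if Nat.eqb y (e n) then 1 else 0))%nat.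

Lemma frac_ge0 n y : (1 <= n)%nat -> 0 <= INR y / INR n.
Proof. intros Hn; apply Rdiv_le_0_compat; [apply pos_INR | now apply INRn_gt0]. Qed.

Lemma kfl_spec n y : (1 <= n)%nat ->
  INR (kfl n y) <= INR n * I (INR y / INR n) < INR (kfl n y) + 1.
Proof.
  intros Hn; apply natfloor_spec. apply Rmult_le_pos; [apply pos_INR|].
  now apply I_ge0, frac_ge0.
Qed.

Lemma kfl_incr n y : (1 <= n)%nat -> (kfl n y <= kfl n (S y))%nat.
Proof.
  intros Hn; pose proof (INRn_gt0 n Hn) as Hn0. apply natfloor_le.
  - apply Rmult_le_pos; [lra|]. now apply I_ge0, frac_ge0.
  - apply Rmult_le_compat_l; [lra|]. apply I_incr; [now apply frac_ge0|].
    apply Rmult_le_compat_r; [left; now apply Rinv_0_lt_compat|]. rewrite S_INR; lra.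
Qed.

Lemma rsum_afam e n x len : (1 <= n)%nat ->
  rsum (afam e n) x len = INR (kfl n (x + len)) - INR (kfl n x)
    + (if Nat.leb x (e n) then (if Nat.ltb (e n) (x + len) then 1 else 0) else 0).
Proof.
  intros Hn; revert x; induction len as [|len IH]; intros x.
  - rewrite Nat.add_0_r. unfold rsum; simpl.
    destruct (Nat.leb_spec x (e n)), (Nat.ltb_spec (e n) x); try lia; lra.
  - rewrite rsum_S, IH. unfold afam.
    rewrite plus_INR, minus_INR by now apply kfl_incr.
    replace (S x + len)%nat with (x + S len)%nat by lia.
    destruct (Nat.eqb_spec x (e n)), (Nat.leb_spec (S x) (e n)), (Nat.leb_spec x (e n)),
      (Nat.ltb_spec (e n) (x + S len)); try lia; simpl (INR 1); simpl (INR 0); lra.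
Qed.

(** The fractional parts at the two ends differ by less than 1, and the added particle counts for at
    most 1. *)
Lemma rsum_afam_close e n x len : (1 <= n)%nat ->
  Rabs (rsum (afam e n) x len - INR n * RInt (ext01 u) (INR x / INR n) (INR (x + len) / INR n)) <= 2.
Proof.
  intros Hn. rewrite rsum_afam, RInt_ext01 by (assumption || now apply frac_ge0).
  pose proof (kfl_spec n x Hn). pose proof (kfl_spec n (x + len) Hn).
  apply Rabs_le_between; destruct (Nat.leb x (e n)), (Nat.ltb (e n) (x + len)); lra.
Qed.

Lemma afam_mass e : is_lim_seq (fun n => mdev n (RInt u 0 1) (afam e n)) 0.
Proof.
  apply (is_lim_seq_le_le_loc (fun _ => 0) _ (fun n => 4 * / INR n)).
  - exists 1%nat; intros n Hn. split; [apply mdev_ge0|].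
    pose proof (INRn_gt0 n Hn) as Hn0.
    pose proof (rsum_afam_close e n 0 (S n) Hn) as H.
    rewrite RInt_ext01 in H by now apply frac_ge0.
    replace (INR 0 / INR n) with 0 in H by (simpl; field; lra).
    assert (E1 : I (INR (0 + S n) / INR n) = RInt u 0 1).
    { rewrite <- I_1. unfold I. f_equal. rewrite (Rmin_right 1 1), Rmin_right; [reflexivity| |lra].
      simpl (0 + S n)%nat. rewrite S_INR. apply (Rmult_le_reg_r (INR n)); [lra|].
      unfold Rdiv; rewrite Rmult_assoc, Rinv_l by lra; lra. }
    assert (E0 : I 0 = 0).
    { unfold I; rewrite Rmin_left, RInt_point by lra; reflexivity. }
    rewrite E1, E0 in H. unfold mdev, ucum, Feps. rewrite Nat.sub_0_r.
    set (S0 := rsum (afam e n) 0 (S n)) in *. set (M := RInt u 0 1) in *.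
    replace (/ INR n * S0 - M) with (/ INR n * (S0 - INR n * (M - 0))) by (field; lra).
    assert (Hi : 0 < / INR n <= 1).
    { split; [now apply Rinv_0_lt_compat|]. rewrite <- Rinv_1; apply Rinv_le_contravar; [lra|].
      apply (le_INR 1); lia. }
    apply Rabs_le_between in H. set (X := S0 - INR n * (M - 0)) in *.
    rewrite Rpow_mult_distr. assert (HX : X ^ 2 <= 4) by nra. pose proof (pow2_ge_0 X).
    assert ((/ INR n) ^ 2 <= / INR n) by nra. nra.
  - apply is_lim_seq_const.
  - replace (Finite 0) with (Rbar_mult 4 0) by (simpl; f_equal; ring).
    apply (is_lim_seq_scal_l (fun n => / INR n)).
    replace (Finite 0) with (Rbar_inv p_infty) by reflexivity.
    apply is_lim_seq_inv; [apply is_lim_seq_INR | discriminate].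
Qed.

Lemma afam_average e a b : 0 < a -> a < b -> exists n0 : nat, forall n : nat, (1 <= n)%nat -> (n0 <= n)%nat ->
  forall x : nat, Rabs (Aell b n x (afam e n) - Aell' b n x u) <= Rpower (INR n) (- a).
Proof.
  intros Ha Hab.
  (* This makes [n ^ b >= 3 n ^ a]. The integer part in [ell] loses at most [1 <= n ^ a], so
     [ell >= 2 n ^ a], which beats the window error 2. *)
  destruct (nfloor_ex (Rpower 3 (/ (b - a)))) as [n0 Hn0]; [left; apply exp_pos|].
  exists (S n0); intros n Hn Hnn x.
  pose proof (INRn_gt0 n Hn) as Hnp.
  assert (Hn1 : 1 <= INR n) by (apply (le_INR 1); lia).
  assert (Hbig : Rpower 3 (/ (b - a)) <= INR n).
  { apply le_INR in Hnn; rewrite S_INR in Hnn; lra. }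
  assert (H3 : 3 <= Rpower (INR n) (b - a)).
  { replace 3 with (Rpower (Rpower 3 (/ (b - a))) (b - a)) at 1.
    - apply Rle_Rpower_l; [lra|]. split; [apply exp_pos|assumption].
    - rewrite Rpower_mult, Rinv_l by lra. apply Rpower_1; lra. }
  assert (Ha1 : 1 <= Rpower (INR n) a).
  { rewrite <- (Rpower_O (INR n)) by lra. apply Rle_Rpower; lra. }
  assert (Hb : Rpower (INR n) b = Rpower (INR n) a * Rpower (INR n) (b - a)).
  { rewrite <- Rpower_plus; f_equal; ring. }
  assert (Hell : 2 * Rpower (INR n) a <= INR (ell b n)).
  { pose proof (natfloor_spec (Rpower (INR n) b) ltac:(left; apply exp_pos)) as H.
    change (natfloor (Rpower (INR n) b)) with (ell b n) in H.
    assert (3 * Rpower (INR n) a <= Rpower (INR n) b) by (rewrite Hb; nra). lra. }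
  set (l := ell b n) in *. assert (Hl : 0 < INR l) by lra.
  unfold Aell, Aell'; fold l.
  replace (/ INR l * rsum (afam e n) x l -
     INR n / INR l * RInt (ext01 u) (INR x / INR n) (INR (x + l) / INR n))
    with (/ INR l * (rsum (afam e n) x l - INR n * RInt (ext01 u) (INR x / INR n) (INR (x + l) / INR n)))
    by (field; lra).
  rewrite Rabs_mult, (Rabs_right (/ INR l)) by (left; now apply Rinv_0_lt_compat).
  apply Rle_trans with (/ INR l * 2).
  - apply Rmult_le_compat_l; [left; now apply Rinv_0_lt_compat | now apply rsum_afam_close].
  - rewrite Rpower_Ropp. apply (Rmult_le_reg_l (INR l)); [assumption|].
    rewrite <- Rmult_assoc, Rinv_r, Rmult_1_l by lra.
    apply (Rmult_le_reg_r (Rpower (INR n) a)); [lra|].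
    rewrite Rmult_assoc, Rinv_l by lra. lra.
Qed.

Lemma edge_unique n xi e0 : (e0 <= n)%nat -> (0 < xi e0)%nat ->
  (forall y, (e0 < y <= n)%nat -> xi y = 0%nat) -> edge n xi = e0.
Proof.
  intros He Hp H0. destruct (edge_spec n xi) as [H1 [H2 H3]].
  specialize (H3 ltac:(exists e0; auto)).
  destruct (Nat.lt_trichotomy (edge n xi) e0) as [Hlt|[|Hgt]]; [|assumption|].
  - specialize (H2 e0 ltac:(lia)); lia.
  - specialize (H0 (edge n xi) ltac:(lia)); lia.
Qed.

Lemma approximation_exists a b : 0 < a -> a < b -> b < 1 ->
  exists xi, approximates a b u xi /\ is_lim_seq (fun n => mdev n (RInt u 0 1) (xi n)) 0.
Proof.
  intros Ha Hab Hb.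
  destruct (classic (exists R0, is_edge u R0)) as [[R0 HR0]|Hno].
  - set (e := fun n => natfloor (INR n * R0)).
    exists (afam e); split; [|apply afam_mass].
    destruct (afam_average e a b Ha Hab) as [n0 Hn0]. exists n0; intros n Hn Hnn.
    split; [intros; now apply Hn0|]. intros R1 HR1.
    destruct HR0 as [[HR01 HR02] [Hz Hmin]], HR1 as [HR11 [Hz1 Hmin1]].
    assert (R1 = R0) as -> by (apply Rle_antisym; [apply Hmin1 | apply Hmin]; auto).
    pose proof (INRn_gt0 n Hn) as Hnp. assert (Hn1 : 1 <= INR n) by (apply (le_INR 1); lia).
    pose proof (natfloor_spec (INR n * R0) ltac:(apply Rmult_le_pos; lra)) as He.
    change (natfloor (INR n * R0)) with (e n) in He.
    assert (Hen : (e n <= n)%nat) by (apply INR_le; nra).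
    rewrite (edge_unique n (afam e n) (e n) Hen).
    + apply Rle_trans with (/ INR n).
      * replace (INR (e n) / INR n - R0) with (/ INR n * (INR (e n) - INR n * R0)) by (field; lra).
        rewrite Rabs_mult, (Rabs_right (/ INR n)) by (left; now apply Rinv_0_lt_compat).
        rewrite <- (Rmult_1_r (/ INR n)) at 2.
        apply Rmult_le_compat_l; [left; now apply Rinv_0_lt_compat|]. apply Rabs_le_between; lra.
      * rewrite Rpower_Ropp. apply Rinv_le_contravar; [apply exp_pos|].
        rewrite <- (Rpower_1 (INR n)) at 2 by lra. apply Rle_Rpower; lra.
    + unfold afam. rewrite Nat.eqb_refl. lia.
    + intros y Hy. unfold afam. destruct (Nat.eqb_spec y (e n)); [lia|].
      assert (Hyn : R0 <= INR y / INR n).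
      { apply (Rmult_le_reg_r (INR n)); [lra|]. unfold Rdiv; rewrite Rmult_assoc, Rinv_l by lra.
        assert (H : (S (e n) <= y)%nat) by lia. apply le_INR in H; rewrite S_INR in H. lra. }
      enough (EI : I (INR (S y) / INR n) = I (INR y / INR n)) by (unfold kfl; rewrite EI; lia).
      (* No mass lies beyond the edge, so the rounded cumulative mass is constant there and no site
         to the right of [e n] is occupied. *)
      assert (HI : forall x, R0 <= x -> I x = I R0).
      { intros x Hx. unfold I.
        rewrite <- (RInt_Chasles (V := R_CompleteNormedModule) uc 0 (Rmin R0 1) (Rmin x 1)) by apply ex_RInt_uc.
        rewrite (RInt_ext uc (fun _ => 0) (Rmin R0 1) (Rmin x 1)).
        - rewrite RInt_const. unfold plus, scal; simpl; unfold mult; simpl; ring.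
        - assert (Hmm : Rmin R0 1 <= Rmin x 1) by (apply Rle_min_compat_r; lra).
          intros z Hz'. rewrite (Rmin_left (Rmin R0 1)), (Rmax_right (Rmin R0 1)) in Hz' by assumption.
          rewrite (Rmin_left R0 1) in Hz' by lra. pose proof (Rmin_r x 1).
          unfold uc; rewrite clamp01_id by lra. apply Hz; lra. }
      rewrite (HI (INR (S y) / INR n)), (HI (INR y / INR n)); [reflexivity|assumption|].
      eapply Rle_trans; [exact Hyn|]. apply Rmult_le_compat_r; [left; now apply Rinv_0_lt_compat|].
      rewrite S_INR; lra.
  - exists (afam (fun _ => 0%nat)); split; [|apply afam_mass].
    destruct (afam_average (fun _ => 0%nat) a b Ha Hab) as [n0 Hn0]. exists n0; intros n Hn Hnn.
    split; [intros; now apply Hn0|]. intros R0 HR0; exfalso; apply Hno; now exists R0.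
Qed.

Lemma mass_ge0 : 0 <= RInt u 0 1.
Proof. rewrite <- I_1; apply I_ge0; lra. Qed.

End Approximation.

(** * The stationary profile *)

(** The tail of the stationary profile in closed form. For [M < j] its second derivative jumps from
    [2 j] to 0 at the edge, so only second differences of it are used below. *)
Definition Gst (j M r : R) : R :=
  if Rlt_dec M j then j * Rmax 0 (sqrt (M / j) - r) ^ 2 else (1 - r) * (M - j * r).

Section Stationary.
Variables j M : R.
Hypotheses (Hj : 0 < j) (HM : 0 <= M).

Lemma sqrt_ratio : M < j -> 0 <= sqrt (M / j) < 1 /\ j * sqrt (M / j) ^ 2 = M.
Proof.
  intros H. assert (H0 : 0 <= M / j) by (apply Rdiv_le_0_compat; lra).
  assert (H1 : M / j < 1).
  { apply (Rmult_lt_reg_r j); [lra|]. unfold Rdiv; rewrite Rmult_assoc, Rinv_l by lra; lra. }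
  split; [split; [apply sqrt_pos|]|].
  - rewrite <- sqrt_1; apply sqrt_lt_1; lra.
  - rewrite pow2_sqrt by assumption; field; lra.
Qed.

Lemma Gst_0 : Gst j M 0 = M.
Proof.
  unfold Gst; destruct (Rlt_dec M j) as [H|H]; [|ring].
  destruct (sqrt_ratio H) as [H1 H2]. rewrite Rminus_0_r, Rmax_right; lra.
Qed.

Lemma Gst_lip x y : -1 <= x <= 2 -> -1 <= y <= 2 ->
  Rabs (Gst j M x - Gst j M y) <= (M + 5 * j) * Rabs (x - y).
Proof.
  intros Hx Hy. unfold Gst; destruct (Rlt_dec M j) as [H|H].
  - destruct (sqrt_ratio H) as [H1 _]. set (q := sqrt (M / j)) in *.
    set (a := Rmax 0 (q - x)). set (b := Rmax 0 (q - y)).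
    assert (Ha : 0 <= a <= 2) by (unfold a, Rmax; destruct Rle_dec; lra).
    assert (Hb : 0 <= b <= 2) by (unfold b, Rmax; destruct Rle_dec; lra).
    assert (Hab : Rabs (a - b) <= Rabs (x - y))
      by (unfold a, b, Rmax, Rabs; repeat destruct Rle_dec; repeat destruct Rcase_abs; lra).
    replace (j * a ^ 2 - j * b ^ 2) with (j * (a + b) * (a - b)) by ring.
    rewrite Rabs_mult, (Rabs_right (j * (a + b))) by (apply Rle_ge, Rmult_le_pos; lra).
    apply Rmult_le_compat; [apply Rmult_le_pos; lra | apply Rabs_pos | nra | assumption].
  - replace ((1 - x) * (M - j * x) - (1 - y) * (M - j * y))
      with ((j * (x + y) - M - j) * (x - y)) by ring.
    rewrite Rabs_mult. apply Rmult_le_compat_r; [apply Rabs_pos|].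
    apply Rabs_le_between; nra.
Qed.

(** One half of the obstacle problem: the second derivative is at most [2 j] everywhere, even across
    the edge. The upper barrier needs it without locating the contact point. *)
Lemma Gst_semiconcave x h : Gst j M (x - h) - 2 * Gst j M x + Gst j M (x + h) <= 2 * j * h ^ 2.
Proof.
  unfold Gst; destruct (Rlt_dec M j) as [H|H]; [|nra].
  generalize (sqrt (M / j)); intros q.
  enough (Rmax 0 (q - (x - h)) ^ 2 - 2 * Rmax 0 (q - x) ^ 2 + Rmax 0 (q - (x + h)) ^ 2 <= 2 * h ^ 2) by nra.
  unfold Rmax; repeat destruct Rle_dec; nra.
Qed.

(** The other half: where [Gst] is positive it is a parabola of second derivative [2 j] near [x].
    The lower barrier is tested only at such points. *)
Lemma Gst_convex x : 0 < Gst j M x -> x <= 1 ->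
  exists h0, 0 < h0 /\ forall h, 0 < h < h0 ->
    2 * j * h ^ 2 <= Gst j M (x - h) - 2 * Gst j M x + Gst j M (x + h).
Proof.
  unfold Gst; destruct (Rlt_dec M j) as [H|H]; intros HG Hx.
  - set (q := sqrt (M / j)) in *.
    assert (Hq : 0 < q - x).
    { apply Rnot_le_lt; intros Hle. rewrite Rmax_left in HG by lra. lra. }
    exists (q - x); split; [assumption|]; intros h Hh. rewrite !Rmax_right by lra. nra.
  - exists 1; split; [lra|]; intros h _. nra.
Qed.

Lemma Gst_bounds r : 0 <= r <= 1 -> 0 <= Gst j M r <= M.
Proof.
  intros Hr; unfold Gst; destruct (Rlt_dec M j) as [H|H].
  - destruct (sqrt_ratio H) as [H1 H2]. set (q := sqrt (M / j)) in *.
    assert (Ha : 0 <= Rmax 0 (q - r) <= q) by (unfold Rmax; destruct Rle_dec; lra).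
    split; [apply Rmult_le_pos; [lra|apply pow2_ge_0]|].
    rewrite <- H2; apply Rmult_le_compat_l; [lra|]. apply pow_incr; lra.
  - apply Rnot_lt_le in H. split; [apply Rmult_le_pos; nra|].
    assert (0 <= (1 - r) * (j * r)) by (apply Rmult_le_pos; [lra|nra]).
    assert (0 <= r * M) by (apply Rmult_le_pos; lra). lra.
Qed.

Lemma Gst_1 : Gst j M 1 = 0.
Proof.
  unfold Gst; destruct (Rlt_dec M j) as [H|H]; [|ring].
  destruct (sqrt_ratio H). rewrite Rmax_left by lra. ring.
Qed.

Lemma is_RInt_zero_ext (h : R -> R) a b : a <= b -> (forall x, a < x < b -> h x = 0) -> is_RInt h a b 0.
Proof.
  intros Hab H. apply (is_RInt_ext (fun _ => 0)).
  - intros x Hx; rewrite Rmin_left, Rmax_right in Hx by lra; symmetry; apply H; lra.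
  - pose proof (is_RInt_const (V := R_NormedModule) a b 0) as H0.
    refine (eq_ind _ (fun l => is_RInt (V := R_NormedModule) (fun _ => 0) a b l) H0 0 _).
    apply Rmult_0_r.
Qed.

Lemma Fmac_rhoM r : 0 <= r <= 1 -> Fmac r (rhoM j M) = Gst j M r.
Proof.
  intros Hr. unfold Fmac. apply is_RInt_unique.
  assert (Hpoly : forall (P p : R -> R) a b, a <= b -> (forall x, is_derive P x (p x)) ->
    (forall x, continuous p x) -> (forall x, a < x < b -> rhoM j M x = p x) ->
    is_RInt (rhoM j M) a b (P b - P a)).
  { intros P p a b Hab HP Hp He. apply (is_RInt_ext p).
    - intros x Hx; rewrite Rmin_left, Rmax_right in Hx by lra; symmetry; apply He; lra.
    - apply (is_RInt_derive (V := R_CompleteNormedModule) P p); auto. }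
  destruct (Rlt_dec M j) as [H|H].
  - destruct (sqrt_ratio H) as [H1 H2].
    assert (Hz : forall x, sqrt (M / j) < x -> rhoM j M x = 0).
    { intros x Hx. unfold rhoM. destruct (Rle_dec M 0); [reflexivity|].
      destruct (Rlt_dec M j); [|lra]. destruct (Rle_dec x _); lra. }
    unfold Gst; destruct (Rlt_dec M j); [|lra]. set (q := sqrt (M / j)) in *.
    destruct (Rle_dec q r) as [Hq|Hq].
    + rewrite Rmax_left by lra. replace (j * 0 ^ 2) with 0 by ring.
      apply is_RInt_zero_ext; [lra|]. intros; apply Hz; lra.
    + rewrite Rmax_right by lra.
      replace (j * (q - r) ^ 2) with (plus ((- j * (q - q) ^ 2) - (- j * (q - r) ^ 2)) 0)
        by (unfold plus; simpl; ring).
      apply (is_RInt_Chasles (V := R_NormedModule) (rhoM j M) r q 1).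
      * apply (Hpoly (fun x => - j * (q - x) ^ 2) (fun x => 2 * j * (q - x))); [lra| | |].
        -- intros x; auto_derive; [trivial|ring].
        -- intros x; apply (ex_derive_continuous (fun x => 2 * j * (q - x))); auto_derive; trivial.
        -- intros x Hx. unfold rhoM.
           destruct (Rle_dec M 0) as [HM0|HM0].
           ++ exfalso. assert (q = 0); [|lra]. unfold q. replace (M / j) with 0; [apply sqrt_0|].
              replace M with 0 by lra. unfold Rdiv; ring.
           ++ destruct (Rlt_dec M j); [|lra]. fold q. destruct (Rle_dec x q); lra.
      * apply is_RInt_zero_ext; [lra|]. intros; apply Hz; lra.
  - unfold Gst; destruct (Rlt_dec M j); [lra|].
    replace ((1 - r) * (M - j * r))
      with ((- j * 1 ^ 2 + (M + j) * 1) - (- j * r ^ 2 + (M + j) * r)) by ring.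
    apply (Hpoly (fun x => - j * x ^ 2 + (M + j) * x) (fun x => -2 * j * x + M + j)); [lra| | |].
    + intros x; auto_derive; [trivial|ring].
    + intros x; apply (ex_derive_continuous (fun x => -2 * j * x + M + j)); auto_derive; trivial.
    + intros x Hx. unfold rhoM. destruct (Rle_dec M 0); [lra|]. destruct (Rlt_dec M j); [lra|reflexivity].
Qed.

Lemma Gst_cont_2d t r : -1 < r < 2 -> continuity_2d_pt (fun _ r => Gst j M r) t r.
Proof.
  intros Hr eps. pose proof (cond_pos eps) as He.
  assert (HL : 0 < M + 5 * j) by lra.
  assert (Hd : 0 < Rmin (eps / (M + 5 * j)) (Rmin (r + 1) (2 - r))).
  { repeat apply Rmin_glb_lt; try lra. apply Rdiv_lt_0_compat; lra. }
  exists (mkposreal _ Hd); simpl; intros _ v _ Hv.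
  pose proof (Rmin_l (eps / (M + 5 * j)) (Rmin (r + 1) (2 - r))).
  pose proof (Rmin_r (eps / (M + 5 * j)) (Rmin (r + 1) (2 - r))).
  pose proof (Rmin_l (r + 1) (2 - r)). pose proof (Rmin_r (r + 1) (2 - r)).
  assert (H5 : Rabs (v - r) < r + 1) by lra. assert (H6 : Rabs (v - r) < 2 - r) by lra.
  apply Rabs_lt_between in H5; apply Rabs_lt_between in H6.
  eapply Rle_lt_trans; [apply Gst_lip; lra|].
  apply Rlt_le_trans with ((M + 5 * j) * (eps / (M + 5 * j))).
  - apply Rmult_lt_compat_l; lra.
  - right; field; lra.
Qed.

End Stationary.

(** Second-order test at a maximum of [p - q] in which [q] enters through second differences only,
    as [Gst] is not twice differentiable. Were [p2 x > B], continuity would keep [p2] above the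
    midpoint nearby, and [second_diff_ge] would contradict maximality. *)
Lemma second_derivative_at_max (p p1 p2 q : R -> R) x B h0 :
  (forall y, is_derive p y (p1 y)) -> (forall y, is_derive p1 y (p2 y)) -> continuous p2 x ->
  0 < h0 ->
  (forall h, 0 < h < h0 -> q (x - h) - 2 * q x + q (x + h) <= B * h ^ 2) ->
  (forall y, x - h0 < y < x + h0 -> p y - q y <= p x - q x) ->
  p2 x <= B.
Proof.
  intros H1 H2 Hc Hh0 Hq Hmax. apply Rnot_lt_le; intros Hlt.
  apply continuity_pt_filterlim in Hc. rewrite continuity_pt_locally in Hc.
  assert (He : 0 < (p2 x - B) / 2) by lra.
  destruct (Hc (mkposreal _ He)) as [d Hd]; simpl in Hd.
  pose proof (cond_pos d) as Hdp.
  set (h := Rmin h0 d / 2).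
  assert (Hh : 0 < h) by (unfold h; assert (0 < Rmin h0 d) by (apply Rmin_glb_lt; lra); lra).
  assert (Hhh : h < h0 /\ h < d).
  { unfold h; assert (0 < Rmin h0 d) by (apply Rmin_glb_lt; lra).
    pose proof (Rmin_l h0 d); pose proof (Rmin_r h0 d); lra. }
  pose proof (second_diff_ge p p1 p2 x h ((p2 x + B) / 2) ltac:(lra) H1 H2) as L.
  specialize (L ltac:(intros y Hy; specialize (Hd y ltac:(change (Rabs (y - x) < d); apply Rabs_lt_between; lra));
    apply Rabs_lt_between in Hd; lra)).
  specialize (Hq h ltac:(lra)).
  pose proof (Hmax (x - h) ltac:(lra)). pose proof (Hmax (x + h) ltac:(lra)).
  assert (0 < h ^ 2) by (apply pow_lt; lra). nra.
Qed.


Lemma rational_approximation (Psi : R -> R) (K : nat) r : (1 <= K)%nat -> 0 <= r -> continuous Psi r ->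
  (forall q, (1 <= q)%nat -> 0 <= Psi (INR (natfloor (r * INR (K * q))) / INR (K * q))) -> 0 <= Psi r.
Proof.
  intros HK Hr Hc Hq. apply Rnot_lt_le; intros Hlt.
  apply continuity_pt_filterlim in Hc. rewrite continuity_pt_locally in Hc.
  assert (He : 0 < - Psi r) by lra. destruct (Hc (mkposreal _ He)) as [d Hd]; simpl in Hd.
  pose proof (cond_pos d) as Hdp.
  destruct (nfloor_ex (/ d)) as [q Hqd]; [left; now apply Rinv_0_lt_compat|].
  specialize (Hq (S q) ltac:(lia)). set (n := (K * S q)%nat) in *.
  assert (Hn : INR q + 1 <= INR n) by (rewrite <- S_INR; apply le_INR; unfold n; nia).
  pose proof (pos_INR q) as Hq0. assert (Hnp : 0 < INR n) by lra.
  pose proof (natfloor_spec (r * INR n) ltac:(apply Rmult_le_pos; lra)) as Hf.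
  set (x := INR (natfloor (r * INR n)) / INR n) in *.
  assert (Hx : Rabs (x - r) < d).
  { replace (x - r) with ((INR (natfloor (r * INR n)) - r * INR n) * / INR n) by (unfold x; field; lra).
    rewrite Rabs_mult, (Rabs_right (/ INR n)) by (left; now apply Rinv_0_lt_compat).
    apply Rle_lt_trans with (1 * / INR n).
    - apply Rmult_le_compat_r; [left; now apply Rinv_0_lt_compat|]. apply Rabs_le_between; lra.
    - rewrite Rmult_1_l, <- (Rinv_inv d). apply Rinv_lt_contravar; [|lra].
      apply Rmult_lt_0_compat; [now apply Rinv_0_lt_compat|lra]. }
  specialize (Hd x Hx). apply Rabs_lt_between in Hd. lra.
Qed.

(** * From rational positions to real positions, and derivatives of the hat averages *)

Section Convergence.
Variables (j M : R) (rho : R -> R -> R) (xi0 : nat -> config).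
Hypotheses (Hj : 0 < j) (HM : 0 <= M).
Hypothesis Hlim : forall zeta t, 0 < zeta -> 0 <= t ->
  is_lim_seq (fun n => Prob j n (hdl_event n zeta (rho t)) (INR n ^ 2 * t) (xi0 n)) 1.
Hypothesis Hmass : is_lim_seq (fun n => mdev n M (xi0 n)) 0.
Hypothesis rho_ge0 : forall t r, 0 <= t -> 0 <= r <= 1 -> 0 <= rho t r.
Hypothesis rho_cont : forall t r, 0 <= t -> 0 <= r <= 1 ->
  filterlim (fun p : R * R => rho (fst p) (snd p))
    (within (fun p : R * R => 0 <= fst p /\ 0 <= snd p <= 1) (locally (t, r)))
    (locally (rho t r)).

Notation f := (fF rho).
Notation g := (gF rho).

Definition g1 (t eta r : R) : R := (iF rho t r - 2 * iF rho t (r + eta) + iF rho t (r + 2 * eta)) / eta ^ 2.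
Definition g2 (t eta r : R) : R := (f t r - 2 * f t (r + eta) + f t (r + 2 * eta)) / eta ^ 2.

Lemma gF_derive t eta r : 0 < eta -> is_derive (g t eta) r (g1 t eta r).
Proof.
  intros Heta. unfold gF, g1. auto_derive.
  - repeat split; eexists; apply iiF_derive; assumption.
  - rewrite !(fun y => is_derive_unique (iiF rho t) y _ (iiF_derive rho rho_cont t y)). field; lra.
Qed.

Lemma g1_derive t eta r : 0 < eta -> is_derive (g1 t eta) r (g2 t eta r).
Proof.
  intros Heta. unfold g1, g2. auto_derive.
  - repeat split; eexists; apply iF_derive; assumption.
  - rewrite !(fun y => is_derive_unique (iF rho t) y _ (iF_derive rho rho_cont t y)). field; lra.
Qed.

Lemma ex_derive_f t r : ex_derive (f t) r.
Proof. eexists; now apply fF_derive. Qed.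

Lemma ex_derive_g t eta r : 0 < eta -> ex_derive (g t eta) r.
Proof. intros; eexists; now apply gF_derive. Qed.

Lemma g2_continuous t eta r : 0 < eta -> continuous (g2 t eta) r.
Proof.
  intros Heta; apply (ex_derive_continuous (g2 t eta)); unfold g2; auto_derive.
  repeat split; apply ex_derive_f.
Qed.

Variable N1 : nat.
Hypothesis HN1 : (1 <= N1)%nat.
Let eta := / INR N1.

Lemma N1_gt0 : 0 < INR N1. Proof. apply (lt_INR 0); lia. Qed.
Lemma eta_pos : 0 < eta. Proof. apply Rinv_0_lt_compat, N1_gt0. Qed.

Variable Q : nat.
Hypothesis HQ : (1 <= Q)%nat.
Let ka := 2 * (eta / INR Q).
Let A := INR N1 ^ 2.
Let A' := (INR N1 * INR Q) ^ 2.

Lemma Q_gt0 : 0 < INR Q. Proof. apply (lt_INR 0); lia. Qed.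

(** The wide hat has half-width [eta = 1 / N1] and the narrow one [eta / Q], both independent of the
    refinement [q]. Only the position is approximated, from the left, with mesh [1 / (N1 Q q)]. *)
Lemma grid_position r q : (1 <= q)%nat -> ka <= r -> r + 2 * eta + ka <= 1 ->
  let N := (N1 * Q * q)%nat in let b0 := natfloor (r * INR N) in
  (1 <= N)%nat /\ (2 * q <= b0)%nat /\ (b0 + 2 * (Q * q) + 2 * q <= N)%nat /\
  INR (Q * q) / INR N = eta /\ INR N / INR (Q * q) = INR N1 /\ INR N / INR q = INR N1 * INR Q /\
  2 * (INR q / INR N) = ka /\ INR b0 / INR N <= r.
Proof.
  intros Hq Hr1 Hr2 N b0. pose proof N1_gt0 as HNp; pose proof Q_gt0 as HQp; pose proof eta_pos as Hep.
  assert (Hqp : 0 < INR q) by (apply (lt_INR 0); lia).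
  assert (EN : INR N = INR N1 * INR Q * INR q) by (unfold N; rewrite !mult_INR; reflexivity).
  assert (HN : 0 < INR N) by (rewrite EN; repeat apply Rmult_lt_0_compat; assumption).
  assert (Hka : 0 < ka) by (unfold ka; assert (0 < eta / INR Q) by (apply Rdiv_lt_0_compat; lra); lra).
  assert (Eka : ka * INR N = 2 * INR q) by (unfold ka, eta; rewrite EN; field; lra).
  assert (Eeta : eta * INR N = INR Q * INR q) by (unfold eta; rewrite EN; field; lra).
  pose proof (natfloor_spec (r * INR N) ltac:(apply Rmult_le_pos; lra)) as Hf. fold b0 in Hf.
  assert (HN1' : (1 <= N)%nat) by (unfold N; nia). clearbody b0 N.
  assert (H1 : ka * INR N <= r * INR N) by (apply Rmult_le_compat_r; lra).
  assert (H2 : (r + 2 * eta + ka) * INR N <= 1 * INR N) by (apply Rmult_le_compat_r; lra).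
  repeat split.
  - exact HN1'.
  - apply Nat.lt_succ_r, INR_lt. rewrite S_INR, mult_INR. simpl (INR 2). lra.
  - apply INR_le. rewrite !plus_INR, !mult_INR. simpl (INR 2). lra.
  - rewrite mult_INR, EN; unfold eta; field; lra.
  - rewrite mult_INR, EN; field; lra.
  - rewrite EN; field; lra.
  - rewrite EN; unfold ka, eta; field; lra.
  - apply (Rmult_le_reg_r (INR N)); [lra|]. unfold Rdiv; rewrite Rmult_assoc, Rinv_l by lra. lra.
Qed.

Lemma local_low_real s tau r : 0 <= s -> 0 <= tau -> tau * A <= 1 -> tau * j <= 1 ->
  ka <= r -> r + 2 * eta + ka <= 1 ->
  g s eta r + tau * (/ 2 * A * (f s (r + ka) - 2 * f s (r + eta - ka) + f s (r + 2 * eta + ka)) - j)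
   - tau ^ 2 * (A * (A' * (M + 1) + j)) <= g (s + tau) eta r.
Proof.
  intros Hs Ht HtA Htj Hr1 Hr2. pose proof eta_pos as Hep.
  assert (Hka : 0 < ka) by (unfold ka; pose proof Q_gt0; assert (0 < eta / INR Q) by (apply Rdiv_lt_0_compat; lra); lra).
  set (Psi := fun r => g (s + tau) eta r - (g s eta r
    + tau * (/ 2 * A * (f s (r + ka) - 2 * f s (r + eta - ka) + f s (r + 2 * eta + ka)) - j)
    - tau ^ 2 * (A * (A' * (M + 1) + j)))).
  enough (0 <= Psi r) by (unfold Psi in *; lra).
  apply (rational_approximation Psi (N1 * Q)); [nia|lra| |].
  - apply (ex_derive_continuous Psi); unfold Psi; auto_derive.
    repeat split; match goal with
      | |- context [gF] => apply ex_derive_g; assumption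
      | |- _ => apply ex_derive_f end.
  - intros q Hq. destruct (grid_position r q Hq Hr1 Hr2) as [G1 [G2 [G3 [G4 [G5 [G6 [G7 G8]]]]]]].
    set (N := (N1 * Q * q)%nat) in *. set (b0 := natfloor (r * INR N)) in *. clearbody b0. clearbody N.
    assert (HN : 0 < INR N) by (apply (lt_INR 0); lia).
    pose proof (local_low j M rho xi0 Hj HM Hlim Hmass rho_ge0 rho_cont N b0 (Q * q) q G1
      ltac:(nia) Hq G2 G3 s tau Hs Ht) as H.
    rewrite G5, G6, G4 in H. specialize (H HtA Htj).
    replace (INR (b0 + 2 * q) / INR N) with (INR b0 / INR N + ka) in H
      by (rewrite <- G7, plus_INR, mult_INR; simpl (INR 2); field; lra).
    replace (INR (b0 + Q * q - 2 * q) / INR N) with (INR b0 / INR N + eta - ka) in H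
      by (rewrite <- G7, <- G4, minus_INR, plus_INR, (mult_INR 2) by lia; simpl (INR 2); field; lra).
    replace (INR (b0 + 2 * (Q * q) + 2 * q) / INR N) with (INR b0 / INR N + 2 * eta + ka) in H
      by (rewrite <- G7, <- G4, !plus_INR, !(mult_INR 2); simpl (INR 2); field; lra).
    unfold Psi, A, A'. lra.
Qed.

Lemma local_up_real s tau c0 r : 0 <= s -> 0 <= tau -> tau * A <= 1 -> tau * j <= 1 ->
  ka <= r -> r + 2 * eta + ka <= 1 -> 0 < c0 <= f s (r + 2 * eta + ka) ->
  g (s + tau) eta r <= g s eta r
   + tau * (/ 2 * A * (f s (r - ka) - 2 * f s (r + eta + ka) + f s (r + 2 * eta - ka)) - j)
   + tau ^ 2 * (A * (A' * (M + 1) + j) + j / c0 ^ 2 * CQ j M A' M).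
Proof.
  intros Hs Ht HtA Htj Hr1 Hr2 Hc0. pose proof eta_pos as Hep.
  assert (Hka : 0 < ka) by (unfold ka; pose proof Q_gt0; assert (0 < eta / INR Q) by (apply Rdiv_lt_0_compat; lra); lra).
  set (Psi := fun r => g s eta r
   + tau * (/ 2 * A * (f s (r - ka) - 2 * f s (r + eta + ka) + f s (r + 2 * eta - ka)) - j)
   + tau ^ 2 * (A * (A' * (M + 1) + j) + j / c0 ^ 2 * CQ j M A' M) - g (s + tau) eta r).
  enough (0 <= Psi r) by (unfold Psi in *; lra).
  apply (rational_approximation Psi (N1 * Q)); [nia|lra| |].
  - apply (ex_derive_continuous Psi); unfold Psi; auto_derive.
    repeat split; match goal with
      | |- context [gF] => apply ex_derive_g; assumption
      | |- _ => apply ex_derive_f end.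
  - intros q Hq. destruct (grid_position r q Hq Hr1 Hr2) as [G1 [G2 [G3 [G4 [G5 [G6 [G7 G8]]]]]]].
    set (N := (N1 * Q * q)%nat) in *. set (b0 := natfloor (r * INR N)) in *. clearbody b0. clearbody N.
    assert (HN : 0 < INR N) by (apply (lt_INR 0); lia).
    pose proof (local_up j M rho xi0 Hj HM Hlim Hmass rho_ge0 rho_cont N b0 (Q * q) q G1
      ltac:(nia) Hq G2 G3 s tau c0 Hs Ht) as H.
    rewrite G5, G6, G4 in H. specialize (H HtA Htj).
    replace (INR (b0 - 2 * q) / INR N) with (INR b0 / INR N - ka) in H
      by (rewrite <- G7, minus_INR, mult_INR by lia; simpl (INR 2); field; lra).
    replace (INR (b0 + Q * q + 2 * q) / INR N) with (INR b0 / INR N + eta + ka) in H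
      by (rewrite <- G7, <- G4, !plus_INR, !(mult_INR 2); simpl (INR 2); field; lra).
    replace (INR (b0 + 2 * (Q * q) - 2 * q) / INR N) with (INR b0 / INR N + 2 * eta - ka) in H
      by (rewrite <- G7, <- G4, minus_INR, plus_INR, !(mult_INR 2) by lia; simpl (INR 2); field; lra).
    replace (INR (b0 + 2 * (Q * q) + 2 * q) / INR N) with (INR b0 / INR N + 2 * eta + ka) in H
      by (rewrite <- G7, <- G4, !plus_INR, !(mult_INR 2); simpl (INR 2); field; lra).
    assert (Hc0' : c0 <= f s (INR b0 / INR N + 2 * eta + ka)).
    { eapply Rle_trans; [apply Hc0|]. apply fF_decr; [assumption|assumption|lra]. }
    specialize (H (conj (proj1 Hc0) Hc0')).
    unfold Psi, A, A'. lra.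
Qed.

End Convergence.

(** * Barriers and convergence *)

Lemma exists_small (l : list R) : (forall x, In x l -> 0 < x) ->
  exists y, 0 < y /\ forall x, In x l -> y < x.
Proof.
  induction l as [|a l IH]; intros H.
  - exists 1; split; [lra|]; intros x [].
  - destruct IH as [y [Hy Hl]]; [intros; apply H; now right|].
    specialize (H a (or_introl eq_refl)).
    exists (Rmin a y / 2). assert (0 < Rmin a y) by (apply Rmin_glb_lt; assumption).
    pose proof (Rmin_l a y); pose proof (Rmin_r a y).
    split; [lra|]; intros x [<-|Hx]; [lra|]. specialize (Hl x Hx); lra.
Qed.

(** From [exp (- u) >= 1 - u]: for [tau <= 1] one has [(1 + tau / 3) (1 - tau / 4) >= 1]. The slack
    from [1 / 4] to [1 / 3] buys a bound linear in [tau]. *)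
Lemma exp_increment x tau : 0 <= tau <= 1 ->
  exp (- (x - tau) / 4) - exp (- x / 4) <= exp (- x / 4) * (tau / 3).
Proof.
  intros Ht. replace (- (x - tau) / 4) with (- x / 4 + tau / 4) by field. rewrite exp_plus.
  assert (H : exp (tau / 4) <= 1 + tau / 3).
  { pose proof (exp_ineq1_le (- (tau / 4))) as H. rewrite exp_Ropp in H.
    pose proof (exp_pos (tau / 4)) as Hp. set (E := exp (tau / 4)) in *.
    assert (H' : (1 + - (tau / 4)) * E <= 1).
    { apply Rle_trans with (/ E * E); [apply Rmult_le_compat_r; lra|]. rewrite Rinv_l by lra. lra. }
    nra. }
  pose proof (exp_pos (- x / 4)). nra.
Qed.

Section Convergence.
Variables (j M : R) (rho : R -> R -> R) (xi0 : nat -> config).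
Hypotheses (Hj : 0 < j) (HM : 0 <= M).
Hypothesis Hlim : forall zeta t, 0 < zeta -> 0 <= t ->
  is_lim_seq (fun n => Prob j n (hdl_event n zeta (rho t)) (INR n ^ 2 * t) (xi0 n)) 1.
Hypothesis Hmass : is_lim_seq (fun n => mdev n M (xi0 n)) 0.
Hypothesis rho_ge0 : forall t r, 0 <= t -> 0 <= r <= 1 -> 0 <= rho t r.
Hypothesis rho_cont : forall t r, 0 <= t -> 0 <= r <= 1 ->
  filterlim (fun p : R * R => rho (fst p) (snd p))
    (within (fun p : R * R => 0 <= fst p /\ 0 <= snd p <= 1) (locally (t, r)))
    (locally (rho t r)).

Notation f := (fF rho).
Notation g := (gF rho).

Variable N1 : nat.
Hypothesis HN1 : (1 <= N1)%nat.
Let eta := / INR N1.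
Let A := INR N1 ^ 2.

Lemma A_pos : 0 < A. Proof. apply pow_lt, (lt_INR 0); lia. Qed.

Lemma small_Q k0 : 0 < k0 -> exists Q, (1 <= Q)%nat /\ 0 < 2 * (eta / INR Q) < k0.
Proof.
  intros Hk. pose proof (eta_pos N1 HN1) as He; fold eta in He.
  destruct (nfloor_ex (2 * eta / k0)) as [q Hq]; [left; apply Rdiv_lt_0_compat; lra|].
  exists (S q); split; [lia|]. rewrite S_INR. pose proof (pos_INR q).
  assert (0 < eta / (INR q + 1)) by (apply Rdiv_lt_0_compat; lra).
  split; [lra|].
  apply (Rmult_lt_reg_r (INR q + 1)); [lra|].
  replace (2 * (eta / (INR q + 1)) * (INR q + 1)) with (2 * eta) by (field; lra).
  assert (Hm : 2 * eta / k0 * k0 < (INR q + 1) * k0) by (apply Rmult_lt_compat_r; lra).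
  replace (2 * eta / k0 * k0) with (2 * eta) in Hm by (field; lra). lra.
Qed.

(** One-sided differential inequality, with the increment taken backwards in time: at a maximum over
    [[0, T]], earlier times are always available, even when the maximum sits at [T]. *)
Lemma drift_up t r D tau1 : 0 < t -> 0 < r -> r + 2 * eta < 1 -> 0 < f t (r + 2 * eta) -> 0 < tau1 ->
  (forall tau, 0 < tau < tau1 -> D * tau <= g t eta r - g (t - tau) eta r) ->
  D <= / 2 * A * (f t r - 2 * f t (r + eta) + f t (r + 2 * eta)) - j.
Proof.
  intros Ht Hr1 Hr2 Hf Ht1 HD. apply Rnot_lt_le; intros Hlt.
  set (X := / 2 * A * (f t r - 2 * f t (r + eta) + f t (r + 2 * eta)) - j) in *.
  set (gap := D - X). assert (Hgap : 0 < gap) by (unfold gap; lra).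
  pose proof A_pos as HA. pose proof (eta_pos N1 HN1) as He; fold eta in He.
  set (c := f t (r + 2 * eta)) in *.
  destruct (fF_lip rho rho_ge0 rho_cont t) as [L [HL Hlip]].
  destruct (exists_small (r :: (1 - r - 2 * eta) :: (c / (4 * L)) :: (gap / (8 * A * L)) :: nil))
    as [k0 [Hk0 Hkl]].
  { intros x [<-|[<-|[<-|[<-|[]]]]]; try lra; apply Rdiv_lt_0_compat; try lra; nra. }
  destruct (small_Q k0 Hk0) as [Q [HQ Hka]]. set (ka := 2 * (eta / INR Q)) in *.
  pose proof (Hkl _ (or_introl eq_refl)) as K1.
  pose proof (Hkl _ (or_intror (or_introl eq_refl))) as K2.
  pose proof (Hkl _ (or_intror (or_intror (or_introl eq_refl)))) as K3.
  pose proof (Hkl _ (or_intror (or_intror (or_intror (or_introl eq_refl))))) as K4.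
  assert (KL1 : L * ka <= c / 4).
  { apply Rle_trans with (L * (c / (4 * L))); [apply Rmult_le_compat_l; lra | right; field; lra]. }
  assert (KL2 : A * (L * ka) <= gap / 8).
  { apply Rle_trans with (A * (L * (gap / (8 * A * L)))).
    - apply Rmult_le_compat_l; [lra|]. apply Rmult_le_compat_l; lra.
    - right; field; lra. }
  clear Hkl K3 K4.
  destruct (exists_small ((c / 4) :: (gap / (8 * A)) :: nil)) as [e [He0 Hel]].
  { intros x [<-|[<-|[]]]; apply Rdiv_lt_0_compat; lra. }
  pose proof (Hel _ (or_introl eq_refl)) as E1.
  pose proof (Hel _ (or_intror (or_introl eq_refl))) as E2.
  assert (EA : A * e <= gap / 8).
  { apply Rle_trans with (A * (gap / (8 * A))); [apply Rmult_le_compat_l; lra | right; field; lra]. }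
  destruct (fF_equicont rho rho_cont t e He0) as [d [Hd Heq]].
  set (A' := (INR N1 * INR Q) ^ 2). set (c0 := c / 4).
  (* This constant depends on the narrow width through [A'], so [Q] is fixed first and [tau] is
     chosen only afterwards, small against it. *)
  set (C := A * (A' * (M + 1) + j) + j / c0 ^ 2 * CQ j M A' M).
  destruct (exists_small (tau1 :: t :: d :: (/ A) :: (/ j) :: (gap / (4 * (Rabs C + 1))) :: nil))
    as [tau [Htau Htl]].
  { pose proof (Rabs_pos C).
    intros x [<-|[<-|[<-|[<-|[<-|[<-|[]]]]]]]; try lra;
      try (apply Rinv_0_lt_compat; lra); apply Rdiv_lt_0_compat; lra. }
  pose proof (Htl _ (or_introl eq_refl)) as T1.
  pose proof (Htl _ (or_intror (or_introl eq_refl))) as T2.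
  pose proof (Htl _ (or_intror (or_intror (or_introl eq_refl)))) as T3.
  pose proof (Htl _ (or_intror (or_intror (or_intror (or_introl eq_refl))))) as T4.
  pose proof (Htl _ (or_intror (or_intror (or_intror (or_intror (or_introl eq_refl)))))) as T5.
  pose proof (Htl _ (or_intror (or_intror (or_intror (or_intror (or_intror (or_introl eq_refl))))))) as T6.
  clear Htl Hel E2.
  assert (TA : tau * A <= 1).
  { apply Rle_trans with (/ A * A); [apply Rmult_le_compat_r; lra | right; field; lra]. }
  assert (Tj : tau * j <= 1).
  { apply Rle_trans with (/ j * j); [apply Rmult_le_compat_r; lra | right; field; lra]. }
  assert (TC : tau * C <= gap / 4).
  { pose proof (Rle_abs C). pose proof (Rabs_pos C).
    apply Rle_trans with (tau * (Rabs C + 1)); [apply Rmult_le_compat_l; lra|].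
    apply Rle_trans with (gap / (4 * (Rabs C + 1)) * (Rabs C + 1)); [apply Rmult_le_compat_r; lra|].
    right; field; lra. }
  assert (Hnear : forall x y, 0 <= x <= 1 -> 0 <= y <= 1 -> Rabs (x - y) <= ka ->
    Rabs (f (t - tau) x - f t y) <= e + L * ka).
  { intros x y Hx Hy Hxy.
    pose proof (Heq (t - tau) t x ltac:(lra) ltac:(lra)
      ltac:(replace (t - tau - t) with (- tau) by ring; rewrite Rabs_Ropp, Rabs_right; lra) ltac:(lra)) as P1.
    pose proof (Hlip t x y ltac:(lra)) as P2.
    assert (L * Rabs (x - y) <= L * ka) by (apply Rmult_le_compat_l; lra).
    apply Rabs_le_between in P1; apply Rabs_le_between in P2; apply Rabs_le_between; lra. }
  assert (Hsm : forall x y, x - y = ka \/ y - x = ka -> Rabs (x - y) <= ka).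
  { intros x y Hxy; apply Rabs_le_between; lra. }
  pose proof (Hnear (r - ka) r ltac:(lra) ltac:(lra) ltac:(apply Hsm; lra)) as F1.
  pose proof (Hnear (r + eta + ka) (r + eta) ltac:(lra) ltac:(lra) ltac:(apply Hsm; lra)) as F2.
  pose proof (Hnear (r + 2 * eta - ka) (r + 2 * eta) ltac:(lra) ltac:(lra) ltac:(apply Hsm; lra)) as F3.
  pose proof (Hnear (r + 2 * eta + ka) (r + 2 * eta) ltac:(lra) ltac:(lra) ltac:(apply Hsm; lra)) as F4.
  fold c in F3, F4.
  apply Rabs_le_between in F1; apply Rabs_le_between in F2; apply Rabs_le_between in F3; apply Rabs_le_between in F4.
  pose proof (local_up_real j M rho xi0 Hj HM Hlim Hmass rho_ge0 rho_cont N1 HN1 Q HQ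
    (t - tau) tau c0 r ltac:(lra) ltac:(lra) TA Tj) as HU.
  fold eta in HU. fold ka in HU. fold A A' C in HU.
  specialize (HU ltac:(lra) ltac:(lra) ltac:(unfold c0; split; lra)).
  replace (t - tau + tau) with t in HU by ring.
  specialize (HD tau ltac:(lra)).
  set (Y := f (t - tau) (r - ka) - 2 * f (t - tau) (r + eta + ka) + f (t - tau) (r + 2 * eta - ka)) in *.
  assert (HY : / 2 * A * Y - j <= X + gap / 2).
  { unfold X. fold c.
    assert (Y <= (f t r - 2 * f t (r + eta) + c) + 4 * (e + L * ka)) by (unfold Y; lra).
    assert (A * Y <= A * ((f t r - 2 * f t (r + eta) + c) + 4 * (e + L * ka))) by (apply Rmult_le_compat_l; lra).
    lra. }
  assert (H1 : tau * (/ 2 * A * Y - j) <= tau * (X + gap / 2)) by (apply Rmult_le_compat_l; lra).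
  assert (H2 : tau ^ 2 * C <= tau * (gap / 4)).
  { replace (tau ^ 2 * C) with (tau * (tau * C)) by ring. apply Rmult_le_compat_l; lra. }
  assert (H3 : D * tau <= (X + 3 * gap / 4) * tau) by lra.
  apply Rmult_le_reg_r in H3; [|lra]. unfold gap in *. lra.
Qed.

Lemma drift_low t r D tau1 : 0 < t -> 0 < r -> r + 2 * eta < 1 -> 0 < tau1 ->
  (forall tau, 0 < tau < tau1 -> g t eta r - g (t - tau) eta r <= D * tau) ->
  / 2 * A * (f t r - 2 * f t (r + eta) + f t (r + 2 * eta)) - j <= D.
Proof.
  intros Ht Hr1 Hr2 Ht1 HD. apply Rnot_lt_le; intros Hlt.
  set (X := / 2 * A * (f t r - 2 * f t (r + eta) + f t (r + 2 * eta)) - j) in *.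
  set (gap := X - D). assert (Hgap : 0 < gap) by (unfold gap; lra).
  pose proof A_pos as HA. pose proof (eta_pos N1 HN1) as He; fold eta in He.
  destruct (fF_lip rho rho_ge0 rho_cont t) as [L [HL Hlip]].
  destruct (exists_small (r :: (1 - r - 2 * eta) :: eta :: (gap / (8 * A * L)) :: nil))
    as [k0 [Hk0 Hkl]].
  { intros x [<-|[<-|[<-|[<-|[]]]]]; try lra; apply Rdiv_lt_0_compat; try lra; nra. }
  destruct (small_Q k0 Hk0) as [Q [HQ Hka]]. set (ka := 2 * (eta / INR Q)) in *.
  pose proof (Hkl _ (or_introl eq_refl)) as K1.
  pose proof (Hkl _ (or_intror (or_introl eq_refl))) as K2.
  pose proof (Hkl _ (or_intror (or_intror (or_introl eq_refl)))) as K3.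
  pose proof (Hkl _ (or_intror (or_intror (or_intror (or_introl eq_refl))))) as K4.
  assert (KL2 : A * (L * ka) <= gap / 8).
  { apply Rle_trans with (A * (L * (gap / (8 * A * L)))).
    - apply Rmult_le_compat_l; [lra|]. apply Rmult_le_compat_l; lra.
    - right; field; lra. }
  clear Hkl K4.
  set (e := gap / (8 * A)). assert (He0 : 0 < e) by (apply Rdiv_lt_0_compat; lra).
  assert (EA : A * e <= gap / 8) by (right; unfold e; field; lra).
  destruct (fF_equicont rho rho_cont t e He0) as [d [Hd Heq]].
  set (A' := (INR N1 * INR Q) ^ 2).
  set (C := A * (A' * (M + 1) + j)).
  destruct (exists_small (tau1 :: t :: d :: (/ A) :: (/ j) :: (gap / (4 * (Rabs C + 1))) :: nil))
    as [tau [Htau Htl]].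
  { pose proof (Rabs_pos C).
    intros x [<-|[<-|[<-|[<-|[<-|[<-|[]]]]]]]; try lra;
      try (apply Rinv_0_lt_compat; lra); apply Rdiv_lt_0_compat; lra. }
  pose proof (Htl _ (or_introl eq_refl)) as T1.
  pose proof (Htl _ (or_intror (or_introl eq_refl))) as T2.
  pose proof (Htl _ (or_intror (or_intror (or_introl eq_refl)))) as T3.
  pose proof (Htl _ (or_intror (or_intror (or_intror (or_introl eq_refl))))) as T4.
  pose proof (Htl _ (or_intror (or_intror (or_intror (or_intror (or_introl eq_refl)))))) as T5.
  pose proof (Htl _ (or_intror (or_intror (or_intror (or_intror (or_intror (or_introl eq_refl))))))) as T6.
  clear Htl.
  assert (TA : tau * A <= 1).
  { apply Rle_trans with (/ A * A); [apply Rmult_le_compat_r; lra | right; field; lra]. }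
  assert (Tj : tau * j <= 1).
  { apply Rle_trans with (/ j * j); [apply Rmult_le_compat_r; lra | right; field; lra]. }
  assert (TC : tau * C <= gap / 4).
  { pose proof (Rle_abs C). pose proof (Rabs_pos C).
    apply Rle_trans with (tau * (Rabs C + 1)); [apply Rmult_le_compat_l; lra|].
    apply Rle_trans with (gap / (4 * (Rabs C + 1)) * (Rabs C + 1)); [apply Rmult_le_compat_r; lra|].
    right; field; lra. }
  assert (Hnear : forall x y, 0 <= x <= 1 -> 0 <= y <= 1 -> Rabs (x - y) <= ka ->
    Rabs (f (t - tau) x - f t y) <= e + L * ka).
  { intros x y Hx Hy Hxy.
    pose proof (Heq (t - tau) t x ltac:(lra) ltac:(lra)
      ltac:(replace (t - tau - t) with (- tau) by ring; rewrite Rabs_Ropp, Rabs_right; lra) ltac:(lra)) as P1.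
    pose proof (Hlip t x y ltac:(lra)) as P2.
    assert (L * Rabs (x - y) <= L * ka) by (apply Rmult_le_compat_l; lra).
    apply Rabs_le_between in P1; apply Rabs_le_between in P2; apply Rabs_le_between; lra. }
  assert (Hsm : forall x y, x - y = ka \/ y - x = ka -> Rabs (x - y) <= ka).
  { intros x y Hxy; apply Rabs_le_between; lra. }
  pose proof (Hnear (r + ka) r ltac:(lra) ltac:(lra) ltac:(apply Hsm; lra)) as F1.
  pose proof (Hnear (r + eta - ka) (r + eta) ltac:(lra) ltac:(lra) ltac:(apply Hsm; lra)) as F2.
  pose proof (Hnear (r + 2 * eta + ka) (r + 2 * eta) ltac:(lra) ltac:(lra) ltac:(apply Hsm; lra)) as F3.
  apply Rabs_le_between in F1; apply Rabs_le_between in F2; apply Rabs_le_between in F3.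
  pose proof (local_low_real j M rho xi0 Hj HM Hlim Hmass rho_ge0 rho_cont N1 HN1 Q HQ
    (t - tau) tau r ltac:(lra) ltac:(lra) TA Tj) as HU.
  fold eta in HU. fold ka in HU. fold A A' in HU. fold C in HU.
  specialize (HU ltac:(lra) ltac:(lra)).
  replace (t - tau + tau) with t in HU by ring.
  specialize (HD tau ltac:(lra)).
  set (Y := f (t - tau) (r + ka) - 2 * f (t - tau) (r + eta - ka) + f (t - tau) (r + 2 * eta + ka)) in *.
  assert (HY : X - gap / 2 <= / 2 * A * Y - j).
  { unfold X.
    assert ((f t r - 2 * f t (r + eta) + f t (r + 2 * eta)) - 4 * (e + L * ka) <= Y) by (unfold Y; lra).
    assert (A * ((f t r - 2 * f t (r + eta) + f t (r + 2 * eta)) - 4 * (e + L * ka)) <= A * Y)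
      by (apply Rmult_le_compat_l; lra).
    lra. }
  assert (H1 : tau * (X - gap / 2) <= tau * (/ 2 * A * Y - j)) by (apply Rmult_le_compat_l; lra).
  assert (H2 : tau ^ 2 * C <= tau * (gap / 4)).
  { replace (tau ^ 2 * C) with (tau * (tau * C)) by ring. apply Rmult_le_compat_l; lra. }
  assert (H3 : (X - 3 * gap / 4) * tau <= D * tau) by lra.
  apply Rmult_le_reg_r in H3; [|lra]. unfold gap in *. lra.
Qed.

Let C := M + 1.
(** A strict supersolution of the heat equation with diffusivity one half. The factor [2 - r ^ 2]
    lies between 1 and 2 on [[0, 1]], so at time 0 the barrier exceeds [M], the largest possible gap
    between the two tails. *)
Definition bar (t r : R) : R := C * exp (- t / 4) * (2 - r ^ 2).

Lemma bar_cont_2d t r : continuity_2d_pt bar t r.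
Proof.
  unfold bar. apply continuity_2d_pt_mult.
  - apply (continuity_1d_2d_pt_comp (fun t => C * exp (- t / 4)) (fun t _ => t)); [|apply continuity_2d_pt_id1].
    eapply is_derive_continuity_pt; auto_derive; [trivial|reflexivity].
  - apply (continuity_1d_2d_pt_comp (fun r => 2 - r ^ 2) (fun _ r => r)); [|apply continuity_2d_pt_id2].
    eapply is_derive_continuity_pt; auto_derive; [trivial|reflexivity].
Qed.

Lemma bar_second t r h : bar t (r - h) - 2 * bar t r + bar t (r + h) = - (2 * (C * exp (- t / 4))) * h ^ 2.
Proof. unfold bar; ring. Qed.

Lemma bar_increment t r tau : 0 <= tau <= 1 -> 0 <= r <= 1 ->
  0 <= bar (t - tau) r - bar t r <= 2 / 3 * (C * exp (- t / 4)) * tau.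
Proof.
  intros Ht Hr. pose proof (exp_increment t tau Ht) as H.
  assert (H0 : 0 <= exp (- (t - tau) / 4) - exp (- t / 4)).
  { assert (exp (- t / 4) <= exp (- (t - tau) / 4)); [|lra].
    destruct (Req_dec tau 0) as [->|Hn]; [rewrite Rminus_0_r; lra|].
    left; apply exp_increasing; lra. }
  unfold bar. set (d := exp (- (t - tau) / 4) - exp (- t / 4)) in *.
  replace (C * exp (- (t - tau) / 4) * (2 - r ^ 2) - C * exp (- t / 4) * (2 - r ^ 2))
    with (C * ((2 - r ^ 2) * d)) by (unfold d; ring).
  replace (2 / 3 * (C * exp (- t / 4)) * tau) with (C * (2 * (exp (- t / 4) * (tau / 3)))) by field.
  assert (HC : 0 < C) by (unfold C; lra).
  assert (Hr2 : 0 <= r ^ 2 <= 1) by nra.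
  assert (0 <= (2 - r ^ 2) * d <= 2 * d) by nra.
  split; [apply Rmult_le_pos; lra|]. apply Rmult_le_compat_l; lra.
Qed.

Lemma bar_0 r : 0 <= r <= 1 -> C <= bar 0 r.
Proof.
  intros Hr. unfold bar. replace (- 0 / 4) with 0 by field. rewrite exp_0, Rmult_1_r.
  assert (HC : 0 < C) by (unfold C; lra). assert (r ^ 2 <= 1) by nra. nra.
Qed.

Lemma bar_bounds t r : 0 <= r <= 1 -> 0 < bar t r <= 2 * (C * exp (- t / 4)).
Proof.
  intros Hr. unfold bar. pose proof (exp_pos (- t / 4)).
  assert (HC : 0 < C * exp (- t / 4)) by (apply Rmult_lt_0_compat; [unfold C; lra|assumption]).
  assert (0 <= r ^ 2 <= 1) by nra. nra.
Qed.

Variables (T L de : R).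
Hypotheses (HT : 0 <= T) (HL : 0 < L) (Hde : 0 < de).
Hypothesis Hlip : forall t x y, t <= T -> Rabs (f t x - f t y) <= L * Rabs (x - y).
Hypothesis Heta1 : 2 * eta < 1.
Hypothesis Heta2 : 2 * eta * L <= de / 2.
Hypothesis Heta3 : 2 * eta * (M + 5 * j) <= de / 2.

Lemma g2_A t r : g2 rho t eta r = A * (f t r - 2 * f t (r + eta) + f t (r + 2 * eta)).
Proof.
  unfold g2, A, eta. assert (0 < INR N1) by (apply (lt_INR 0); lia). field; lra.
Qed.

(** A positive maximum of the difference is excluded at [t = 0] by [bar_0], at [r = 0] by mass
    conservation, and at the right end because [f] vanishes at 1 and is Lipschitz. An interior one
    contradicts the drift inequality. *)
Lemma upper_barrier t r : 0 <= t <= T -> 0 <= r <= 1 - 2 * eta ->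
  g t eta r <= Gst j M r + bar t r + de.
Proof.
  intros Ht Hr. pose proof (eta_pos N1 HN1) as He; fold eta in He.
  destruct (max_2d (fun t r => g t eta r - (Gst j M r + bar t r + de)) 0 T 0 (1 - 2 * eta))
    as [ts [rs [[Hts Hrs] Hmax]]]; [lra|lra| |].
  { intros x y Hx Hy. apply continuity_2d_pt_minus.
    - apply gF_cont_2d; try assumption; lra.
    - apply continuity_2d_pt_plus; [|apply continuity_2d_pt_const].
      apply continuity_2d_pt_plus; [apply Gst_cont_2d; assumption || lra | apply bar_cont_2d]. }
  destruct (Rle_dec (g ts eta rs - (Gst j M rs + bar ts rs + de)) 0) as [Hle|Hpos].
  { specialize (Hmax t r Ht Hr). cbv beta in Hmax. lra. }
  exfalso. apply Rnot_le_lt in Hpos.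
  destruct (gF_bounds rho rho_ge0 rho_cont ts eta rs He) as [B1 B2].
  destruct (Gst_bounds j M Hj HM rs ltac:(lra)) as [G1 G2].
  destruct (bar_bounds ts rs ltac:(lra)) as [Ba1 Ba2].
  assert (HfM : f ts rs <= M) by (apply (f_le_M j M rho xi0); assumption || lra).
  assert (Hts0 : 0 < ts).
  { destruct (Req_dec ts 0) as [->|Hn]; [|lra]. pose proof (bar_0 rs ltac:(lra)). unfold C in *; lra. }
  assert (Hrs0 : 0 < rs).
  { destruct (Req_dec rs 0) as [->|Hn]; [|lra]. rewrite (Gst_0 j M Hj HM) in Hpos. lra. }
  assert (Hdrop : forall x, f ts x - f ts (x + 2 * eta) <= de / 2).
  { intros x. pose proof (Hlip ts x (x + 2 * eta) ltac:(lra)) as H.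
    replace (x - (x + 2 * eta)) with (- (2 * eta)) in H by ring.
    rewrite Rabs_Ropp, (Rabs_right (2 * eta)) in H by lra. apply Rabs_le_between in H. lra. }
  assert (Hrs1 : rs < 1 - 2 * eta).
  { destruct (Req_dec rs (1 - 2 * eta)) as [Heq|Hn]; [|lra]. exfalso.
    specialize (Hdrop rs). rewrite Heq in Hdrop at 2.
    replace (1 - 2 * eta + 2 * eta) with 1 in Hdrop by ring. rewrite fF_1 in Hdrop. lra. }
  (* The offset [de] serves here: [g > de] at the maximum gives [f > de] at [rs], and the tail drops
     by at most [de / 2] across the hat. The upper drift inequality is thus available exactly where
     it is needed. *)
  assert (Hfpos : 0 < f ts (rs + 2 * eta)) by (specialize (Hdrop rs); lra).
  set (E := C * exp (- ts / 4)) in *.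
  assert (HE : 0 < E) by (apply Rmult_lt_0_compat; [unfold C; lra|apply exp_pos]).
  assert (HD : - (2 / 3 * E) <= / 2 * A * (f ts rs - 2 * f ts (rs + eta) + f ts (rs + 2 * eta)) - j).
  { apply (drift_up ts rs _ (Rmin 1 ts)); try assumption; [lra|apply Rmin_glb_lt; lra|].
    intros tau Htau. pose proof (Rmin_l 1 ts); pose proof (Rmin_r 1 ts).
    specialize (Hmax (ts - tau) rs ltac:(lra) ltac:(lra)). cbv beta in Hmax.
    pose proof (bar_increment ts rs tau ltac:(lra) ltac:(lra)) as H1. fold E in H1. lra. }
  assert (H2 : g2 rho ts eta rs <= 2 * j - 2 * E).
  { apply (second_derivative_at_max (g ts eta) (g1 rho ts eta) (g2 rho ts eta)
      (fun r => Gst j M r + bar ts r + de) rs (2 * j - 2 * E) (Rmin rs (1 - 2 * eta - rs))).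
    - intros; now apply gF_derive.
    - intros; now apply g1_derive.
    - now apply g2_continuous.
    - apply Rmin_glb_lt; lra.
    - intros h Hh. pose proof (Gst_semiconcave j M HM rs h). pose proof (bar_second ts rs h) as Hb.
      fold E in Hb. lra.
    - intros y Hy. pose proof (Rmin_l rs (1 - 2 * eta - rs)); pose proof (Rmin_r rs (1 - 2 * eta - rs)).
      specialize (Hmax ts y Hts ltac:(lra)). cbv beta in Hmax. lra. }
  (* The drift gives [- 2 / 3 * E <= g2 / 2 - j], the maximum gives [g2 / 2 - j <= - E], and
     [E > 0]. *)
  rewrite g2_A in H2. lra.
Qed.

(** Mirror image of the upper barrier. The roles at the boundary change: at [r = 0] the Lipschitz
    bound on [f] is used, at the right end that on [Gst]. *)
Lemma lower_barrier t r : 0 <= t <= T -> 0 <= r <= 1 - 2 * eta ->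
  Gst j M r - bar t r - de <= g t eta r.
Proof.
  intros Ht Hr. pose proof (eta_pos N1 HN1) as He; fold eta in He.
  destruct (max_2d (fun t r => (Gst j M r - bar t r - de) - g t eta r) 0 T 0 (1 - 2 * eta))
    as [ts [rs [[Hts Hrs] Hmax]]]; [lra|lra| |].
  { intros x y Hx Hy. apply continuity_2d_pt_minus.
    - apply continuity_2d_pt_minus; [|apply continuity_2d_pt_const].
      apply continuity_2d_pt_minus; [apply Gst_cont_2d; assumption || lra | apply bar_cont_2d].
    - apply gF_cont_2d; try assumption; lra. }
  destruct (Rle_dec ((Gst j M rs - bar ts rs - de) - g ts eta rs) 0) as [Hle|Hpos].
  { specialize (Hmax t r Ht Hr). cbv beta in Hmax. lra. }
  exfalso. apply Rnot_le_lt in Hpos.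
  destruct (gF_bounds rho rho_ge0 rho_cont ts eta rs He) as [B1 B2].
  destruct (Gst_bounds j M Hj HM rs ltac:(lra)) as [G1 G2].
  destruct (bar_bounds ts rs ltac:(lra)) as [Ba1 Ba2].
  assert (Hf0 : 0 <= f ts (rs + 2 * eta)) by (apply fF_ge0; try assumption; lra).
  assert (Hts0 : 0 < ts).
  { destruct (Req_dec ts 0) as [->|Hn]; [|lra]. pose proof (bar_0 rs ltac:(lra)). unfold C in *; lra. }
  assert (Hrs0 : 0 < rs).
  { destruct (Req_dec rs 0) as [->|Hn]; [|lra]. exfalso.
    pose proof (Hlip ts 0 (0 + 2 * eta) ltac:(lra)) as H.
    replace (0 - (0 + 2 * eta)) with (- (2 * eta)) in H by ring.
    rewrite Rabs_Ropp, (Rabs_right (2 * eta)) in H by lra. apply Rabs_le_between in H.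
    rewrite (mass_conserved j M rho xi0 Hj HM Hlim Hmass ts ltac:(lra)) in H. lra. }
  assert (Hrs1 : rs < 1 - 2 * eta).
  { destruct (Req_dec rs (1 - 2 * eta)) as [Heq|Hn]; [|lra]. exfalso.
    pose proof (Gst_lip j M Hj HM rs 1 ltac:(lra) ltac:(lra)) as H.
    rewrite (Gst_1 j M Hj HM), Heq in H. replace (1 - 2 * eta - 1) with (- (2 * eta)) in H by ring.
    rewrite Rabs_Ropp, (Rabs_right (2 * eta)), Rminus_0_r in H by lra. apply Rabs_le_between in H.
    rewrite Heq in Hpos at 1. lra. }
  set (E := C * exp (- ts / 4)) in *.
  assert (HE : 0 < E) by (apply Rmult_lt_0_compat; [unfold C; lra|apply exp_pos]).
  assert (HD : / 2 * A * (f ts rs - 2 * f ts (rs + eta) + f ts (rs + 2 * eta)) - j <= 2 / 3 * E).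
  { apply (drift_low ts rs _ (Rmin 1 ts)); try assumption; [lra|apply Rmin_glb_lt; lra|].
    intros tau Htau. pose proof (Rmin_l 1 ts); pose proof (Rmin_r 1 ts).
    specialize (Hmax (ts - tau) rs ltac:(lra) ltac:(lra)). cbv beta in Hmax.
    pose proof (bar_increment ts rs tau ltac:(lra) ltac:(lra)) as H1. fold E in H1. lra. }
  (* Since [g] and the barrier are nonnegative, a positive difference forces [Gst > de] at the
     maximum, so the contact region of the stationary profile is avoided. *)
  destruct (Gst_convex j M rs ltac:(lra) ltac:(lra)) as [h0 [Hh0 Hconv]].
  assert (H2 : - g2 rho ts eta rs <= - (2 * j + 2 * E)).
  { set (h1 := Rmin h0 (Rmin rs (1 - 2 * eta - rs))).
    assert (Hh1 : 0 < h1) by (repeat apply Rmin_glb_lt; lra).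
    assert (Hh1' : h1 <= h0) by apply Rmin_l.
    assert (Hh2 : h1 <= Rmin rs (1 - 2 * eta - rs)) by apply Rmin_r.
    pose proof (Rmin_l rs (1 - 2 * eta - rs)); pose proof (Rmin_r rs (1 - 2 * eta - rs)).
    apply (second_derivative_at_max (fun r => - g ts eta r) (fun r => - g1 rho ts eta r)
      (fun r => - g2 rho ts eta r)
      (fun r => - (Gst j M r - bar ts r - de)) rs (- (2 * j + 2 * E)) h1).
    - intros; apply (is_derive_opp (V := R_NormedModule) (g ts eta)); now apply gF_derive.
    - intros; apply (is_derive_opp (V := R_NormedModule) (g1 rho ts eta)); now apply g1_derive.
    - apply (continuous_opp (V := R_NormedModule) (g2 rho ts eta)); now apply g2_continuous.
    - assumption.
    - intros h Hh. specialize (Hconv h ltac:(lra)). pose proof (bar_second ts rs h) as Hb.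
      fold E in Hb. lra.
    - intros y Hy. specialize (Hmax ts y Hts ltac:(lra)). cbv beta in Hmax. lra. }
  rewrite g2_A in H2. lra.
Qed.

End Convergence.

(** * Removal of the hat width: exponential convergence of the tail *)

Section Rate.
Variables (j M : R) (rho : R -> R -> R) (xi0 : nat -> config).
Hypotheses (Hj : 0 < j) (HM : 0 <= M).
Hypothesis Hlim : forall zeta t, 0 < zeta -> 0 <= t ->
  is_lim_seq (fun n => Prob j n (hdl_event n zeta (rho t)) (INR n ^ 2 * t) (xi0 n)) 1.
Hypothesis Hmass : is_lim_seq (fun n => mdev n M (xi0 n)) 0.
Hypothesis rho_ge0 : forall t r, 0 <= t -> 0 <= r <= 1 -> 0 <= rho t r.
Hypothesis rho_cont : forall t r, 0 <= t -> 0 <= r <= 1 ->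
  filterlim (fun p : R * R => rho (fst p) (snd p))
    (within (fun p : R * R => 0 <= fst p /\ 0 <= snd p <= 1) (locally (t, r)))
    (locally (rho t r)).

(** For fixed [t] both [de] and the hat width may tend to 0, since the barriers depend on neither. A
    violation by [gap] is refuted with [de = gap / 4]: the total error is at most [3 de]. *)
Lemma exponential_convergence t r : 0 <= t -> 0 <= r <= 1 ->
  Rabs (fF rho t r - Gst j M r) <= 2 * ((M + 1) * exp (- t / 4)).
Proof.
  intros Ht Hr. apply Rnot_lt_le; intros Hlt.
  set (gap := Rabs (fF rho t r - Gst j M r) - 2 * ((M + 1) * exp (- t / 4))).
  assert (Hgap : 0 < gap) by (unfold gap; lra).
  destruct (fF_lip rho rho_ge0 rho_cont t) as [L [HL Hlip]].
  set (de := gap / 4). assert (Hde : 0 < de) by (unfold de; lra).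
  destruct (exists_small ((/ 2) :: (de / (4 * L)) :: (de / (4 * (M + 5 * j))) :: nil)) as [e [He Hel]].
  { intros x [<-|[<-|[<-|[]]]]; try lra; apply Rdiv_lt_0_compat; lra. }
  pose proof (Hel _ (or_introl eq_refl)) as E1.
  pose proof (Hel _ (or_intror (or_introl eq_refl))) as E2.
  pose proof (Hel _ (or_intror (or_intror (or_introl eq_refl)))) as E3.
  destruct (nfloor_ex (/ e)) as [q Hq]; [left; now apply Rinv_0_lt_compat|].
  set (N1 := S q). assert (HN1 : (1 <= N1)%nat) by (unfold N1; lia).
  set (eta := / INR N1).
  assert (Heta : 0 < eta < e).
  { unfold eta, N1. rewrite S_INR. pose proof (pos_INR q).
    split; [apply Rinv_0_lt_compat; lra|]. rewrite <- (Rinv_inv e).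
    apply Rinv_lt_contravar; [|lra]. apply Rmult_lt_0_compat; [now apply Rinv_0_lt_compat|lra]. }
  assert (H1 : 2 * eta < 1) by lra.
  assert (H2 : 2 * eta * L <= de / 2).
  { apply Rle_trans with (2 * (de / (4 * L)) * L); [apply Rmult_le_compat_r; lra | right; field; lra]. }
  assert (H3 : 2 * eta * (M + 5 * j) <= de / 2).
  { apply Rle_trans with (2 * (de / (4 * (M + 5 * j))) * (M + 5 * j));
      [apply Rmult_le_compat_r; lra | right; field; lra]. }
  assert (Hst : forall x y, 0 <= x <= 1 -> 0 <= y <= 1 -> Rabs (x - y) <= 2 * eta ->
    Rabs (fF rho t x - fF rho t y) <= de / 2 /\ Rabs (Gst j M x - Gst j M y) <= de / 2).
  { intros x y Hx Hy Hxy. split.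
    - eapply Rle_trans; [apply Hlip; lra|].
      eapply Rle_trans; [apply Rmult_le_compat_l; [lra|exact Hxy]|]. lra.
    - eapply Rle_trans; [apply Gst_lip; assumption || lra|].
      eapply Rle_trans; [apply Rmult_le_compat_l; [lra|exact Hxy]|]. lra. }
  (* The hat extends to the right by [2 eta], so points near 1 are moved left to keep its support
     inside [[0, 1]]. *)
  set (r' := Rmin r (1 - 2 * eta)).
  assert (Hr' : 0 <= r' <= 1 - 2 * eta /\ Rabs (r - r') <= 2 * eta /\ Rabs (r' + 2 * eta - r') <= 2 * eta).
  { unfold r', Rmin. destruct (Rle_dec r (1 - 2 * eta)); repeat split; try lra; apply Rabs_le_between; lra. }
  destruct Hr' as [R1 [R2 R3]].
  pose proof (upper_barrier j M rho xi0 Hj HM Hlim Hmass rho_ge0 rho_cont N1 HN1 t L de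
    Ht Hde Hlip H1 H2 t r' ltac:(lra) R1) as U.
  pose proof (lower_barrier j M rho xi0 Hj HM Hlim Hmass rho_ge0 rho_cont N1 HN1 t L de
    Ht Hde Hlip H1 H2 H3 t r' ltac:(lra) R1) as D.
  fold eta in U, D.
  destruct (gF_bounds rho rho_ge0 rho_cont t eta r' ltac:(lra)) as [B1 B2].
  destruct (bar_bounds M HM t r' ltac:(lra)) as [Ba1 Ba2].
  destruct (Hst r r' ltac:(lra) ltac:(lra) R2) as [S1 S2].
  destruct (Hst (r' + 2 * eta) r' ltac:(lra) ltac:(lra) R3) as [S3 _].
  apply Rabs_le_between in S1; apply Rabs_le_between in S2; apply Rabs_le_between in S3.
  assert (Hfin : Rabs (fF rho t r - Gst j M r) <= 2 * ((M + 1) * exp (- t / 4)) + 3 * de).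
  { apply Rabs_le_between. lra. }
  unfold de in Hfin. unfold gap in *. lra.
Qed.

End Rate.

Theorem theorem2p8 (j a b : R) (rho_init : R -> R) (M : R) (rho : R -> R -> R) :
  0 < j ->
  0 < a -> a < b -> b < 1 ->
  (forall r, 0 <= r <= 1 ->
     filterlim rho_init (within (fun x => 0 <= x <= 1) (locally r)) (locally (rho_init r))) ->
  (forall r, 0 <= r <= 1 -> 0 <= rho_init r) ->
  RInt rho_init 0 1 = M ->
  is_hydro_limit j a b rho_init rho ->
  forall delta, 0 < delta -> exists T, forall t, T <= t ->
    forall r, 0 <= r <= 1 -> Rabs (Fmac r (rho t) - Fmac r (rhoM j M)) <= delta.
Proof.
  intros Hj Ha Hab Hb Hcont Hpos HM [Hrho [Hrhoc [_ Hhyd]]] delta Hdelta.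
  destruct (approximation_exists rho_init Hcont Hpos a b Ha Hab Hb) as [xi0 [Hap Hmass]].
  pose proof (mass_ge0 rho_init Hcont Hpos) as HM0. rewrite HM in Hmass, HM0.
  specialize (Hhyd xi0 Hap).
  exists (8 * (M + 1) / delta); intros t Ht r Hr.
  assert (Ht0 : 0 < t).
  { eapply Rlt_le_trans; [|exact Ht]. apply Rdiv_lt_0_compat; lra. }
  rewrite Fmac_rhoM, <- fF_Fmac by (assumption || lra).
  eapply Rle_trans; [apply (exponential_convergence j M rho xi0); assumption || lra|].
  assert (H : exp (- t / 4) * t <= 4).
  { pose proof (exp_ineq1_le (t / 4)) as H. replace (- t / 4) with (- (t / 4)) by field.
    rewrite exp_Ropp. pose proof (exp_pos (t / 4)).
    apply (Rmult_le_reg_l (exp (t / 4))); [assumption|].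
    rewrite <- Rmult_assoc, Rinv_r by lra. lra. }
  apply (Rmult_le_compat_r delta) in Ht; [|lra].
  replace (8 * (M + 1) / delta * delta) with (8 * (M + 1)) in Ht by (field; lra).
  apply (Rmult_le_reg_r t); [assumption|]. nra.
Qed.
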